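(* Let $n\ge2$, $k_1\ge1$, $k_2\ge0$ and $0\le\alpha\le n-1$. The number of NBC bases of the gain graph $K_n^{[1-k_2,k_1+k_2]}$ with activity $\alpha$ equals the number of $(k_1,k_2)$-non-increasing $(k_1+k_2)$-colored rooted trees on $[n]$ having exactly $\alpha$ edges of the form $(n,i)$ colored $1$. In particular, the number of bounded regions of the arrangement associated with $K_n^{[1-k_2,k_1+k_2]}$ (taken in the hyperplane $x_1+\cdots+x_n=0$) equals the number of such trees with no edge of the form $(n,i)$ colored $1$. (For $k_1=1,k_2=0$ this is the Linial arrangement $x_j-x_i=1$, $1\le i<j\le n$, and the trees are uncolored.)
   Context: For integers $a\le b$, $K_n^{[a,b]}$ is the gain graph (over $\mathbb Z$) with vertex set $[n]$ and, for every $1\le i<j\le n$ and every integer $g\in[a,b]$, one edge from $i$ to $j$ with gain $g$ (gain $-g$ in the reverse direction), corresponding to the hyperplane $x_j-x_i=g$ in $\mathbb R^n$; the associated arrangement consists of all these hyperplanes. A circle is balanced if the sum of the gains along it, in a fixed direction, is $0$. Fix a linear order on the edges. A broken circuit is a balanced circle minus its smallest edge. An NBC set is an edge set forming a forest of the underlying multigraph (no circles, no two parallel edges) containing no broken circuit; an NBC basis is an NBC set which is a spanning tree. For an NBC basis $B$, $e\in B$ is active if $e$ is the smallest edge among all $f$ with $(B\setminus\{e\})\cup\{f\}$ a spanning tree; the activity of $B$ is the number of active edges (the counts do not depend on the order). A $k$-colored rooted tree on $[n]$ is a set of $n-1$ triples $(u,w,c)$, $u\neq w\in[n]$, $c\in[k]$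 (edge from parent $u$ to child $w$ with color $c$), each vertex a child at most once, with no cycle. For a vertex $v$ with at least one child let $c_v$ be the minimal color of edges from $v$ to its children. With $k=k_1+k_2$, the tree is $(k_1,k_2)$-non-increasing if for every vertex $v$ with a child and $c_v\le k_1$, at least one child $w$ joined to $v$ by an edge of color $c_v$ satisfies $w<v$. An edge of the form $(n,i)$ is one whose parent is $n$. *)

(* Defs.v *)
From HB Require Import structures.
From mathcomp Require Import all_boot all_order all_algebra.
From mathcomp Require Import all_classical all_reals all_analysis.
From mathcomp Require Import Rstruct Rstruct_topology.

Set Implicit Arguments.
Unset Strict Implicit.
Unset Printing Implicit Defensive.

Import Order.TTheory GRing.Theory Num.Theory.
Import numFieldNormedType.Exports.

(* Conventions: vertex i : 'I_n stands for vertex i+1 of [n]; so vertex n is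
   the ordinal with value n.-1.  Color c : 'I_k stands for color c+1.
   Edges of K_n^[a,b] are triples (i, j, g) with i < j and g : 'I_(|b-a|+1),
   the gain being a + g; the edge corresponds to the hyperplane x_j - x_i = a+g. *)

Section GainGraph.
Variables (n : nat) (a b : int).
Local Open Scope ring_scope.

Definition ngains : nat := (absz (b - a)).+1.
Definition gedge : finType := ('I_n * 'I_n * 'I_ngains)%type.
Definition gtail (e : gedge) : 'I_n := e.1.1.
Definition ghead (e : gedge) : 'I_n := e.1.2.
Definition gain (e : gedge) : int := a + (e.2 : nat)%:Z.
Definition Kedges : {set gedge} := [set e : gedge | (gtail e < ghead e)%N].

Definition joins (e : gedge) (u v : 'I_n) : bool :=
  ((gtail e == u) && (ghead e == v)) || ((gtail e == v) && (ghead e == u)).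
Definition dgain (e : gedge) (u v : 'I_n) : int :=
  if (gtail e == u) && (ghead e == v) then gain e else - gain e.

(* (vs, es) describes a circle: distinct vertices v_0..v_{m-1} (m >= 2),
   distinct edges e_0..e_{m-1} of the gain graph, e_t joining v_t and v_{t+1 mod m} *)
Definition circle_rep (C : {set gedge}) (vs : seq 'I_n) (es : seq gedge) : Prop :=
  [/\ (2 <= size vs)%N, size es = size vs, uniq vs & uniq es] /\
  [/\ {subset es <= Kedges},
      all (fun p => joins p.1 p.2.1 p.2.2) (zip es (zip vs (rot 1 vs)))
    & C = [set e in es]].

Definition is_circle (C : {set gedge}) : Prop :=
  exists vs es, circle_rep C vs es.

Definition balanced_circle (C : {set gedge}) : Prop :=
  exists vs es, circle_rep C vs es /\
    \sum_(p <- zip es (zip vs (rot 1 vs))) dgain p.1 p.2.1 p.2.2 = 0.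

(* r : linear order on the edges, given by an injective rank function *)
Variable r : gedge -> nat.

Definition min_edge (C : {set gedge}) (e : gedge) : Prop :=
  e \in C /\ forall f, f \in C -> (r e <= r f)%N.

Definition broken_circuit (D : {set gedge}) : Prop :=
  exists C e, [/\ balanced_circle C, min_edge C e & D = C :\ e].

Definition forest (B : {set gedge}) : Prop :=
  B \subset Kedges /\ forall C : {set gedge}, C \subset B -> ~ is_circle C.

Definition nbc_set (B : {set gedge}) : Prop :=
  forest B /\ forall D : {set gedge}, broken_circuit D -> ~ (D \subset B).

Definition adj (B : {set gedge}) : rel 'I_n :=
  fun u v => [exists e in B, joins e u v].

Definition spanning_tree (B : {set gedge}) : Prop :=
  forest B /\ forall u v, connect (adj B) u v.

Definition nbc_basis (B : {set gedge}) : Prop := nbc_set B /\ spanning_tree B.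

Definition active (B : {set gedge}) (e : gedge) : Prop :=
  e \in B /\ forall f, f \in Kedges -> spanning_tree ((B :\ e) :|: [set f]) ->
    (r e <= r f)%N.

Definition activity (B : {set gedge}) : nat := #|[set e in B | `[< active B e >]]|.

Definition nbc_count (alpha : nat) : nat :=
  #|[set B : {set gedge} | `[< nbc_basis B /\ activity B = alpha >]]|.

End GainGraph.

Section Trees.
Variables (n k : nat).

Definition ctedge : finType := ('I_n * 'I_n * 'I_k)%type.

Definition parent (T : {set ctedge}) : rel 'I_n :=
  fun u w => [exists c : 'I_k, (u, w, c) \in T].

Definition colored_rooted_tree (T : {set ctedge}) : Prop :=
  [/\ #|T| = n.-1,
      forall t, t \in T -> t.1.1 != t.1.2,
      forall w : 'I_n, (#|[set t in T | t.1.2 == w]| <= 1)%N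
    & forall u w, parent T u w -> ~~ connect (parent T) w u (* no cycle *)].

Definition min_child_color (T : {set ctedge}) (v : 'I_n) (c : 'I_k) : Prop :=
  (exists w, (v, w, c) \in T) /\ forall w c', (v, w, c') \in T -> (c <= c')%N.

(* (k1, k - k1)-non-increasing; colors are 0-based, so c_v <= k1 reads c < k1 *)
Definition non_increasing (k1 : nat) (T : {set ctedge}) : Prop :=
  forall v c, min_child_color T v c -> (c < k1)%N ->
    exists w : 'I_n, (v, w, c) \in T /\ (w < v)%N.

Definition n_edges_color1 (T : {set ctedge}) : nat :=
  #|[set t in T | (t.1.1 == n.-1 :> nat) && (t.2 == 0 :> nat)]|.

End Trees.

Definition tree_count (n k1 k2 alpha : nat) : nat :=
  #|[set T : {set ctedge n (k1 + k2)} |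
     `[< [/\ colored_rooted_tree T, non_increasing k1 T & n_edges_color1 T = alpha] >]]|.

Section Arrangement.
Local Open Scope ring_scope.
Local Open Scope classical_set_scope.
Variables (n : nat) (a b : int).
Local Open Scope ring_scope.

Definition hyperplane (e : gedge n a b) : set 'rV[Rdefinitions.R]_n :=
  [set x | x ord0 (ghead e) - x ord0 (gtail e) = (gain e)%:~R].

Definition sum0_space : set 'rV[Rdefinitions.R]_n := [set x | \sum_i x ord0 i = 0].

Definition arr_complement : set 'rV[Rdefinitions.R]_n :=
  [set x | sum0_space x /\ forall e, e \in Kedges n a b -> ~ hyperplane e x].

Definition region (A : set 'rV[Rdefinitions.R]_n) : Prop :=
  exists2 x, arr_complement x & A = connected_component arr_complement x.

Definition num_bounded_regions (N : nat) : Prop :=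
  exists F : 'I_N -> set 'rV[Rdefinitions.R]_n, injective F /\
    forall A, (region A /\ bounded_set A) <-> exists i, A = F i.

End Arrangement.

(* Main.v *)
From HB Require Import structures.
From mathcomp Require Import all_boot all_order all_algebra.
From mathcomp Require Import all_classical all_reals all_analysis.
From mathcomp Require Import Rstruct Rstruct_topology.
From mathcomp Require Import zify ring lra.
Require Import Defs.
From mathcomp Require Import fintype finset.


(* Write K = k1 + k2, q = k1 + 1, and w(d) = sum over v of (k2 + d v) for
   d : [n] -> {0, .., q - 1}.  Both generating polynomials, of NBC bases by activity
   and of trees by colour-1 edges at n, equal q^-n * sum over d of (X + w(d) - 1)^(n-1).

   NBC side.  Each NBC set S lies in exactly one interval [B \ act B, B] of an NBC
   basis B, the minimum spanning tree containing S, so the activity polynomial is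
   determined by the numbers of NBC sets of each size.  By Whitney's theorem these give
   the number of x in (Z/m)^n avoiding all hyperplanes, for m large.  Such an x is
   counted by reading the points around the circle: a gap of at least k2 is uniquely
   (k2 + d) + q b with 0 <= d < q, and b = 0 forces a descent of labels, so x amounts to
   d together with a distribution of the labels into boxes.

   Tree side.  In the ring of set functions under subset convolution, let tau_v be the
   series of trees rooted at v and P_v the product of 1 + tau_i over i >= v.  The local
   condition reads tau_v = x_v (H - G P_(v+1)), and P / (H - G P) is multiplied by
   1 + x_v H at each step; hence E^q = prod (1 + x_v H) for E = P_1, and the coefficients
   of E^y follow by an Abel-type identity.  E^y counts forests by number of trees, and
   hanging the other trees below n by edges of colour 1 turns forests into trees.

   Regions.  Cells are sign vectors; a cell is bounded exactly when the digraph of its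
   inequalities is strongly connected, and deletion-restriction shows that bounded cells
   are counted by the alternating sum over the feasible sets of hyperplanes, which is the
   number of NBC bases without active edge. *)

Set Implicit Arguments.
Unset Strict Implicit.
Unset Printing Implicit Defensive.

Import Order.TTheory GRing.Theory Num.Theory.
Local Open Scope ring_scope.

(** * Circles, forests and potentials *)

Section Circles.
Variables (n : nat) (a b : int).
Local Notation G := (gedge n a b).
Local Notation K := (Kedges n a b).

(** No bijection between bases and trees is built: both counts are coefficients of polynomials over
    [rat], compared through their values. The shift by one in the variable arises differently on the
    two sides: a colouring count modulo [m] is the activity polynomial at [1 - m], while choosing
    which colour-1 edges at the last vertex to cut turns a weight [y] per tree into [1 + y] per such
    edge.

    Working modulo [m] makes the points cyclic, so that one label can be pinned at 0; [m] must
    exceed every circle sum, so that balance modulo [m] is balance in the integers. The tree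
    condition compares labels, which exponential series in one variable forget; set functions keep
    them, and the product over disjoint sets makes every tree series square to zero. The functional
    equation gives [E^y] directly only for [y] a multiple of [q]. Polynomiality in [y] supplies the
    rest, and it is needed inside the recursion itself, whose exponents w(B) are arbitrary. *)

Definition dval (V : zmodType) (g : G -> V) (e : G) (u v : 'I_n) : V :=
  if (gtail e == u) && (ghead e == v) then g e else - g e.

(** With integer gains this is the sum in [balanced_circle]; the other value groups serve for
    residues, reals and the zero gain. *)
Definition circle_sum (V : zmodType) (g : G -> V) vs es : V :=
  \sum_(p <- zip es (zip vs (rot 1 vs))) dval g p.1 p.2.1 p.2.2.

Definition defect (V : zmodType) (g : G -> V) (x : 'I_n -> V) (e : G) : V :=
  g e - (x (ghead e) - x (gtail e)).

(** [defect g x] differs from [g] by a coboundary; around a closed walk the heads are the tails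
    rotated by one place, so it telescopes. *)
Lemma circle_sum_defect (V : zmodType) (g : G -> V) x C vs es :
  circle_rep C vs es -> circle_sum (defect g x) vs es = circle_sum g vs es.
Proof.
case=> [[_ szE _ _] [_ /allP hj _]].
rewrite /circle_sum.
have szz : size es = size (zip vs (rot 1 vs)) by rewrite size1_zip ?size_rot.
under eq_big_seq => p /hj pj.
  have -> : dval (defect g x) p.1 p.2.1 p.2.2
      = dval g p.1 p.2.1 p.2.2 - (x p.2.2 - x p.2.1).
    rewrite /dval /defect; case: ifP => [/andP[/eqP-> /eqP->]//|h].
    by move: pj; rewrite /joins h /= => /andP[/eqP-> /eqP->]; rewrite opprD opprK [in RHS]opprB.
  over.
rewrite /= sumrB.
suff -> : \sum_(p <- zip es (zip vs (rot 1 vs))) (x p.2.2 - x p.2.1) = 0.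
  by rewrite subr0.
have -> : \sum_(p <- zip es (zip vs (rot 1 vs))) (x p.2.2 - x p.2.1)
    = \sum_(q <- zip vs (rot 1 vs)) (x q.2 - x q.1).
  rewrite -[in RHS](@unzip2_zip _ _ es (zip vs (rot 1 vs))) ?szz //.
  by rewrite /unzip2 big_map.
rewrite sumrB.
rewrite -(big_map (fun q => q.2) predT x) -(big_map (fun q => q.1) predT x).
rewrite -/(unzip1 _) -/(unzip2 _) unzip1_zip ?unzip2_zip ?size_rot //.
by rewrite (perm_big vs) ?subrr //; rewrite perm_rot.
Qed.

Lemma big_unzip1_single (V : zmodType) (T : eqType) (L : seq (G * T)) (F : G * T -> V) e :
  uniq (unzip1 L) -> e \in unzip1 L ->
  (forall p, p.1 != e -> p \in L -> F p = 0) ->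
  exists t, \sum_(p <- L) F p = F (e, t).
Proof.
elim: L => //= -[f t] L IH /= /andP[fL uL]; rewrite inE => /orP[/eqP->|eL] h.
- exists t; rewrite big_cons [X in _ + X]big1_seq ?addr0 //.
  move=> /= p pL; apply: h; last by rewrite inE pL orbT.
  by apply: contraNneq fL => <-; apply: map_f.
- have [p pne pL|t' ht'] := IH uL eL.
    by apply: h; rewrite ?inE ?pL ?orbT.
  exists t'; rewrite big_cons ht' h ?add0r //= ?inE ?eqxx //.
  by apply: contraNneq fL => ->.
Qed.

(** The edges of a circle are distinct, so [e] occurs once in the sum, up to sign, and nothing else
    contributes. *)
Lemma circle_sum_eq0 (V : zmodType) (g : G -> V) C vs es (e : G) :
  circle_rep C vs es -> e \in C -> (forall f, f \in C -> f != e -> g f = 0) ->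
  circle_sum g vs es = 0 -> g e = 0.
Proof.
case=> [[_ szE _ uE] [_ _ CE]] eC h.
have szz : size es = size (zip vs (rot 1 vs)) by rewrite size1_zip ?size_rot.
rewrite /circle_sum.
case: (@big_unzip1_single V _ (zip es (zip vs (rot 1 vs)))
  (fun p => dval g p.1 p.2.1 p.2.2) e) => [||p pe pL|t ->].
- by rewrite unzip1_zip ?szz.
- by rewrite unzip1_zip ?szz //; move: eC; rewrite CE inE.
- have pC : p.1 \in C.
    rewrite CE inE -(@unzip1_zip _ _ es (zip vs (rot 1 vs))) ?szz //.
    exact: map_f.
  by rewrite /dval h // oppr0 if_same.
- by rewrite /dval /=; case: ifP => // _ /eqP; rewrite oppr_eq0 => /eqP.
Qed.

Lemma circle_sum_sat (V : zmodType) (g : G -> V) x C vs es :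
  circle_rep C vs es -> (forall f, f \in C -> x (ghead f) - x (gtail f) = g f) ->
  circle_sum g vs es = 0.
Proof.
move=> hC h; rewrite -(circle_sum_defect g x hC) /circle_sum.
have [[_ szE _ _] [_ _ CE]] := hC.
have szz : size es = size (zip vs (rot 1 vs)) by rewrite size1_zip ?size_rot.
apply: big1_seq => p /= pL.
have pC : p.1 \in C.
  rewrite CE inE -(@unzip1_zip _ _ es (zip vs (rot 1 vs))) ?szz //.
  exact: map_f.
by rewrite /dval /defect h // subrr oppr0 if_same.
Qed.

(** The defect of such a potential is supported on [e] alone, where it must vanish. Hence the last
    equation along a balanced circle is redundant. *)
Lemma circle_sum_complete (V : zmodType) (g : G -> V) x C vs es (e : G) :
  circle_rep C vs es -> e \in C ->
  (forall f, f \in C -> f != e -> x (ghead f) - x (gtail f) = g f) ->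
  circle_sum g vs es = 0 -> x (ghead e) - x (gtail e) = g e.
Proof.
move=> hC eC h; rewrite -(circle_sum_defect g x hC) => s0.
apply/eqP; rewrite eq_sym -subr_eq0; apply/eqP.
apply: (circle_sum_eq0 hC eC _ s0) => f fC fe.
by rewrite /defect h // subrr.
Qed.

Lemma adj_sym (S : {set G}) : symmetric (adj S).
Proof.
by move=> u v; apply/eq_existsb => e; rewrite /joins orbC.
Qed.

Lemma connect_adj_sym (S : {set G}) : connect_sym (adj S).
Proof. exact: sym_connect_sym (adj_sym S). Qed.

Lemma adj_edge (S : {set G}) (e : G) : e \in S -> adj S (gtail e) (ghead e).
Proof. by move=> eS; apply/existsP; exists e; rewrite eS /joins !eqxx. Qed.

Lemma connect_edge (S : {set G}) u (e : G) :
  e \in S -> connect (adj S) u (gtail e) = connect (adj S) u (ghead e).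
Proof.
by move=> eS; apply/same_connect_r/connect1/adj_edge => //; apply: connect_adj_sym.
Qed.

Lemma adj_sub (S S' : {set G}) u v : S \subset S' -> adj S u v -> adj S' u v.
Proof.
move=> sS /existsP[e /andP[eS je]]; apply/existsP; exists e.
by rewrite (subsetP sS).
Qed.

Lemma connect_adj_sub (S S' : {set G}) u v :
  S \subset S' -> connect (adj S) u v -> connect (adj S') u v.
Proof.
by move=> sS; apply: connect_sub => x y /(adj_sub sS)/connect1.
Qed.

(* The indicator of a connected component is a potential for the zero gain,
   so a circle cannot leave the component through a single edge. *)
Lemma connect_circle (S C : {set G}) (e : G) u :
  is_circle C -> e \in C -> C :\ e \subset S ->
  connect (adj S) u (gtail e) = connect (adj S) u (ghead e).
Proof.
move=> [vs [es hC]] eC sCS.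
pose x v : int := (connect (adj S) u v : nat)%:Z.
have /eqP : x (ghead e) - x (gtail e) = 0.
  apply: (@circle_sum_complete int (fun=> 0) x C vs es e hC eC).
    move=> f fC fe; apply/eqP; rewrite subr_eq0 /x (@connect_edge S u f) //.
    by apply: (subsetP sCS); rewrite !inE fe.
  by rewrite /circle_sum big1 // => p _; rewrite /dval oppr0 if_same.
by rewrite subr_eq0 => /eqP[]; do 2!case: connect.
Qed.

(** A simple path repeats no edge: its first vertex never recurs, while later edges have both ends
    among the later vertices. *)
Lemma path_edges (S : {set G}) u p :
  path (adj S) u p -> uniq (u :: p) ->
  exists es, [/\ size es = size p, {subset es <= S}, uniq es,
    all (fun q => joins q.1 q.2.1 q.2.2) (zip es (zip (belast u p) p)) &
    forall e, e \in es -> (gtail e \in u :: p) && (ghead e \in u :: p)].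
Proof.
elim: p u => [|v p IH] u /=; first by exists [::].
case/andP=> /existsP[e /andP[eS je]] pp /andP[up uvp].
have [es [sz sub ues al en]] := IH v pp uvp.
have eends : (gtail e \in [:: u, v & p]) && (ghead e \in [:: u, v & p]).
  by move: je => /orP[]/andP[/eqP-> /eqP->]; rewrite !inE !eqxx ?orbT.
exists (e :: es); split => //=.
- by rewrite sz.
- by move=> f; rewrite inE => /orP[/eqP->//|/sub].
- rewrite ues andbT; apply: contra up => /en /andP[].
  by move: je => /orP[]/andP[/eqP-> /eqP->].
- by rewrite je al.
- move=> f; rewrite inE => /orP[/eqP->//|/en].
  by case/andP => h1 h2; rewrite [_ \in [:: u, v & p]]inE h1 orbT inE h2 orbT.
Qed.

Lemma connect_add_circle (S : {set G}) (e : G) :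
  S \subset K -> e \in K -> e \notin S -> connect (adj S) (gtail e) (ghead e) ->
  exists2 C, is_circle C & C \subset e |: S.
Proof.
move=> SK eK eS /connectP[p0 pp0].
case/shortenP: pp0 => p pp up _ lp.
have [es [sz sub ues al _]] := path_edges pp up.
exists [set f in rcons es e].
  exists (gtail e :: p), (rcons es e); split; split => //.
  (* A circle needs two vertices: the path is non-empty because [gtail e < ghead e]. A path of one
     step gives a pair of parallel edges. *)
  - case: p lp {pp up al sz} => //= te; move: eK; rewrite inE.
    by rewrite te ltnn.
  - by rewrite size_rcons /= sz.
  - by rewrite rcons_uniq ues andbT; apply: contra eS => /sub.
  - by move=> f; rewrite mem_rcons inE => /orP[/eqP->//|/sub/(subsetP SK)].
  - rewrite rot1_cons {1}lastI !zip_rcons ?size_belast // ?size1_zip ?size_belast //.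
    by rewrite all_rcons al /joins -lp !eqxx ?orbT.
apply/subsetP => f; rewrite !inE mem_rcons inE => /orP[->//|/sub->].
by rewrite orbT.
Qed.

Lemma forest_sub (S S' : {set G}) : S' \subset S -> forest S -> forest S'.
Proof.
move=> sS [SK nC]; split; first exact: subset_trans SK.
by move=> C CS; apply: nC; apply: subset_trans CS sS.
Qed.

Lemma forest_setU1 (S : {set G}) (e : G) : e \in K -> e \notin S -> forest S ->
  forest (e |: S) <-> ~~ connect (adj S) (gtail e) (ghead e).
Proof.
move=> eK eS fS; have [SK nC] := fS; split.
  move=> [_ nC']; apply/negP => /(connect_add_circle SK eK eS)[C cC CS].
  exact: nC' CS cC.
move=> nc; split; first by rewrite subUset sub1set eK.
move=> C CS cC; have [eC|eC] := boolP (e \in C).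
  move/negP: nc; apply.
  rewrite -(@connect_circle S C e (gtail e)) //.
  by apply/subsetP => f; rewrite !inE => /andP[fe /(subsetP CS)]; rewrite !inE (negPf fe).
apply: (nC C) => //; apply/subsetP => f fC.
have := subsetP CS f fC; rewrite !inE => /orP[/eqP fe|//].
by rewrite -fe fC in eC.
Qed.

(** The basic move on potentials: translating a whole component of [S] preserves every edge of [S]
    and alters by [w] an edge whose head alone lies in it. *)
Definition shift (V : zmodType) (S : {set G}) u (w : V) (x : 'I_n -> V) v : V :=
  x v + (if connect (adj S) u v then w else 0).

Lemma shift_edge (V : zmodType) (S : {set G}) u (w : V) x (e : G) : e \in S ->
  shift S u w x (ghead e) - shift S u w x (gtail e) = x (ghead e) - x (gtail e).
Proof.
by move=> eS; rewrite /shift (connect_edge u eS) opprD addrACA subrr addr0.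
Qed.

Lemma shift_nedge (V : zmodType) (S : {set G}) (w : V) x (e : G) :
  ~~ connect (adj S) (gtail e) (ghead e) ->
  shift S (ghead e) w x (ghead e) - shift S (ghead e) w x (gtail e)
  = x (ghead e) - x (gtail e) + w.
Proof.
by rewrite connect_adj_sym => /negPf h; rewrite /shift connect0 h addr0 addrAC.
Qed.

Definition sat (V : zmodType) (g : G -> V) (S : {set G}) (x : 'I_n -> V) :=
  [forall e in S, x (ghead e) - x (gtail e) == g e].

Lemma satP (V : zmodType) (g : G -> V) (S : {set G}) x :
  reflect (forall e : G, e \in S -> x (ghead e) - x (gtail e) = g e) (sat g S x).
Proof. by apply: (iffP forall_inP) => h e /h /eqP. Qed.

Lemma sat_setU1 (V : zmodType) (g : G -> V) (S : {set G}) (e : G) x :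
  sat g (e |: S) x = (x (ghead e) - x (gtail e) == g e) && sat g S x.
Proof.
apply/satP/andP => [h|[/eqP h1 /satP h2] f].
  split; first by apply/eqP/h; rewrite setU11.
  by apply/satP => f fS; apply: h; rewrite setU1r.
by rewrite !inE => /orP[/eqP->//|/h2].
Qed.

Lemma sat_add (V : zmodType) (g : G -> V) (S : {set G}) (e : G) x : sat g S x ->
  ~~ connect (adj S) (gtail e) (ghead e) -> exists x', sat g (e |: S) x'.
Proof.
move=> /satP sx nc.
exists (shift S (ghead e) (defect g x e) x); rewrite sat_setU1; apply/andP; split.
  by rewrite shift_nedge // /defect addrC subrK.
by apply/satP => f fS; rewrite shift_edge // sx.
Qed.

Lemma forest_ind (Pr : {set G} -> Prop) : Pr set0 ->
  (forall (S : {set G}) (e : G), e \in K -> e \notin S -> forest S -> ~~ connect (adj S) (gtail e) (ghead e) ->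
     Pr S -> Pr (e |: S)) ->
  forall S : {set G}, forest S -> Pr S.
Proof.
move=> P0 PS S; have [k] := ubnP #|S|; elim: k S => // k IH S.
have [->//|[e eS]] := set_0Vmem S.
rewrite (cardsD1 e) eS => /= hk fS.
have sS : S :\ e \subset S by apply: subsetDl.
have fS' := forest_sub sS fS.
have eK : e \in K by apply: (subsetP fS.1).
rewrite -(setD1K eS); apply: PS => //; rewrite ?setD11 //.
  by apply/(forest_setU1 eK _ fS'); rewrite ?setD11 ?setD1K.
exact: IH.
Qed.

Lemma forest_sat (V : zmodType) (g : G -> V) (S : {set G}) : forest S -> exists x, sat g S x.
Proof.
elim/forest_ind => [|{}S e eK eS fS nc [x sx]]; last exact: sat_add sx nc.
by exists (fun=> 0); apply/satP => e; rewrite inE.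
Qed.

Definition sols (V : finZmodType) (g : G -> V) (S : {set G}) : {set {ffun 'I_n -> V}} :=
  [set x : {ffun 'I_n -> V} | sat g S x].

(** Each forest edge divides the number of solutions by [#|V|]: translating the component of its
    head by an arbitrary amount maps solutions with the edge, times [V], bijectively onto solutions
    without it. *)
Lemma card_sols (V : finZmodType) (g : G -> V) (S : {set G}) : forest S ->
  (#|sols g S| * #|V| ^ #|S| = #|V| ^ n)%N.
Proof.
elim/forest_ind => [|{}S e eK eS fS nc IH].
  rewrite cards0 expn0 muln1.
  have -> : sols g set0 = [set: {ffun 'I_n -> V}].
    by apply/setP => x; rewrite !inE; apply/satP => e; rewrite inE.
  by rewrite cardsT card_ffun card_ord.
rewrite -IH cardsU1 eS expnD expn1 mulnA; congr (_ * _)%N.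
pose h (p : {ffun 'I_n -> V} * V) : {ffun 'I_n -> V} :=
  [ffun v => shift S (ghead e) p.2 p.1 v].
have hE (p : {ffun 'I_n -> V} * V) f : f \in S ->
    h p (ghead f) - h p (gtail f) = p.1 (ghead f) - p.1 (gtail f).
  by move=> fS'; rewrite !ffunE shift_edge.
have hE' p : h p (ghead e) - h p (gtail e) = p.1 (ghead e) - p.1 (gtail e) + p.2.
  by rewrite !ffunE shift_nedge.
rewrite -[#|V|]cardsT -cardsX -(@card_in_imset _ _ h).
  apply: eq_card => x; apply/imsetP/idP => [[[y w]]|].
    rewrite !inE => /andP[/= + _] ->; rewrite sat_setU1 => /andP[_ /satP hy].
    by apply/satP => f fS'; rewrite hE //= hy.
  rewrite inE => /satP sx.
  pose w := defect g x e.
  exists ([ffun v => shift S (ghead e) w x v], - w).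
    rewrite !inE andbT sat_setU1; apply/andP; split.
      by rewrite !ffunE shift_nedge // addrC subrK.
    by apply/satP => f fS'; rewrite !ffunE shift_edge // sx.
  apply/ffunP => v; rewrite !ffunE /shift !ffunE /shift.
  by case: ifP; rewrite ?addr0 // -addrA subrr addr0.
move=> [y w] [y' w']; rewrite !inE /= !sat_setU1 !andbT.
move=> /andP[/eqP ey _] /andP[/eqP ey' _] hh.
have ew : w = w'.
  have := hE' (y, w); rewrite hh hE' /= ey ey' => /addrI ->.
  by [].
rewrite ew in hh *; congr (_, _); apply/ffunP => v.
move/ffunP/(_ v): hh; rewrite !ffunE /shift /=; exact: addIr.
Qed.

(** Zero gain over ['I_2]: on a connected graph only the two constants are solutions, so [card_sols]
    reads [2 * 2 ^ #|S| = 2 ^ n]. *)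
Lemma spanning_sol_card (S : {set G}) : (0 < n)%N -> spanning_tree S -> #|S| = n.-1.
Proof.
move=> n0 [fS cS].
pose v0 := Ordinal n0.
have := @card_sols 'I_2 (fun=> 0) S fS.
have -> : #|sols (fun=> 0 : 'I_2) S| = 2.
  rewrite -[RHS](card_ord 2) -(@card_imset _ _ (fun w : 'I_2 => [ffun _ : 'I_n => w])).
    apply: eq_card => x; apply/idP/imsetP => [|[w _ ->]]; last first.
      by rewrite inE; apply/satP => e _; rewrite !ffunE subrr.
    rewrite inE => /satP sx; exists (x v0) => //; apply/ffunP => v; rewrite ffunE.
    have /connectP[p + ->] := cS v0 v.
    elim: p {v0} (v0) => //= w p IH u /andP[/existsP[e /andP[eS je]] pp].
    rewrite (IH _ pp) //; move/eqP: (sx _ eS); rewrite subr_eq0 => /eqP.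
    by move: je => /orP[]/andP[/eqP-> /eqP->] ->.
  by move=> w w' /ffunP/(_ v0); rewrite !ffunE.
rewrite card_ord -expnS => /eqP; rewrite eqn_exp2l // => /eqP nE.
by rewrite -[RHS](congr1 predn nE).
Qed.

End Circles.

(** * Broken circuits and activity *)

Lemma sum_subset_expr (T : finType) (R : comNzRingType) (D : {set T}) (t : R) :
  \sum_(A : {set T} | A \subset D) t ^+ #|A| = (1 + t) ^+ #|D|.
Proof.
transitivity (\prod_i (if i \in D then t + 1 else 1 : R)); last first.
  by rewrite -big_mkcond prodr_const addrC.
transitivity (\prod_i ((if i \in D then t else 0) + 1 : R)); last first.
  by apply: eq_bigr => i _; case: ifP => _ //; rewrite add0r.
rewrite bigA_distr big_mkcond /=; apply: eq_bigr => A _.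
rewrite -big_mkcond /=; case: ifP => [sA|/negbT].
  rewrite -prodr_const; apply: eq_bigr => i iA.
  by rewrite (subsetP sA).
move/subsetPn => [i iA iD]; rewrite (bigD1 i) //= (negPf iD) mul0r //.
Qed.

Section Bases.
Variables (n : nat) (a b : int).
Local Notation G := (gedge n a b).
Local Notation K := (Kedges n a b).
Variable r : G -> nat.
Hypothesis n_gt0 : (0 < n)%N.
Hypothesis r_inj : {in K &, injective r}.

Lemma circle_subK (C : {set G}) : is_circle C -> C \subset K.
Proof.
by move=> [vs [es [_ [sub _ ->]]]]; apply/subsetP => e; rewrite inE => /sub.
Qed.

Lemma forest_setD1_nconnect (S : {set G}) (f : G) : forest S -> f \in S ->
  ~~ connect (adj (S :\ f)) (gtail f) (ghead f).
Proof.
move=> fS fiS; have fS' : forest (S :\ f) by apply: forest_sub fS; apply: subsetDl.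
have fK : f \in K by apply: (subsetP fS.1).
by apply/(forest_setU1 fK _ fS'); rewrite ?setD11 ?setD1K.
Qed.

(** The rest of the circle still joins the ends of [f]. Conversely, were the ends of [e] joined
    without [f], the circle could not leave the component of [gtail f], against [f] being a bridge
    of [B]. *)
Lemma exchange_circle (B C : {set G}) (e f : G) :
  spanning_tree B -> is_circle C -> e \in C -> C :\ e \subset B ->
  f \in C -> f \in B -> spanning_tree ((B :\ f) :|: [set e]).
Proof.
move=> [fB cB] cC eC sCB fC fiB.
have eB : e \notin B.
  apply/negP => eB; apply: (fB.2 C) => //.
  by rewrite -(setD1K eC) subUset sub1set eB.
have fe : f != e by apply: contraNneq eB => <-.
have eK : e \in K by apply: (subsetP (circle_subK cC)).
have fB' : forest (B :\ f) by apply: forest_sub fB; apply: subsetDl.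
rewrite setUC.
have cE u v : connect (adj (e |: B :\ f)) u v.
  have /connectP[p + ->] := cB u v.
  elim: p u => //= w p IH u /andP[/existsP[g /andP[gB jg]] pp].
  apply: connect_trans (IH _ pp).
  have cg : connect (adj (e |: B :\ f)) (gtail g) (ghead g).
    have [->|gf] := eqVneq g f.
      rewrite -(@connect_circle _ _ _ _ C f (gtail f)) //.
      apply/subsetP => h; rewrite !inE => /andP[hf hC]; rewrite hf /=.
      have [//|he] := eqVneq h e; apply: (subsetP sCB); by rewrite !inE he.
    by apply/connect1/adj_edge; rewrite !inE gf gB orbT.
  by move: jg => /orP[]/andP[/eqP<- /eqP<-] //; rewrite connect_adj_sym.
split => //.
apply/(forest_setU1 eK _ fB'); first by rewrite !inE (negPf eB) andbF.
apply/negP => ce; move: (forest_setD1_nconnect fB fiB) => /negP; apply.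
pose S := B :\ f.
have eqe g : g \in C -> g != f -> connect (adj S) (gtail f) (gtail g) = connect (adj S) (gtail f) (ghead g).
  move=> gC gf; have [->|ge] := eqVneq g e.
    by apply/same_connect_r => //; apply: connect_adj_sym.
  by apply: connect_edge; rewrite !inE gf; apply: (subsetP sCB); rewrite !inE ge.
have [vs [es hC]] := cC.
pose x v : int := (connect (adj S) (gtail f) v : nat)%:Z.
have /eqP : x (ghead f) - x (gtail f) = 0.
  apply: (@circle_sum_complete _ _ _ int (fun=> 0) x C vs es f hC fC).
    by move=> g gC gf; apply/eqP; rewrite subr_eq0 /x eqe.
  by rewrite /circle_sum big1 // => p _; rewrite /dval oppr0 if_same.
by rewrite subr_eq0 /x connect0; case: connect.
Qed.

Lemma exists_joins (u v : 'I_n) : u != v -> exists2 e : G, e \in K & joins e u v.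
Proof.
move=> uv; have [lt|gt|eq] := ltngtP u v; last by case/eqP: uv; apply: val_inj.
  by exists (u, v, ord0); rewrite ?inE // /joins /= !eqxx.
by exists (v, u, ord0); rewrite ?inE // /joins /= !eqxx orbT.
Qed.

Lemma forest_spanning (S : {set G}) : forest S -> exists2 B, spanning_tree B & S \subset B.
Proof.
move=> fS; have [|B /maxsetP[/asboolP fB mB] sB] := @maxset_exists _ (fun S : {set G} => `[< forest S >]) S.
  exact/asboolP.
exists B => //; split => // u v; apply/negPn/negP => nc.
have uv : u != v by apply: contraNneq nc => ->.
have [e eK je] := exists_joins uv.
have nce : ~~ connect (adj B) (gtail e) (ghead e).
  by apply: contra nc; move: je => /orP[]/andP[/eqP-> /eqP->] //; rewrite connect_adj_sym.
have eB : e \notin B by apply: contra nce => /adj_edge/connect1.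
have /asboolP fe : forest (e |: B) by apply/forest_setU1.
have := mB _ fe (subsetUr _ _) => /setP/(_ e); rewrite setU11 (negPf eB) //.
Qed.

(** The circle that [e] closes in [B'] is not contained in the forest [B]; any of its edges outside
    [B] can be exchanged. *)
Lemma spanning_exchange (B B' : {set G}) (e : G) : spanning_tree B -> spanning_tree B' ->
  e \in B -> e \notin B' -> exists f, [/\ f \in B', f \notin B &
    spanning_tree ((B' :\ f) :|: [set e])].
Proof.
move=> tB tB' eB eB'; have eK : e \in K by apply: (subsetP tB.1.1).
have [C cC sC] := connect_add_circle tB'.1.1 eK eB' (tB'.2 _ _).
have /subsetPn[f fC fB] : ~~ (C \subset B) by apply/negP => /(tB.1.2 C).
have eC : e \in C.
  have [//|eC] := boolP (e \in C); case: (tB'.1.2 C) => //.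
  apply/subsetP => g gC; have := subsetP sC _ gC; rewrite !inE => /orP[/eqP ge|//].
  by rewrite -ge gC in eC.
have sCB : C :\ e \subset B'.
  by apply/subsetP => g; rewrite !inE => /andP[/negPf ge /(subsetP sC)]; rewrite !inE ge.
have fe : f != e by apply: contraNneq fB => ->.
have fB' : f \in B' by apply: (subsetP sCB); rewrite !inE fe.
by exists f; split => //; apply: exchange_circle cC _ _ _ _.
Qed.

Definition actset (B : {set G}) := [set e in B | `[< active r B e >]].

(** Membership of [S] in the interval from [B] without its active edges up to [B]. *)
Definition completes (S B : {set G}) :=
  [&& `[< spanning_tree B >], S \subset B & B :\: S \subset actset B].

(* A minimum-weight spanning tree above S. *)
Lemma completes_exists (S : {set G}) : forest S -> exists B, completes S B.
Proof.
move=> /forest_spanning[B0 tB0 sB0].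
pose P (B : {set G}) := `[< spanning_tree B >] && (S \subset B).
have PB0 : P B0 by apply/andP; split => //; apply/asboolP.
case: (arg_minnP (fun B : {set G} => \sum_(e in B) r e)%N PB0) => B /andP[/asboolP tB sB] mB.
exists B; apply/and3P; split => //; first exact/asboolP.
apply/subsetP => e; rewrite inE => /andP[eS eB]; rewrite inE eB; apply/asboolP.
split=> // f fK tf.
have Pf : P (B :\ e :|: [set f]).
  apply/andP; split; first exact/asboolP.
  apply/subsetP => g gS; rewrite !inE (subsetP sB) // andbT.
  by have -> : g != e by apply: contraNneq eS => <-.
(* If [f] were already in the tree, the exchange would give a spanning tree with one edge fewer. *)
have [fB|fB] := boolP (f \in B :\ e).
  have := spanning_sol_card n_gt0 tf; rewrite setUC (setUidPr _) ?sub1set //.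
  have := spanning_sol_card n_gt0 tB; rewrite (cardsD1 e) eB => <- /eqP.
  by rewrite add1n -[X in X == _]add0n eqn_leq ltnn andbF.
have := mB _ Pf.
rewrite setUC big_setU1 //= (big_setD1 e) //=.
by rewrite leq_add2r.
Qed.

(** Some [f] of [B'] outside [B] can be exchanged for [e]. It lies outside [S], so it is active in
    [B'] and its rank is at most that of [e]; with [h] the ranks agree, which puts [e] in [B']. *)
Lemma completes_min (S B B' : {set G}) (e : G) : completes S B -> completes S B' ->
  e \in B -> e \notin B' -> (forall f, f \in B' -> f \notin B -> (r e <= r f)%N) -> False.
Proof.
move=> /and3P[/asboolP tB sB aB] /and3P[/asboolP tB' sB' aB'] eB eB' h.
have [f [fB' fB tf]] := spanning_exchange tB tB' eB eB'.
have fS : f \notin S by apply: contra fB => /(subsetP sB).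
have eK : e \in K by apply: (subsetP tB.1.1).
have fK : f \in K by apply: (subsetP tB'.1.1).
have : f \in actset B' by apply: (subsetP aB'); rewrite inE fS.
rewrite inE => /andP[_ /asboolP[_ /(_ e eK tf) rfe]].
have /r_inj ef : r e = r f by apply/eqP; rewrite eqn_leq h.
by rewrite ef ?fB' // in eB'.
Qed.

Lemma completes_unique (S B B' : {set G}) : completes S B -> completes S B' -> B = B'.
Proof.
move=> cB cB'; apply/eqP/negPn/negP => ne.
pose D := (B :\: B') :|: (B' :\: B).
have [D0|[e0 e0D]] := set_0Vmem D.
  case/negP: ne; rewrite eqEsubset; apply/andP; split; apply/subsetP => e eB;
  apply/negPn/negP => eB'; by have := in_set0 e; rewrite -D0 /D !inE eB (negPf eB') /= ?orbT.
(* The smallest edge of the symmetric difference contradicts [completes_min], whichever tree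
   contains it. *)
case: (arg_minnP (P := fun e => e \in D) r e0D) => e eD he.
move: eD; rewrite /D !inE => /orP[]/andP[e1 e2].
  apply: (completes_min cB cB' e2 e1) => f fB' fB; apply: he.
  by rewrite /= /D !inE fB' fB orbT.
apply: (completes_min cB' cB e2 e1) => f fB' fB; apply: he.
by rewrite /= /D !inE fB' fB.
Qed.

Lemma nbc_sub (S S' : {set G}) : S' \subset S -> nbc_set r S -> nbc_set r S'.
Proof.
move=> sS [fS hS]; split; first exact: forest_sub fS.
by move=> D bD sD; apply: (hS D bD); apply: subset_trans sS.
Qed.

Lemma completes_nbc (S B : {set G}) : completes S B -> nbc_set r S -> nbc_set r B.
Proof.
move=> /and3P[/asboolP tB sB aB] [fS hS]; split; first by case: tB.
move=> D [C [e [bC [eC me] DE]]] sD.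
have cC : is_circle C by case: bC => vs [es [hC _]]; exists vs, es.
have /subsetPn[f fD fS'] : ~~ (D \subset S).
  by apply/negP; apply: hS; exists C, e.
have := fD; rewrite DE !inE => /andP[fe fC].
have fB : f \in B by apply: (subsetP sD).
have : f \in actset B by apply: (subsetP aB); rewrite inE fS'.
have CK := subsetP (circle_subK cC).
rewrite inE => /andP[_ /asboolP[_ /(_ e (CK _ eC)) h]].
have rfe : (r f <= r e)%N by apply: h; apply: exchange_circle cC _ _ _ _ => //; rewrite -DE.
have /r_inj ef : r f = r e by apply/eqP; rewrite eqn_leq rfe me.
by rewrite ef ?CK ?eqxx // in fe.
Qed.

Lemma sum_nbc_activity (R : comNzRingType) (t : R) :
  \sum_(S : {set G} | `[< nbc_set r S >]) t ^+ (n.-1 - #|S|)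
  = \sum_(B : {set G} | `[< nbc_basis r B >]) (1 + t) ^+ activity r B.
Proof.
pose h S := odflt set0 [pick B | completes S B].
have hP S B : completes S B -> h S = B.
  rewrite /h => cB; case: pickP => [B' cB'|/(_ B)]; last by rewrite cB.
  exact: completes_unique cB' cB.
have hP' (S : {set G}) : nbc_set r S -> completes S (h S).
  by move=> [/completes_exists[B cB] _]; rewrite (hP _ _ cB).
rewrite (partition_big h (fun B => `[< nbc_basis r B >])); last first.
  move=> S /asboolP nS; have cS := hP' _ nS; apply/asboolP; split.
    exact: completes_nbc cS nS.
  by case/and3P: cS => /asboolP.
apply: eq_bigr => B /asboolP[nB tB].
rewrite -/(actset B) /activity -/(actset B) -sum_subset_expr.
(* The sets completed by [B] are [B :\: A] with [A] a set of active edges, and the exponent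
   [n.-1 - #|S|] is then [#|A|]. *)
rewrite (reindex_onto (fun A => B :\: A) (fun S => B :\: S)); last first.
  move=> S /andP[/asboolP nS /eqP hS]; have := hP' _ nS; rewrite hS => /and3P[_ sB _].
  by rewrite setDDr setDv set0U; apply/setIidPr.
apply: eq_big => [A|A /andP[_ /eqP AE]].
  apply/andP/idP => [[/andP[/asboolP nS /eqP hS] /eqP AE]|sA].
    by have := hP' _ nS; rewrite hS => /and3P[_ _]; rewrite AE.
  have sAB : A \subset B by apply: subset_trans sA _; apply/subsetP => e; rewrite inE => /andP[].
  have AE : B :\: (B :\: A) = A by rewrite setDDr setDv set0U; apply/setIidPr.
  split; last by rewrite AE.
  apply/andP; split; first by apply/asboolP; apply: nbc_sub nB; apply: subsetDl.
  apply/eqP/hP/and3P; split; first exact/asboolP.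
    exact: subsetDl.
  by rewrite AE.
congr (t ^+ _); rewrite -(spanning_sol_card n_gt0 tB) -{2}AE [in RHS]cardsD.
by congr (_ - _)%N; rewrite (setIidPr _) ?subsetDl.
Qed.

Definition bcmin (S : {set G}) (e : G) :=
  exists C, [/\ balanced_circle C, min_edge r C e & C :\ e \subset S].

Definition toggle (S : {set G}) (e : G) := if e \in S then S :\ e else e |: S.

Lemma toggleK (e : G) : involutive (toggle^~ e).
Proof.
by move=> S; rewrite /toggle; case eS: (e \in S); rewrite ?setD11 ?setU11 ?setD1K ?setU1K ?eS.
Qed.

Lemma balanced_is_circle (C : {set G}) : balanced_circle C -> is_circle C.
Proof. by case=> vs [es [hC _]]; exists vs, es. Qed.

(** All edges of [C] except its smallest edge [e'] have rank above [e'], hence above [e], and are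
    not affected by toggling [e]. So the largest completing edge is the same before and after its
    toggle. *)
Lemma bcmin_toggle (S : {set G}) (e e' : G) : e \in K -> (r e <= r e')%N ->
  bcmin S e' -> bcmin (toggle S e) e'.
Proof.
move=> eK le [C [bC [e'C me] sC]]; exists C; split => //.
have CK := subsetP (circle_subK (balanced_is_circle bC)).
apply/subsetP => f fC; have fS := subsetP sC _ fC.
move: fC; rewrite !inE => /andP[fe fC].
have fne : f != e.
  apply: contraNneq fe => fe; apply/eqP/r_inj; rewrite ?CK //.
  by apply/eqP; rewrite eqn_leq me // fe le.
by rewrite /toggle; case: ifP; rewrite !inE ?(negPf fne) fS.
Qed.

(* Pair off the sets containing a broken circuit by toggling the largest
   edge that completes one. *)
Lemma whitney_nbc (phi : {set G} -> int) :
  (forall (S C : {set G}) e, S \subset K -> balanced_circle C -> e \in C ->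
     C :\ e \subset S -> phi (e |: S) = phi S) ->
  (forall S C : {set G}, C \subset S -> is_circle C -> ~ balanced_circle C -> phi S = 0) ->
  \sum_(S : {set G} | S \subset K) (-1) ^+ #|S| * phi S
  = \sum_(S : {set G} | `[< nbc_set r S >]) (-1) ^+ #|S| * phi S.
Proof.
move=> h1 h2.
rewrite (bigID (fun S : {set G} => `[< exists e, bcmin S e >])) /=.
have bcK S e : bcmin S e -> e \in K.
  move=> [C [bC [eC _] _]].
  by apply: (subsetP (circle_subK (balanced_is_circle bC))).
pose mx S e := bcmin S e /\ forall e', bcmin S e' -> (r e' <= r e)%N.
have mxu S e e' : mx S e -> mx S e' -> e = e'.
  move=> [b1 m1] [b2 m2]; apply: r_inj; rewrite ?(bcK _ _ b1) ?(bcK _ _ b2) //.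
  by apply/eqP; rewrite eqn_leq m1 ?m2.
have mxe S : (exists e, bcmin S e) -> exists e, mx S e.
  move=> [e0 /asboolP b0].
  case: (arg_maxnP (P := fun e => `[< bcmin S e >]) r b0) => e /asboolP be me.
  by exists e; split => // e' /asboolP /me.
pose io S := if [pick e | `[< mx S e >]] is Some e then toggle S e else S.
have ioE S e : mx S e -> io S = toggle S e.
  rewrite /io => m1; case: pickP => [e' /asboolP m2|/(_ e) /asboolP//].
  by rewrite (mxu _ _ _ m1 m2).
have mxt S e : mx S e -> mx (toggle S e) e.
  move=> [b1 m1]; have eK := bcK _ _ b1; split; first exact: bcmin_toggle.
  move=> e' b'; rewrite leqNgt; apply/negP => lt.
  have := bcmin_toggle eK (ltnW lt) b'; rewrite toggleK => /m1.
  by rewrite leqNgt lt.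
have toK (S : {set G}) (e : G) : e \in K -> S \subset K -> toggle S e \subset K.
  move=> eK sK; rewrite /toggle; case: ifP => _; first exact: subset_trans (subsetDl _ _) sK.
  by rewrite subUset sub1set eK.
have phit (S : {set G}) (e : G) : S \subset K -> bcmin S e -> phi (toggle S e) = phi S.
  move=> sK [C [bC [eC _] sC]]; rewrite /toggle; case: ifP => eS; last exact: h1 bC eC sC.
  rewrite -[in RHS](setD1K eS); symmetry; apply: (h1 _ C) => //.
    exact: subset_trans (subsetDl _ _) sK.
  by apply/subsetP => f fC; rewrite !inE (subsetP sC) // andbT; move: fC; rewrite !inE => /andP[].
set s1 := (X in X + _ = _).
have s10 : s1 = - s1.
  rewrite {1}/s1 (reindex_inj (h := io)); last first.
    apply: inv_inj => S; rewrite {2}/io.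
    case: pickP => [e /asboolP m1|no].
      by rewrite (ioE _ _ (mxt _ _ m1)) toggleK.
    by rewrite /io; case: pickP => // e; rewrite no.
  rewrite /s1 -sumrN /=; apply: eq_big => [S|S].
    apply/andP/andP => -[sK /asboolP/mxe[e m1]].
      have m2 : exists e, mx S e.
        move: m1; rewrite /io; case: pickP => [e' /asboolP m2 _|_ m2]; by [exists e'|exists e].
      case: m2 => e' m2; rewrite (ioE _ _ m2) in sK.
      have eK := bcK _ _ m2.1.
      split; last by apply/asboolP; exists e'; case: m2.
      by rewrite -(toggleK e' S); apply: toK.
    have eK := bcK _ _ m1.1.
    rewrite (ioE _ _ m1); split; first exact: toK.
    by apply/asboolP; exists e; case: (mxt _ _ m1).
  move=> /andP[sK /asboolP/mxe[e m1]].
  have e2 : exists e, mx S e.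
    move: m1; rewrite /io; case: pickP => [e' /asboolP m2 _|_ m2]; by [exists e'|exists e].
  case: e2 => {m1}e m1; rewrite (ioE _ _ m1) in sK *.
  have eK := bcK _ _ m1.1.
  have sK' : S \subset K by rewrite -(toggleK e S); apply: toK.
  rewrite phit //; last by case: m1.
  rewrite -mulNr; congr (_ * _).
  rewrite /toggle; case: ifP => eS.
    by rewrite [in RHS](cardsD1 e) eS exprS mulN1r opprK.
  by rewrite cardsU1 eS exprS mulN1r.
have -> : s1 = 0 by lia.
rewrite add0r big_mkcond [RHS]big_mkcond /=; apply: eq_bigr => S _.
have bcbroken S' e : bcmin S' e -> ~ nbc_set r S'.
  by move=> [C [bC mC sC]] [_ /(_ (C :\ e))]; apply => //; exists C, e.
case: ifP => [/andP[sK /asboolP nb]|h].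
  case: asboolP => // nn.
  (* A remaining set that is not NBC contains a circle. Were it balanced, its smallest edge would be
     a completing edge; so it is unbalanced and [phi] vanishes. *)
  have [C [sC cC]] : exists C : {set G}, C \subset S /\ is_circle C.
    apply: contra_notP nn => nC; split; first by split => // C sC cC; apply: nC; exists C.
    by move=> D [C [e [bC mC ->]]] sD; apply: nb; exists e, C.
  rewrite (h2 S C) ?mulr0 // => bC; apply: nb.
  have [vs [es hC]] := cC.
  have [e0 e0C] : exists e, e \in C.
    case: hC => [[sv se _ _] [_ _ ->]]; case: es se sv => [<-//|e es _ _].
    by exists e; rewrite inE mem_head.
  case: (arg_minnP r e0C) => e eC me; exists e, C; split => //.
  by apply: subset_trans sC; apply: subsetDl.
case: asboolP => // nS.
have nb : ~ (exists e : G, bcmin S e) by move=> [e /bcbroken]; apply.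
by move: h; rewrite nS.1.1 /= (asboolF nb).
Qed.

End Bases.

Lemma card_sumz (T : finType) (A : {set T}) : #|A|%:Z = \sum_x (x \in A : nat)%:Z.
Proof.
rewrite -natz -sum1_card natr_sum big_mkcond /=; apply: eq_bigr => x _.
by case: (x \in A).
Qed.

(** * Inclusion-exclusion: colourings modulo [m] in terms of NBC bases *)

Section NbcCounts.
Variables (n : nat) (a b : int).
Local Notation G := (gedge n a b).
Local Notation K := (Kedges n a b).
Variable r : G -> nat.
Hypothesis n_gt0 : (0 < n)%N.
Hypothesis r_inj : {in K &, injective r}.

Definition igain (R : pzRingType) (e : G) : R := (gain e)%:~R.

Lemma circle_sum_igain (R : pzRingType) vs es :
  circle_sum (@igain R) vs es = (circle_sum (@gain n a b) vs es)%:~R.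
Proof.
rewrite /circle_sum rmorph_sum /=; apply: eq_bigr => p _.
by rewrite /dval; case: ifP => // _; rewrite rmorphN.
Qed.

Lemma sat_balanced (R : pzRingType) (S C : {set G}) (e : G) (x : 'I_n -> R) :
  balanced_circle C -> e \in C -> C :\ e \subset S ->
  sat (@igain R) (e |: S) x = sat (@igain R) S x.
Proof.
move=> [vs [es [hC s0]]] eC sC; rewrite sat_setU1 andb_idl // => /satP sx.
apply/eqP; apply: (circle_sum_complete (g := @igain R) hC eC) => [f fC fe|].
  by apply: sx; apply: (subsetP sC); rewrite !inE fe.
by rewrite circle_sum_igain [circle_sum _ _ _]s0.
Qed.

Lemma sat_circle (R : pzRingType) (S C : {set G}) (x : 'I_n -> R) vs es :
  circle_rep C vs es -> C \subset S -> sat (@igain R) S x ->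
  (circle_sum (@gain n a b) vs es)%:~R = 0 :> R.
Proof.
move=> hC sC /satP sx; rewrite -circle_sum_igain.
by apply: (circle_sum_sat hC) => f fC; apply: sx; apply: (subsetP sC).
Qed.

(** For [m] above this bound an unbalanced circle stays unbalanced modulo [m]. *)
Lemma norm_circle_sum (C : {set G}) vs es : circle_rep C vs es ->
  (absz (circle_sum (@gain n a b) vs es) <= n * (absz a + absz (b - a)))%N.
Proof.
move=> [[_ sz uv _] _].
have szn : (size (zip es (zip vs (rot 1 vs))) <= n)%N.
  rewrite size1_zip sz ?size1_zip ?size_rot //.
  by rewrite -[leqRHS](card_ord n) -(card_uniqP uv) max_card.
apply: leq_trans (_ : (size (zip es (zip vs (rot 1 vs))) * (absz a + absz (b - a)) <= _)%N); last first.
  by rewrite leq_mul2r szn orbT.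
rewrite /circle_sum; elim: (zip _ _) => [|p L IH]; first by rewrite big_nil.
rewrite big_cons /= mulSn.
have : (absz (dval (@gain n a b) p.1 p.2.1 p.2.2) <= absz a + absz (b - a))%N.
  have gb : (absz (gain p.1) <= absz a + absz (b - a))%N.
    rewrite /gain; have := ltn_ord p.1.2; rewrite /ngains ltnS; lia.
  by rewrite /dval; case: ifP => // _; rewrite abszN.
move: IH; set W := (absz a + absz (b - a))%N; set s := \sum_(_ <- _) _.
set d := dval _ _ _ _; move: (size L * W)%N => k; rewrite -/W; move: W s d => W s d; lia.
Qed.

Lemma intr_Zp_eq0 m (z : int) : (1 < m)%N -> (absz z < m)%N -> z%:~R = 0 :> 'Z_m -> z = 0.
Proof.
move=> m1 zm z0; apply/eqP; rewrite -absz_eq0.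
have : (absz z)%:R = 0 :> 'Z_m.
  case: z z0 {zm} => k //; rewrite NegzE rmorphN /= => /eqP; rewrite oppr_eq0 => /eqP.
  by [].
move=> /(congr1 (@nat_of_ord _)) /=; rewrite val_Zp_nat // modn_small //.
by move=> ->.
Qed.

Lemma forest_card (S : {set G}) : forest S -> (#|S| <= n.-1)%N.
Proof.
move=> /forest_spanning[B tB sB].
by rewrite -(spanning_sol_card n_gt0 tB); apply: subset_leq_card.
Qed.

(** [sum_nbc_activity] at [t = - x]. It serves at [x = m] for colourings and at [x = 1] for bounded
    cells, where only activity 0 survives. *)
Lemma nbc_sum_sign (x : int) :
  \sum_(S : {set G} | `[< nbc_set r S >]) (-1) ^+ #|S| * x ^+ (n.-1 - #|S|)
  = (-1) ^+ n.-1 * \sum_(B : {set G} | `[< nbc_basis r B >]) (1 - x) ^+ activity r B.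
Proof.
rewrite -(sum_nbc_activity n_gt0 r_inj) mulr_sumr; apply: eq_bigr => S /asboolP[/forest_card sS _].
rewrite -[- x]mulN1r exprMn mulrA -exprD.
congr (_ * _); rewrite -[in LHS]signr_odd -[in RHS]signr_odd; congr (_ ^+ _).
by rewrite oddD oddB // addKb.
Qed.

Definition colorings m : {set {ffun 'I_n -> 'Z_m}} :=
  [set x : {ffun 'I_n -> 'Z_m} |
    [forall e in K, x (ghead e) - x (gtail e) != @igain 'Z_m e]].

Lemma incl_excl_colorings m :
  #|colorings m|%:Z = \sum_(S : {set G} | S \subset K)
     (-1) ^+ #|S| * #|sols (@igain 'Z_m) S|%:Z.
Proof.
under [RHS]eq_bigr => S _.
  rewrite card_sumz mulr_sumr; over.
rewrite exchange_big /= card_sumz.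
apply: eq_bigr => x _.
pose T := [set e in K | x (ghead e) - x (gtail e) == @igain 'Z_m e].
transitivity (\sum_(S : {set G} | S \subset T) (-1 : int) ^+ #|S|).
  rewrite sum_subset_expr subrr inE.
  case: forall_inP => [h|/forall_inP].
    suff -> : T = set0 by rewrite cards0.
    apply/setP => e; rewrite !inE; apply/negbTE/negP => /andP[eK].
    by apply/negP/h; rewrite inE.
  rewrite negb_forall_in => /exists_inP[e eK]; rewrite negbK => he.
  have : e \in T by rewrite /T in_set eK.
  by rewrite (cardsD1 e) => ->; rewrite exprS mul0r.
rewrite big_mkcond [RHS]big_mkcond /=; apply: eq_bigr => S _.
have -> : S \subset T = (S \subset K) && sat (@igain 'Z_m) S x.
  apply/subsetP/andP => [h|[/subsetP h1 /satP h2] e eS].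
    split; first by apply/subsetP => e /h; rewrite inE => /andP[].
    by apply/satP => e /h; rewrite inE => /andP[_ /eqP].
  by rewrite /T in_set h1 ?h2 //=.
rewrite inE; case: (_ \subset _) => //=.
by case: sat; rewrite ?mulr1 ?mulr0.
Qed.

Lemma card_colorings m : (1 < m)%N -> (n * (absz a + absz (b - a)) < m)%N ->
  #|colorings m|%:Z = m%:Z * (-1) ^+ n.-1 *
    \sum_(B : {set G} | `[< nbc_basis r B >]) (1 - m%:Z) ^+ activity r B.
Proof.
move=> m1 mbig; rewrite incl_excl_colorings (whitney_nbc n_gt0 r_inj); first last.
- move=> S C sC [vs [es hC]] nb; apply/eqP; rewrite eqz_nat cards_eq0; apply/eqP/setP => x.
  rewrite !inE; apply/negbTE/negP => /(sat_circle hC sC) /intr_Zp_eq0 h.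
  apply: nb; exists vs, es; split => //; apply: h => //.
  exact: leq_ltn_trans (norm_circle_sum hC) mbig.
- move=> S C e _ bC eC sC; congr (#|pred_of_set _|%:Z); apply/setP => x.
  by rewrite !inE (sat_balanced _ bC).
rewrite -mulrA -nbc_sum_sign mulr_sumr; apply: eq_bigr => S /asboolP[fS _].
rewrite mulrCA; congr (_ * _).
have := card_sols (@igain 'Z_m) fS; rewrite card_ord Zp_cast //.
(* The successor accounts for one extra factor [m], the global translations. *)
have nE : n = ((n.-1 - #|S|).+1 + #|S|)%N.
  by rewrite addSn subnK ?forest_card // prednK.
rewrite [X in _ = (_ ^ X)%N]nE expnD => /eqP; rewrite eqn_pmul2r ?expn_gt0; last by lia.
move=> /eqP ->; rewrite -exprS -!natz natrX //.
Qed.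
End NbcCounts.

(** * Colourings modulo m *)

Section StrictOrder.
Variables (T : finType) (R : rel T).
Hypothesis Rirr : irreflexive R.
Hypothesis Rtr : transitive R.
Hypothesis Rtot : forall u v, u != v -> R u v || R v u.

Definition below v := [set w | R w v].

Lemma below_sub u v : R u v -> u |: below u \subset below v.
Proof.
move=> uv; apply/subsetP => w; rewrite !inE => /orP[/eqP->//|wu].
exact: Rtr wu uv.
Qed.

Lemma below_inj : injective below.
Proof.
move=> u v e; apply/eqP/negPn/negP => /Rtot /orP[] h.
  by move/setP/(_ u): e; rewrite !inE h Rirr.
by move/setP/(_ v): e; rewrite !inE h Rirr.
Qed.

Lemma below_succ u : u |: below u != [set: T] -> exists v, below v = u |: below u.
Proof.
rewrite -subTset => /subsetPn[v0 _ v0N].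
case: (arg_minnP (P := fun v => v \notin u |: below u) (fun v => #|below v|) v0N) => v vN hv.
exists v; apply/eqP; rewrite eqEsubset; apply/andP; split; last first.
  apply: below_sub; move: vN; rewrite !inE negb_or => /andP[vu nvu].
  by have := Rtot vu; rewrite (negPf nvu).
apply/subsetP => w wv; apply/negPn/negP => /hv; rewrite leqNgt => /negP; apply.
apply: proper_card; apply/properP; split; last by exists w => //; rewrite inE Rirr.
by apply: subset_trans (subsetUr _ _) (below_sub _); move: wv; rewrite inE.
Qed.

Lemma below_pred v : below v != set0 -> exists2 u, R u v & below v = u |: below u.
Proof.
move=> /set0Pn[w0 w0v].
case: (arg_maxnP (P := fun w => w \in below v) (fun w => #|below w|) w0v) => u uv hu.
have Ruv : R u v by move: uv; rewrite inE.
exists u => //; apply/eqP; rewrite eqEsubset below_sub // andbT.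
apply/subsetP => w wv; apply/negPn/negP; rewrite !inE negb_or => /andP[wu nwu].
have := Rtot wu; rewrite (negPf nwu) /= => uw.
have : (#|below w| <= #|below u|)%N := hu _ wv.
rewrite leqNgt => /negP; apply.
apply: proper_card; apply/properP; split; last by exists u; rewrite inE // Rirr.
exact: subset_trans (subsetUr _ _) (below_sub _).
Qed.
End StrictOrder.

(** * Circular placements as remainders of gaps and boxes of labels *)

Section Placements.
Variables (n k1 k2 m : nat).
Local Notation V := 'I_n.+1.
Local Notation q := k1.+1.
Hypothesis m_big : (n.+1 * (k1 + k2) + (k1 + k2).+1 <= m)%N.

(** Ties are read by decreasing label: a step from a larger to a smaller label is the kind allowed a
    gap of only [k2], and [k2] may be 0. *)
Definition before (h : V -> nat) (u v : V) :=
  (h u < h v)%N || ((h u == h v) && (v < u)%N).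

Lemma before_irr h : irreflexive (before h).
Proof. by move=> u; rewrite /before !ltnn andbF. Qed.

Lemma before_trans h : transitive (before h).
Proof. by move=> v u w; rewrite /before; lia. Qed.

Lemma before_total h u v : u != v -> before h u v || before h v u.
Proof.
move=> uv; have : (u : nat) != v by [].
by rewrite /before; lia.
Qed.

Lemma before_asym h u v : before h u v -> ~~ before h v u.
Proof. by rewrite /before; lia. Qed.

(** For labels [i < j] the difference [xj - xi] avoids the gains [1 - k2, ..., k1 + k2]; the last
    two clauses say so after one turn of the circle in either direction. *)
Definition ok_pair (xi xj : nat) :=
  [&& (xi + (k1 + k2) < xj) || (xj + k2 <= xi), xj + k2 <= xi + m
    & xi + (k1 + k2) < xj + m]%N.

Definition valid (X : V -> nat) :=
  [forall i : V, forall j : V, (i < j)%N ==> ok_pair (X i) (X j)].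

Lemma validP X : reflect (forall i j : V, (i < j)%N -> ok_pair (X i) (X j)) (valid X).
Proof.
apply: (iffP forallP) => h i; first by move=> j ij; have /forallP/(_ j) := h i; rewrite ij.
by apply/forallP => j; apply/implyP => /h.
Qed.

Definition place (d : V -> nat) (f : V -> nat) v :=
  (\sum_(u in below (before f) v) d u + q * f v)%N.

Section Place.
Variables (d f : V -> nat) (j : nat).
Hypothesis d_ge : forall v, (k2 <= d v)%N.
Hypothesis f_lt : forall v, (f v < j)%N.
Hypothesis d_sum : (\sum_v d v + q * j = m)%N.

Lemma place_before u v : before f u v ->
  (place d f u + d u + q * (f v - f u) <= place d f v)%N.
Proof.
move=> uv; have := below_sub (@before_trans f) uv => sub.
have le : (\sum_(w in u |: below (before f) u) d w <= \sum_(w in below (before f) v) d w)%N.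
  by rewrite [leqRHS](big_setID (u |: below (before f) u)) /= (setIidPr sub) leq_addr.
move: le; rewrite big_setU1 ?inE ?before_irr //= /place mulnBr.
have : (q * f u <= q * f v)%N by rewrite leq_mul2l; move: uv; rewrite /before; lia.
move: (\sum_(i in below (before f) u) d i)%N (\sum_(i in below (before f) v) d i)%N.
move: (q * f u)%N (q * f v)%N => c c' s s'; lia.
Qed.

Lemma place_bound v : (place d f v + d v + q * (j - f v) <= m)%N.
Proof.
have le : (\sum_(w in v |: below (before f) v) d w <= \sum_w d w)%N.
  by rewrite [leqRHS](bigID (mem (v |: below (before f) v))) /= leq_addr.
move: le; rewrite big_setU1 ?inE ?before_irr //= /place mulnBr.
have : (q * f v <= q * j)%N by rewrite leq_mul2l ltnW.
move: d_sum; move: (\sum_(i in below (before f) v) d i)%N (\sum_i d i)%N.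
move: (q * f v)%N (q * j)%N => c c' s s'; lia.
Qed.

Lemma before_place u v : before (place d f) u v = before f u v.
Proof.
have main w w' : before f w w' -> before (place d f) w w'.
  move=> h; have := place_before h; move: h; rewrite /before.
  have [lt _|ge /=] := ltnP (f w) (f w').
    have : (0 < q * (f w' - f w))%N by rewrite muln_gt0 /= subn_gt0.
    lia.
  move=> /andP[/eqP -> w'w]; rewrite subnn muln0 w'w; lia.
have [->|uv] := eqVneq u v; first by rewrite !before_irr.
case: (boolP (before f u v)) => [/main//|nb].
have := before_total f uv; rewrite (negPf nb) /= => /main/before_asym/negbTE.
by [].
Qed.

Lemma place_valid : valid (place d f).
Proof.
apply/validP => u v uv; have ne : u != v by apply: contraTneq uv => ->; rewrite ltnn.
have := place_bound u; have := place_bound v.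
have := d_ge u; have := d_ge v.
have qj w : (q <= q * (j - f w))%N by rewrite leq_pmulr // subn_gt0.
have := qj u; have := qj v.
case/orP: (before_total f ne) => h.
  have lt : (f u < f v)%N by move: h uv; rewrite /before; lia.
  have := place_before h.
  have : (q <= q * (f v - f u))%N by rewrite leq_pmulr // subn_gt0.
  rewrite /ok_pair; lia.
have := place_before h; rewrite /ok_pair.
by move: (q * (f u - f v))%N (q * (j - f u))%N (q * (j - f v))%N => c c' c''; lia.
Qed.

Lemma place_max : f ord_max = 0%N -> place d f ord_max = 0%N.
Proof.
move=> f0; rewrite /place f0 muln0 addn0 big1 // => u; rewrite inE /before f0 ltn0 /=.
by move=> /andP[_]; rewrite ltnNge -ltnS ltn_ord.
Qed.
End Place.

Lemma below_before_eq h h' : (forall u v, before h u v = before h' u v) ->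
  below (before h) =1 below (before h').
Proof. by move=> e v; apply/setP => w; rewrite !inE e. Qed.

(** Positions determine the order and, modulo [q], the prefix sums of [d]; the full sum is known
    too, being [m] minus a multiple of [q]. So each [d v] is known modulo [q], hence exactly, as it
    lies in a window of length [q]. *)
Lemma place_inj (d d' f f' : V -> nat) j j' :
  (forall v, (k2 <= d v < k2 + q)%N) -> (forall v, (k2 <= d' v < k2 + q)%N) ->
  (forall v, (f v < j)%N) -> (forall v, (f' v < j')%N) ->
  (\sum_v d v + q * j = m)%N -> (\sum_v d' v + q * j' = m)%N ->
  place d f =1 place d' f' -> d =1 d' /\ f =1 f'.
Proof.
move=> hd hd' hf hf' sd sd' e.
have bE u v : before f u v = before f' u v.
  rewrite -(before_place f sd) -(before_place f' sd').
  by rewrite /before !e.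
have belE := below_before_eq bE.
pose B := below (before f).
have eqm v : \sum_(u in B v) d u = \sum_(u in B v) d' u %[mod q].
  have := e v; rewrite /place -belE => /(congr1 (modn^~ q)).
  by rewrite ![(q * _)%N]mulnC ![(_ + _ * q)%N]addnC !modnMDl.
have eqm' v : \sum_(u in v |: B v) d u = \sum_(u in v |: B v) d' u %[mod q].
  have [->|] := eqVneq (v |: B v) [set: V]; last first.
    by move=> /(below_succ (@before_irr f) (@before_trans f) (@before_total f))[w <-].
  rewrite !(eq_bigl predT) => [|w|w]; rewrite ?inE //.
  have := sd; rewrite -sd' => /(congr1 (modn^~ q)).
  by rewrite ![(q * _)%N]mulnC ![(_ + _ * q)%N]addnC !modnMDl.
have dE : d =1 d'.
  move=> v; have := eqm' v; rewrite !big_setU1 ?inE ?before_irr //=.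
  rewrite -(modnDmr (d v)) eqm modnDmr => /eqP; rewrite eqn_modDr.
  have := hd v; have := hd' v => /andP[h1 h2] /andP[h3 h4].
  rewrite -(subnK h1) -(subnK h3) eqn_modDr !modn_small; lia.
split=> // v; have := e v; rewrite /place -belE.
rewrite (eq_bigr d') => [/addnI/eqP|u _]; last exact: dE.
by rewrite eqn_pmul2l // => /eqP.
Qed.

Section Unplace.
Variable X : V -> nat.
Hypothesis X_valid : valid X.
Hypothesis X_lt : forall v, (X v < m)%N.
Hypothesis X_max : X ord_max = 0%N.
Local Notation B := (below (before X)).

Let irr := @before_irr X.
Let trans := @before_trans X.
Let tot := @before_total X.

(** After the last label comes the first again; it sits at 0, that is at [m] one turn later. *)
Definition nextX u := if [pick v | B v == u |: B u] is Some v then X v else m.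
Definition gap u := (nextX u - X u)%N.

Lemma nextXE u v : B v = u |: B u -> nextX u = X v.
Proof.
rewrite /nextX => e; case: pickP => [w /eqP|/(_ v)]; last by rewrite e eqxx.
by rewrite -e => /(below_inj irr tot) ->.
Qed.

Lemma nextX_last u : u |: B u = [set: V] -> nextX u = m.
Proof.
rewrite /nextX => e; case: pickP => // w; rewrite e => /eqP/setP/(_ w).
by rewrite !inE irr.
Qed.

Lemma before_max v : v != ord_max -> before X ord_max v.
Proof.
move=> ne; have : (v < n)%N by have := ltn_ord v; move: ne; rewrite -val_eqE /=; lia.
by rewrite /before X_max /=; lia.
Qed.

(** The closing step leads back to the largest label, so it is an ascent and needs the large gap;
    with a single label the gap is all of [m]. *)
Lemma gap_last u : u |: B u = [set: V] -> (k2 + q <= gap u)%N.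
Proof.
move=> e; rewrite /gap nextX_last //.
have [->|ne] := eqVneq u ord_max; first by rewrite X_max; lia.
have lt : (u < (ord_max : V))%N.
  by have := ltn_ord u; move: ne; rewrite -val_eqE /=; lia.
have /validP/(_ _ _ lt) := X_valid; rewrite /ok_pair X_max; have := X_lt u; lia.
Qed.

Lemma gap_step u v : B v = u |: B u ->
  (X u + gap u = X v)%N /\ (k2 + (if (u < v)%N then q else 0) <= gap u)%N.
Proof.
move=> e; have uv : before X u v by have := setU11 u (B u); rewrite -e inE.
rewrite /gap (nextXE e); split; first by move: uv; rewrite /before; lia.
have ne : (u : nat) != v by apply/eqP => /val_inj uv'; rewrite uv' irr in uv.
have /validP h := X_valid; have := h u v; have := h v u.
rewrite /ok_pair; move: uv ne; rewrite /before; case: ifP; lia.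
Qed.

Lemma gap_ge u : (k2 <= gap u)%N.
Proof.
have [/gap_last|/(below_succ irr trans tot)[v /gap_step[_]]] := eqVneq (u |: B u) [set: V]; lia.
Qed.

Lemma below_max : B ord_max = set0.
Proof.
apply/setP => u; rewrite !inE; have [->|/before_max] := eqVneq u ord_max; first exact: irr.
by move/before_asym/negbTE.
Qed.

Lemma X_sum v : X v = (\sum_(u in B v) gap u)%N.
Proof.
have [k] := ubnP #|B v|; elim: k v => // k IH v.
have [e _|/(below_pred irr trans tot)[u uv e]] := eqVneq (B v) set0.
  have -> : v = ord_max by apply: (below_inj irr tot); rewrite e below_max.
  by rewrite below_max big_set0.
rewrite e cardsU1 inE irr /= => hk; rewrite big_setU1 ?inE ?irr //=.
by rewrite -IH // addnC (gap_step e).1.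
Qed.

Lemma exists_last : exists l, l |: B l = [set: V].
Proof.
case: (arg_maxnP (P := predT) (fun w => #|B w|) (i0 := ord_max) isT) => l _ hl; exists l.
apply/eqP/negPn/negP => /(below_succ irr trans tot)[v e].
have : (#|B v| <= #|B l|)%N := hl v isT.
rewrite e cardsU1 inE irr /=; lia.
Qed.

Lemma m_sum : m = (\sum_u gap u)%N.
Proof.
have [l e] := exists_last.
transitivity (\sum_(u in l |: B l) gap u)%N; last by rewrite e; apply: eq_bigl => w; rewrite inE.
rewrite big_setU1 ?inE ?irr //= -X_sum /gap (nextX_last e) subnK //.
exact: ltnW.
Qed.

Definition bars u := ((gap u - k2) %/ q)%N.
Definition rest u := ((gap u - k2) %% q)%N.
Definition box v := (\sum_(u in B v) bars u)%N.

Lemma gapE u : gap u = (k2 + rest u + q * bars u)%N.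
Proof.
rewrite -[LHS](subnK (gap_ge u)) {1}(divn_eq (gap u - k2) q) /rest /bars; lia.
Qed.

Lemma box_sub u v : before X u v -> (box u + bars u <= box v)%N.
Proof.
move=> uv; have := below_sub trans uv => sub.
have le : (\sum_(w in u |: B u) bars w <= \sum_(w in B v) bars w)%N.
  by rewrite [leqRHS](big_setID (u |: B u)) /= (setIidPr sub) leq_addr.
by move: le; rewrite big_setU1 ?inE ?irr //= addnC.
Qed.

Lemma bars_step u v : B v = u |: B u -> bars u = 0%N -> (v < u)%N.
Proof.
move=> e b0; have [_] := gap_step e.
have : (gap u < k2 + q)%N by rewrite gapE b0 muln0 addn0 ltn_add2l ltn_pmod.
have : u != v by apply/eqP => uv; move/setP/(_ u): e; rewrite -uv !inE irr eqxx.
rewrite neq_ltn => /orP[->|//]; lia.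
Qed.

Lemma box_eq u v : before X u v -> box u = box v -> (v < u)%N.
Proof.
have [k] := ubnP #|B v|; elim: k v => // k IH v hk uv be.
have ne : B v != set0 by apply/set0Pn; exists u; rewrite inE.
have [p pv e] := below_pred irr trans tot ne.
have : u \in B v by rewrite inE.
have bp := box_sub pv.
rewrite e !inE => /orP[/eqP up|uup].
  by apply: bars_step; rewrite ?up //; move: bp; rewrite -up -be; lia.
have := box_sub uup => bu.
have pu : (p < u)%N.
  by apply: IH => //; [move: hk; rewrite e cardsU1 inE irr; lia|lia].
apply: ltn_trans pu; apply: bars_step => //; lia.
Qed.

(** A step within a box has no bar, hence is a descent: labels sharing a box occur in decreasing
    order, as [before] reads ties. *)
Lemma before_box u v : before box u v = before X u v.
Proof.
have main w w' : before X w w' -> before box w w'.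
  move=> h; have hb := box_sub h; rewrite /before; have [//|ge] := ltnP (box w) (box w').
  have be : box w = box w' by lia.
  by rewrite be eqxx (box_eq h be).
have [->|uv] := eqVneq u v; first by rewrite !before_irr.
case: (boolP (before X u v)) => [/main//|nb].
have := before_total X uv; rewrite (negPf nb) /= => /main/before_asym/negbTE.
by [].
Qed.

Lemma unplaceE v : place (fun u => k2 + rest u)%N box v = X v.
Proof.
rewrite /place (below_before_eq before_box) X_sum /box big_distrr -big_split /=.
by apply: eq_bigr => u _; rewrite -gapE.
Qed.

(** The gap after the last label contains a bar by [gap_last], and this bar precedes no label. *)
Lemma box_lt v : (box v < \sum_u bars u)%N.
Proof.
have [l e] := exists_last.
have lB : l \notin B v.
  rewrite inE; apply/negP => lv; have : v \in l |: B l by rewrite e inE.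
  rewrite !inE => /orP[/eqP vl|vl]; first by rewrite vl irr in lv.
  by move: (before_asym lv); rewrite vl.
rewrite [ltnRHS](bigD1 l) //= [X in (_ < _ + X)%N](bigID (mem (B v))) /=.
have : (0 < bars l)%N by rewrite divn_gt0 //; have := gap_last e; lia.
have -> : (\sum_(i | (i != l) && (i \in B v)) bars i = box v)%N.
  apply: eq_bigl => w; rewrite andb_idl // => wB.
  by apply: contraNneq lB => <-.
lia.
Qed.

Lemma rest_sum : (\sum_u (k2 + rest u) + q * \sum_u bars u = m)%N.
Proof.
by rewrite [RHS]m_sum big_distrr -big_split /=; apply: eq_bigr => u _; rewrite -gapE.
Qed.

Lemma box_max : box ord_max = 0%N.
Proof. by rewrite /box below_max big_set0. Qed.
End Unplace.
End Placements.

Lemma card_sum_nat (T : finType) (P : pred T) :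
  #|[set x | P x]| = (\sum_x P x)%N.
Proof.
rewrite -sum1_card big_mkcond /=; apply: eq_bigr => x _.
by rewrite inE; case: (P x).
Qed.

Lemma sum_ord_ltn m j : (j <= m)%N -> (\sum_(i < m) (i < j) = j)%N.
Proof.
move=> jm; rewrite -card_sum_nat -[RHS](card_ord j).
rewrite -(card_imset (f := widen_ord jm)); last by move=> x y /(congr1 val)/= /val_inj.
apply: eq_card => i; rewrite inE; apply/idP/imsetP => [ij|[x _ ->]]; last by rewrite /= ltn_ord.
by exists (Ordinal ij) => //; apply: val_inj.
Qed.

Lemma card_anchored n m j : (0 < j <= m.+1)%N ->
  #|[set f : {ffun 'I_n.+1 -> 'I_m.+1} |
     (f ord_max == 0 :> nat) && [forall v, (f v < j)%N]]| = (j ^ n)%N.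
Proof.
move=> /andP[j0 jm].
pose c (v : 'I_n.+1) (i : 'I_m.+1) : nat := if v == ord_max then (i == 0 :> nat) else (i < j)%N.
transitivity (\sum_(f : {ffun 'I_n.+1 -> 'I_m.+1}) \prod_v c v (f v))%N.
  rewrite card_sum_nat; apply: eq_bigr => f _.
  rewrite big_ord_recr /= {2}/c eqxx mulnC; case: eqP => f0 /=; rewrite ?mul1n ?mul0n //.
  have cE (i : 'I_n) : c (widen_ord (leqnSn n) i) (f (widen_ord (leqnSn n) i)) =
     (f (widen_ord (leqnSn n) i) < j)%N :> nat.
    by rewrite /c ifF //; apply/negbTE; rewrite -val_eqE /= neq_ltn ltn_ord.
  case: forallP => [h|/forallP].
    by rewrite big1 // => i _; rewrite cE h.
  rewrite negb_forall => /existsP[v hv].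
  have vn : (v < n)%N.
    have := ltn_ord v; rewrite ltnS leq_eqVlt => /orP[/eqP vE|//].
    by case/negP: hv; have -> : v = ord_max by [apply: val_inj]; rewrite f0.
  rewrite (bigD1 (Ordinal vn)) //= cE.
  have -> : widen_ord (leqnSn n) (Ordinal vn) = v by apply: val_inj.
  by rewrite (negPf hv).
rewrite -(bigA_distr_bigA c) big_ord_recr /= {2}/c eqxx.
have -> : (\sum_(i < m.+1) (i == 0 :> nat) = 1)%N.
  by rewrite big_ord_recl big1 // addn0.
rewrite muln1 (eq_bigr (fun=> j)) ?prod_nat_const ?card_ord // => i _.
rewrite -[RHS](sum_ord_ltn jm); apply: eq_bigr => i' _; rewrite /c ifF //; apply/negbTE.
by rewrite -val_eqE /= neq_ltn ltn_ord.
Qed.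

Section CountPlacements.
Variables (n k1 k2 M : nat).
Local Notation V := 'I_n.+1.
Local Notation q := k1.+1.
Local Notation m := M.+2.
Hypothesis m_big : (n.+1 * (k1 + k2) + (k1 + k2).+1 <= m)%N.

Definition slack (d : {ffun V -> 'I_q}) : nat := (m - \sum_v (k2 + d v))%N.

Lemma slackE (d : {ffun V -> 'I_q}) : (\sum_v (k2 + d v) + slack d = m)%N.
Proof.
rewrite subnKC //; apply: leq_trans m_big; apply: leq_trans (leq_addr _ _).
rewrite -[X in (_ <= X * _)%N](card_ord n.+1) -sum_nat_const; apply: leq_sum => v _.
by rewrite addnC leq_add2r -ltnS.
Qed.

(** Guarantees at least one box, whatever [d] is. *)
Lemma slack_gt (d : {ffun V -> 'I_q}) : (k1 + k2 < slack d)%N.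
Proof.
have := slackE d; move: m_big.
have : (\sum_v (k2 + d v) <= n.+1 * (k1 + k2))%N.
  rewrite -[X in (_ <= X * _)%N](card_ord n.+1) -sum_nat_const; apply: leq_sum => v _.
  by rewrite addnC leq_add2r -ltnS.
lia.
Qed.

Definition placements : {set {ffun V -> 'I_m}} :=
  [set X : {ffun V -> 'I_m} | (X ord_max == 0 :> nat) && valid k1 k2 m (fun v => X v)].

(** [slack p.1 %/ q] is the number of boxes; box 0 for [ord_max] makes that label the first one
    read, at position 0. *)
Definition codes : {set {ffun V -> 'I_q} * {ffun V -> 'I_m}} :=
  [set p : {ffun V -> 'I_q} * {ffun V -> 'I_m} | (q %| slack p.1)%N &&
     ((p.2 ord_max == 0 :> nat) && [forall v, (p.2 v < slack p.1 %/ q)%N])].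

Lemma card_codes :
  #|codes| = (\sum_(d : {ffun V -> 'I_q} | q %| slack d) (slack d %/ q) ^ n)%N.
Proof.
rewrite card_sum_nat -(pair_bigA _ (fun (d : {ffun V -> 'I_q}) (f : {ffun V -> 'I_m}) => ((q %| slack d)%N &&
     ((f ord_max == 0 :> nat) && [forall v, (f v < slack d %/ q)%N]) : nat))) /=.
rewrite [RHS]big_mkcond /=; apply: eq_bigr => d _.
case: (boolP (q %| slack d)%N) => dv /=; last by rewrite big1.
rewrite -card_sum_nat card_anchored //; apply/andP; split.
  by rewrite divn_gt0 //; have := slack_gt d; lia.
by apply: leq_trans (leq_div _ _) _; rewrite /slack leq_subr.
Qed.

Lemma card_placements : #|placements| = #|codes|.
Proof.
pose D (p : {ffun V -> 'I_q} * {ffun V -> 'I_m}) := fun v => (k2 + p.1 v)%N.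
pose h p : {ffun V -> 'I_m} := [ffun v => inord (place k1 (D p) (fun v => p.2 v) v)].
have inf p : p \in codes ->
  [/\ forall v, (k2 <= D p v < k2 + q)%N, forall v, (p.2 v < slack p.1 %/ q)%N,
    (\sum_v D p v + q * (slack p.1 %/ q) = m)%N & p.2 ord_max = 0%N :> nat].
  rewrite inE => /andP[dv /andP[/eqP p0 /forallP pl]]; split => //.
    by move=> v; rewrite /D leq_addr ltn_add2l ltn_ord.
  by rewrite mulnC divnK // slackE.
have hE p v : p \in codes -> h p v = place k1 (D p) (fun v => p.2 v) v :> nat.
  move=> /inf[h1 h2 h3 h4]; rewrite ffunE inordK //.
  have := place_bound m_big h2 h3 v.
  have : (0 < q * (slack p.1 %/ q - p.2 v))%N by rewrite muln_gt0 subn_gt0 h2.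
  move: (place _ _ _ _) (q * (_ - _))%N (D p v) => s c d c0 c1; lia.
rewrite -(card_in_imset (f := h) (D := codes)).
  apply: eq_card => X; apply/idP/imsetP => [|[p pc ->]]; last first.
    have [h1 h2 h3 h4] := inf _ pc.
    have hk v : (k2 <= D p v)%N by case/andP: (h1 v).
    have := place_valid m_big hk h2 h3 => /validP vp.
    rewrite inE hE // place_max //=; apply/validP => i j ij.
    by rewrite !hE // vp.
  rewrite inE => /andP[/eqP X0 vX].
  have lX v : (X v < m)%N by apply: ltn_ord.
  have bl := box_lt m_big vX lX X0; have rs := rest_sum m_big vX lX X0.
  have bm := box_max m_big vX X0; have ue := unplaceE m_big vX lX X0.
  set bx := box _ _ _ _ in bl bm ue; set rt := rest _ _ _ _ in rs ue.
  set j := (\sum_u bars _ _ _ _ u)%N in bl rs.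
  have jm : (j <= m)%N by rewrite -[leqRHS]rs mulSn; move: (\sum_u _)%N (k1 * j)%N => s s'; lia.
  pose dd : {ffun V -> 'I_q} := [ffun v => inord (rt v)].
  pose ff : {ffun V -> 'I_m} := [ffun v => inord (bx v)].
  have rE v : dd v = rt v :> nat by rewrite ffunE inordK // ltn_pmod.
  have sl : slack dd = (q * j)%N.
    rewrite /slack -[X in (X - _)%N]rs.
    have -> : (\sum_v (k2 + dd v) = \sum_u (k2 + rt u))%N.
      by apply: eq_bigr => v _; rewrite rE.
    by rewrite addKn.
  have bE v : ff v = bx v :> nat.
    by rewrite ffunE inordK //; apply: leq_trans (bl v) jm.
  exists (dd, ff).
    rewrite inE /= sl dvdn_mulr // bE bm eqxx /=; apply/forallP => v.
    by rewrite bE mulKn // bl.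
  apply/ffunP => v; rewrite ffunE; apply: val_inj => /=.
  have -> : place k1 (D (dd, ff)) (fun v => ff v) v = X v.
    rewrite -[RHS]ue /place bE; congr (_ + _)%N.
    rewrite (below_before_eq (h' := bx)); last by move=> u w; rewrite /before !bE.
    by apply: eq_bigr => u _; rewrite /D rE.
  by rewrite inordK.
move=> p p' pc pc' hh.
have [h1 h2 h3 h4] := inf _ pc; have [h1' h2' h3' h4'] := inf _ pc'.
have [|dE fE] := place_inj m_big h1 h1' h2 h2' h3 h3'.
  by move=> v; rewrite -!hE // hh.
case: p p' {pc pc' hh h1 h2 h3 h4 h1' h2' h3' h4'} dE fE => [d f] [d' f'] dE fE; congr (_, _).
  by apply/ffunP => v; apply: val_inj; have := dE v; rewrite /D /= => /addnI.
by apply/ffunP => v; apply: val_inj; exact: fE.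
Qed.
End CountPlacements.

Lemma intr_Zp_eq0b M (z : int) : (z%:~R == 0 :> 'I_M.+2) = (M.+2 %| absz z)%N.
Proof.
have natE k : (k%:R == 0 :> 'I_M.+2) = (M.+2 %| k)%N by rewrite Zp_nat -val_eqE.
case: z => k; first exact: natE.
by rewrite NegzE rmorphN oppr_eq0 abszN; apply: natE.
Qed.

(** * Colourings modulo [m] as rotated placements *)

Section ColoringsCount.
Variables (n k1 k2 M : nat).
Local Notation V := 'I_n.+1.
Local Notation q := k1.+1.
Local Notation m := M.+2.
Hypothesis k1_gt0 : (0 < k1)%N.
Hypothesis m_big : (n.+1 * (k1 + k2) + (k1 + k2).+1 <= m)%N.
Local Notation a := (1 - k2%:Z).
Local Notation b := ((k1 + k2)%N%:Z).

Lemma gain_bounds (e : gedge n.+1 a b) : 1 - k2%:Z <= gain e <= (k1 + k2)%N%:Z.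
Proof. by rewrite /gain; have := ltn_ord e.2; rewrite /ngains; lia. Qed.

Lemma gain_onto (i j : V) (z : int) : 1 - k2%:Z <= z <= (k1 + k2)%N%:Z ->
  exists e : gedge n.+1 a b, [/\ gtail e = i, ghead e = j & gain e = z].
Proof.
move=> hz; have lt : (absz (z - a)%R < ngains a b)%N by rewrite /ngains; lia.
by exists (i, j, Ordinal lt); split => //; rewrite /gain /=; lia.
Qed.

Lemma sub_eq_intr (x y : 'I_m) (z : int) :
  (x - y == z%:~R) = (m %| absz ((x : nat)%:Z - (y : nat)%:Z - z)%R)%N.
Proof.
by rewrite -intr_Zp_eq0b !rmorphB /= subr_eq0 -!pmulrn !natr_Zp.
Qed.

Lemma coloring_valid (X : {ffun V -> 'I_m}) :
  (X \in colorings n.+1 a b m) = valid k1 k2 m (fun v => X v).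
Proof.
have Xlt v : (X v < m)%N by apply: ltn_ord.
rewrite inE; apply/forall_inP/validP => [h i j ij|h e eK]; last first.
  have ij : (gtail e < ghead e)%N by move: eK; rewrite inE.
  rewrite /igain sub_eq_intr; have := h _ _ ij; rewrite /ok_pair.
  have := gain_bounds e; have := Xlt (gtail e); have := Xlt (ghead e).
  move: (nat_of_ord (X (gtail e))) (nat_of_ord (X (ghead e))) (gain e) m_big => xi xj z.
  have : (k1 + k2 <= n.+1 * (k1 + k2))%N by rewrite leq_pmull.
  move: (n.+1 * (k1 + k2))%N => s.
  move=> hs hm h1 h2 h3 h4; apply/negP => /dvdnP[t].
  (* Positions lie below [m], so the only multiples of [m] to exclude are 0 and, with either sign,
     [m] itself: these match the clauses of [ok_pair]. *)
  case: t => [|[|t]]; [lia|lia|].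
  rewrite !mulSn; move: (t * m)%N => c; lia.
have no (z : int) : 1 - k2%:Z <= z <= (k1 + k2)%N%:Z ->
    ~~ (m %| absz ((X j : nat)%:Z - (X i : nat)%:Z - z)%R)%N.
  move=> hz; have [e [te he ge]] := gain_onto i j hz.
  by have := h e; rewrite inE te he /igain ge sub_eq_intr; apply.
have := Xlt i; have := Xlt j; move: no.
move: (nat_of_ord (X i)) (nat_of_ord (X j)) => xi xj no hj hi.
apply/and3P; split; apply/negPn/negP => hh.
- have hz : 1 - k2%:Z <= xj%:Z - xi%:Z <= (k1 + k2)%N%:Z by lia.
  by case/negP: (no _ hz); rewrite subrr.
- have hz : 1 - k2%:Z <= xj%:Z - xi%:Z - m%:Z <= (k1 + k2)%N%:Z by lia.
  case/negP: (no _ hz); have -> : absz (xj%:Z - xi%:Z - (xj%:Z - xi%:Z - m%:Z))%R = m by lia.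
  exact: dvdnn.
- have hz : 1 - k2%:Z <= xj%:Z - xi%:Z + m%:Z <= (k1 + k2)%N%:Z by lia.
  case/negP: (no _ hz); have -> : absz (xj%:Z - xi%:Z - (xj%:Z - xi%:Z + m%:Z))%R = m by lia.
  exact: dvdnn.
Qed.

Lemma coloring_shift (X : {ffun V -> 'I_m}) (t : 'I_m) :
  ([ffun v => X v + t] \in colorings n.+1 a b m) = (X \in colorings n.+1 a b m).
Proof.
rewrite !inE; apply: eq_forallb => e; congr (_ ==> _).
by rewrite !ffunE [X (gtail e) + t]addrC addrKA.
Qed.

Lemma card_colorings_placements :
  #|colorings n.+1 a b m| = (m * #|placements n k1 k2 M|)%N.
Proof.
rewrite mulnC -[X in (_ * X)%N](card_ord m) -cardsT -cardsX.
pose h (p : {ffun V -> 'I_m} * 'I_m) : {ffun V -> 'I_m} := [ffun v => p.1 v + p.2].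
rewrite -(card_in_imset (f := h)).
  apply: eq_card => X; apply/idP/imsetP => [XC|[[Y t] YP ->]].
    exists ([ffun v => X v - X ord_max], X ord_max); last first.
      by apply/ffunP => v; rewrite !ffunE subrK.
    rewrite !inE andbT -coloring_valid /= ffunE subrr eqxx /=.
    rewrite -(coloring_shift _ (X ord_max)).
    suff -> : [ffun v => [ffun v0 => X v0 - X ord_max] v + X ord_max] = X by [].
    by apply/ffunP => v; rewrite !ffunE subrK.
  rewrite (coloring_shift Y t) coloring_valid.
  by move: YP; rewrite !inE andbT => /andP[].
move=> [Y t] [Y' t']; rewrite !inE !andbT => /andP[/= /eqP Y0 _] /andP[/= /eqP Y0' _] hh.
have val0 (x : 'I_m) : x = 0%N :> nat -> x = 0 by move=> x0; apply: val_inj.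
have tt : t = t'.
  by move/ffunP/(_ ord_max): hh; rewrite !ffunE /= (val0 _ Y0) (val0 _ Y0') !add0r.
rewrite tt in hh *; congr (_, _); apply/ffunP => v.
by move/ffunP/(_ v): hh; rewrite !ffunE /= => /addIr.
Qed.

End ColoringsCount.

(* For large m the number of colourings is m times the value at m of a single
   polynomial, while the placement count gives m times a polynomial depending only
   on the residue of m modulo k1 + 1; hence all those polynomials coincide with
   their average. *)
Section NbcPolynomial.
Variables (n k1 k2 : nat).
Local Notation V := 'I_n.+1.
Local Notation q := k1.+1.
Local Notation a := (1 - k2%:Z).
Local Notation b := ((k1 + k2)%N%:Z).
Hypothesis k1_gt0 : (0 < k1)%N.
Variable r : gedge n.+1 a b -> nat.
Hypothesis r_inj : {in Kedges n.+1 a b &, injective r}.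

Definition nbc_poly : {poly rat} :=
  \sum_(B : {set gedge n.+1 a b} | `[< nbc_basis r B >]) 'X^(activity r B).

Definition wsum (d : {ffun V -> 'I_q}) : nat := (\sum_v (k2 + d v))%N.

Lemma poly_eq_infinite (p p' : {poly rat}) (N c s : nat) : (0 < c)%N ->
  (forall t : nat, (N <= t)%N -> p.[(t * c + s)%N%:R] = p'.[(t * c + s)%N%:R]) -> p = p'.
Proof.
move=> c0 h; apply/eqP; rewrite -subr_eq0; apply/eqP.
apply: (roots_geq_poly_eq0 (rs := [seq ((t * c + s)%N%:R : rat) | t <- iota N (size (p - p'))])).
- apply/allP => x /mapP[t]; rewrite mem_iota => /andP[Nt _] ->.
  by rewrite rootE hornerD hornerN h // subrr.
- rewrite map_inj_uniq ?iota_uniq // => t t' /eqP; rewrite eqr_nat eqn_add2r eqn_pmul2r //.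
  by move=> /eqP.
- by rewrite size_map size_iota.
Qed.

Lemma horner_nbc_poly (t : nat) :
  (n.+1 * (absz a + absz (b - a)) + (n.+1 * (k1 + k2) + (k1 + k2).+1) < t)%N ->
  (-1) ^+ n * nbc_poly.[1 - t%:R]
  = \sum_(d : {ffun V -> 'I_q} | wsum d == t %[mod q]) ((t%:R - (wsum d)%:R) / q%:R) ^+ n.
Proof.
case: t => [//|[|M]] tbig; first by move: tbig; rewrite !addnS ltnS ltn0.
have m_big : (n.+1 * (k1 + k2) + (k1 + k2).+1 <= M.+2)%N.
  by move: tbig; move: (_ * (absz a + _))%N (_ * (k1 + k2))%N => u v; lia.
have m_big' : (n.+1 * (absz a + absz (b - a)) < M.+2)%N.
  by move: tbig; move: (_ * (absz a + _))%N (_ * (k1 + k2))%N => u v; lia.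
have := card_colorings (ltn0Sn n) r_inj (isT : (1 < M.+2)%N) m_big'.
rewrite card_colorings_placements // card_placements // card_codes //.
rewrite PoszM -mulrA => /mulfI E.
have {}E := E isT.
transitivity ((\sum_(d : {ffun V -> 'I_q} | q %| slack k2 M d) (slack k2 M d %/ q) ^ n)%N%:Z%:~R : rat).
  rewrite E rmorphM /= rmorphXn /= rmorphN1 rmorph_sum /= /nbc_poly horner_sum.
  congr (_ * _); apply: eq_bigr => B _; rewrite hornerXn rmorphXn /=.
  by rewrite rmorphB /= rmorph1.
rewrite -pmulrn natr_sum; apply: eq_big => d.
  by rewrite eq_sym eqn_mod_dvd // -(slackE m_big d) leq_addr.
have sl : slack k2 M d = (M.+2 - wsum d)%N by [].
have le : (wsum d <= M.+2)%N by rewrite -(slackE m_big d) leq_addr.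
move=> dv; rewrite natrX; congr (_ ^+ n).
by rewrite natf_div // sl natrB.
Qed.

Lemma nbc_polyE :
  nbc_poly = q%:R ^- n.+1 *: \sum_(d : {ffun V -> 'I_q}) ('X + ((wsum d)%:R - 1)%:P) ^+ n.
Proof.
pose pr (s : nat) : {poly rat} := \sum_(d : {ffun V -> 'I_q} | wsum d == s %[mod q])
   ((1 - 'X - (wsum d)%:R%:P) * (q%:R^-1)%:P) ^+ n.
have key s : (-1) ^+ n *: nbc_poly = pr s.
  pose N := (n.+1 * (absz a + absz (b - a)%R) + (n.+1 * (k1 + k2) + (k1 + k2).+1))%N.+1.
  (* The substitution of [1 - 'X] is its own inverse, so it can be undone after comparing values at
     [1 - t]. *)
  suff E : ((-1) ^+ n *: nbc_poly) \Po (1 - 'X) = pr s \Po (1 - 'X).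
    have K (p : {poly rat}) : (p \Po (1 - 'X)) \Po (1 - 'X) = p.
      rewrite -comp_polyA comp_polyB comp_polyX -polyC1 comp_polyC opprB addrCA.
      by rewrite subrr addr0 comp_polyXr.
    by rewrite -(K (_ *: _)) E K.
  apply: (@poly_eq_infinite _ _ N q s) => // t Nt.
  rewrite !horner_comp hornerZ !hornerE horner_nbc_poly; last first.
    by apply: leq_trans (leq_addr _ _); apply: leq_trans (leq_pmulr _ _).
  rewrite /pr horner_sum; apply: eq_big => d; first by rewrite modnMDl.
  by move=> _; rewrite !hornerE opprB addrCA subrr addr0.
have qn0 : (q%:R : rat) != 0 by rewrite pnatr_eq0.
(* [key] holds for every residue [s]; adding up the [q] cases collects each [d] once, under its own
   residue. *)
have : (-1) ^+ n *: nbc_poly *+ q = \sum_(d : {ffun V -> 'I_q})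
   ((1 - 'X - (wsum d)%:R%:P) * (q%:R^-1)%:P) ^+ n.
  rewrite -[X in _ *+ X](card_ord q) -sumr_const (eq_bigr (fun s : 'I_q => pr s)) => [|s _]; last first.
    by rewrite -key.
  rewrite /pr (exchange_big_dep xpredT) //=; apply: eq_bigr => d _.
  rewrite (big_pred1 (inord (wsum d %% q))) // => s.
  rewrite [(s %% q)%N]modn_small //=; apply/eqP/eqP => [e|->].
    by apply: val_inj; rewrite /= inordK ?ltn_pmod.
  by rewrite inordK ?ltn_pmod.
rewrite -scaler_nat => E.
have sg : (-1) ^+ n * (-1) ^+ n = 1 :> rat by rewrite -exprMn mulrNN mulr1 expr1n.
have {}E : nbc_poly = (q%:R^-1 * (-1) ^+ n) *: \sum_(d : {ffun V -> 'I_q})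
   ((1 - 'X - (wsum d)%:R%:P) * (q%:R^-1)%:P) ^+ n.
  rewrite -E !scalerA -[LHS]scale1r; congr (_ *: _).
  by move: (q%:R) ((-1) ^+ n) qn0 sg => Q s Q0 sg; rewrite -[LHS]sg; field.
rewrite {}E !scaler_sumr; apply: eq_bigr => d _.
have -> : (1 - 'X - (wsum d)%:R%:P : {poly rat}) = -1 *: ('X + ((wsum d)%:R - 1)%:P).
  by rewrite scaleN1r polyCB -polyC1; ring.
rewrite exprMn -polyC_exp [X in _ *: X]mulrC mul_polyC exprZn !scalerA; congr (_ *: _).
rewrite exprS invfM exprVn -!mulrA; congr (_ * _).
by rewrite mulrCA sg mulr1.
Qed.
End NbcPolynomial.

(** * The ring of set functions *)

(** A separate name carrying only the additive structure, so that the product can be subset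
    convolution and not the pointwise one. *)
Definition sfun (T : finType) : Type := {ffun {set T} -> rat}.

HB.instance Definition _ (T : finType) := GRing.Zmodule.on (sfun T).

Section SetFunctionRing.
Variable T : finType.
Local Notation A := (sfun T).
Implicit Types F G H : A.

Definition sfun_of (F : {set T} -> rat) : A := [ffun X => F X].

Definition sfun_mul F G : A :=
  sfun_of (fun X => \sum_(Y : {set T} | Y \subset X) F Y * G (X :\: Y)).

Definition sfun_one : A := sfun_of (fun X => (X == set0)%:R).

Lemma setDDK (X Y : {set T}) : Y \subset X -> X :\: (X :\: Y) = Y.
Proof. by move=> YX; rewrite setDDr setDv set0U; apply/setIidPr. Qed.

Lemma sfun_mulC : commutative sfun_mul.
Proof.
move=> F G; apply/ffunP => X; rewrite !ffunE.
rewrite (reindex_onto (fun Y => X :\: Y) (fun Y => X :\: Y)); last by move=> Y; apply: setDDK.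
apply: eq_big => [Y|Y /andP[_ /eqP ->]]; last by rewrite mulrC.
rewrite subsetDl /=; apply/eqP/idP => [<-|/setDDK//]; exact: subsetDl.
Qed.

Lemma sfun_mulA : associative sfun_mul.
Proof.
move=> F G H; apply/ffunP => X; rewrite !ffunE.
under eq_bigr => Y _ do rewrite ffunE mulr_sumr.
under [RHS]eq_bigr => Y _ do rewrite ffunE mulr_suml.
rewrite [RHS](exchange_big_dep (fun Z : {set T} => Z \subset X)) /=; last first.
  by move=> Y Z YX ZY; apply: subset_trans ZY YX.
apply: eq_bigr => Z ZX.
rewrite (reindex_onto (fun Y => Y :\: Z) (fun Y => Z :|: Y)) /=; last first.
  move=> Y; rewrite subsetD => /andP[_ YZ]; rewrite setDUl setDv set0U.
  by apply/setDidPl.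
apply: eq_big => Y.
  apply/andP/andP => [[YX /eqP <-]|[YX ZY]].
    rewrite subsetUl; split=> //; rewrite subUset ZX.
    by apply: subset_trans YX _; apply: subsetDl.
  split; first exact: setSD.
  apply/eqP/setP => w; rewrite !inE; case: (boolP (w \in Z)) => //= wZ.
  by rewrite (subsetP ZY).
move=> /andP[_ /eqP YE]; rewrite -mulrA; congr (_ * (_ * H _)).
by rewrite setDDl YE.
Qed.

Lemma sfun_mul1 : left_id sfun_one sfun_mul.
Proof.
move=> F; apply/ffunP => X; rewrite ffunE (bigD1 set0) ?sub0set //= ffunE eqxx mul1r setD0.
by rewrite big1 ?addr0 // => Y /andP[_ /negPf Y0]; rewrite ffunE Y0 mul0r.
Qed.

Lemma sfun_mulDl : left_distributive sfun_mul +%R.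
Proof.
move=> F G H; apply/ffunP => X; rewrite !ffunE -big_split /=.
by apply: eq_bigr => Y _; rewrite ffunE mulrDl.
Qed.

Lemma sfun_one_neq0 : sfun_one != 0.
Proof.
by apply/eqP => /ffunP/(_ set0); rewrite !ffunE eqxx => /eqP; rewrite oner_eq0.
Qed.

HB.instance Definition _ := GRing.Zmodule_isComNzRing.Build (sfun T)
  sfun_mulA sfun_mulC sfun_mul1 sfun_mulDl sfun_one_neq0.

Lemma sfunM F G X : (F * G) X = \sum_(Y : {set T} | Y \subset X) F Y * G (X :\: Y).
Proof. by rewrite [LHS]ffunE. Qed.

Lemma sfun1 X : (1 : A) X = (X == set0)%:R.
Proof. by rewrite [LHS]ffunE. Qed.

Lemma sfunD F G X : (F + G) X = F X + G X.
Proof. by rewrite [LHS]ffunE. Qed.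

Lemma sfunN F X : (- F) X = - F X.
Proof. by rewrite [LHS]ffunE. Qed.

Lemma sfun0 X : (0 : A) X = 0.
Proof. by rewrite [LHS]ffunE. Qed.

Lemma sfun_sum I (s : seq I) (P : pred I) (F : I -> A) X :
  (\sum_(i <- s | P i) F i) X = \sum_(i <- s | P i) F i X.
Proof.
by apply: (big_morph (fun F : A => F X)) => [F1 F2|]; rewrite ?sfunD ?sfun0.
Qed.

Lemma sfunMn F k X : (F *+ k) X = F X *+ k.
Proof. by elim: k => [|k IH]; rewrite ?mulr0n ?sfun0 // !mulrS sfunD IH. Qed.

(** The variable x_v of multilinear power series; its square is 0 because a set holds [v] at most
    once. *)
Definition svar (v : T) : A := sfun_of (fun X => (X == [set v])%:R).

Lemma svarM v F X : (svar v * F) X = if v \in X then F (X :\ v) else 0.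
Proof.
rewrite sfunM; case: ifP => vX.
  rewrite (bigD1 [set v]) ?sub1set //= ffunE eqxx mul1r big1 ?addr0 //.
  by move=> Y /andP[_ /negPf Yv]; rewrite ffunE Yv mul0r.
rewrite big1 // => Y YX; rewrite ffunE; case: eqP => [Yv|_]; last by rewrite mul0r.
by move: YX; rewrite Yv sub1set vX.
Qed.

Lemma svar2 v : svar v * svar v = 0.
Proof.
apply/ffunP => X; rewrite svarM sfun0; case: ifP => // vX; rewrite ffunE.
by case: eqP => // /setP/(_ v); rewrite !inE eqxx.
Qed.

Lemma svar_prod (R : {set T}) F X :
  ((\prod_(v in R) svar v) * F) X = if R \subset X then F (X :\: R) else 0.
Proof.
have [k] := ubnP #|R|; elim: k R X => // k IH R X.
have [->|[v vR]] := set_0Vmem R; first by rewrite big_set0 mul1r sub0set setD0.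
rewrite (cardsD1 v) vR /= => hk; rewrite (big_setD1 v) //= -mulrA svarM.
have -> : (R \subset X) = (v \in X) && (R :\ v \subset X).
  by rewrite -{1}(setD1K vR) subUset sub1set.
case: ifP => //= vX.
rewrite IH // subsetD1 !inE eqxx andbT.
by rewrite setDDl setD1K.
Qed.

(** Equality of series below degree [k]. Multiplying by a variable gains one degree ([agree_svar]),
    which makes the tree equation contracting. *)
Definition agree k F G := forall X : {set T}, (#|X| < k)%N -> F X = G X.

Lemma agreeD k F F' G G' : agree k F F' -> agree k G G' -> agree k (F + G) (F' + G').
Proof. by move=> h1 h2 X Xk; rewrite !sfunD h1 ?h2. Qed.

Lemma agreeN k F F' : agree k F F' -> agree k (- F) (- F').
Proof. by move=> h X Xk; rewrite !sfunN h. Qed.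

Lemma agreeM k F F' G G' : agree k F F' -> agree k G G' -> agree k (F * G) (F' * G').
Proof.
move=> h1 h2 X Xk; rewrite !sfunM; apply: eq_bigr => Y YX; rewrite h1 ?h2 //.
  by apply: leq_ltn_trans Xk; apply: subset_leq_card; apply: subsetDl.
by apply: leq_ltn_trans Xk; apply: subset_leq_card.
Qed.

Lemma agree_prod k I (s : seq I) (P : pred I) (F F' : I -> A) :
  (forall i, agree k (F i) (F' i)) ->
  agree k (\prod_(i <- s | P i) F i) (\prod_(i <- s | P i) F' i).
Proof.
by move=> h; apply: (big_ind2 (agree k)) => [||i _]; [|move=> *; exact: agreeM|exact: h].
Qed.

Lemma agree_sum k I (s : seq I) (P : pred I) (F F' : I -> A) :
  (forall i, agree k (F i) (F' i)) ->
  agree k (\sum_(i <- s | P i) F i) (\sum_(i <- s | P i) F' i).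
Proof.
by move=> h; apply: (big_ind2 (agree k)) => [||i _]; [|move=> *; exact: agreeD|exact: h].
Qed.

Lemma agreeX k F F' j : agree k F F' -> agree k (F ^+ j) (F' ^+ j).
Proof. by move=> h; elim: j => [|j IH]; rewrite ?expr0 // !exprS; apply: agreeM. Qed.

Lemma agree_svar k v F F' : agree k F F' -> agree k.+1 (svar v * F) (svar v * F').
Proof.
move=> h X Xk; rewrite !svarM; case: ifP => // vX; apply: h.
by move: Xk; rewrite (cardsD1 v) vX.
Qed.

End SetFunctionRing.

(** * The functional equation of the tree series *)

Section TreeSeries.
Variables (n k1 k2 : nat).
Local Notation V := 'I_n.
Local Notation A := (sfun V).
Local Notation q := k1.+1.

Definition Eall (tau : V -> A) : A := \prod_i (1 + tau i).
Definition Egt (tau : V -> A) (v : V) : A := \prod_(i : V | (v < i)%N) (1 + tau i).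
(** Series of what hangs below [v]; each available colour contributes a factor [E]. First term: no
    colour below [k1]. Summand [c]: all colours at least [c], minus the cases where the children of
    colour [c] all exceed [v], which include having none. *)
Definition Wroot (tau : V -> A) (v : V) : A :=
  Eall tau ^+ k2 + \sum_(c < k1)
    (Eall tau ^+ (k1 + k2 - c) - Eall tau ^+ (k1 + k2 - c.+1) * Egt tau v).

(** Iteration from 0: each round settles one more degree, and sets have at most [n] elements. *)
Lemma tau_exists : exists tau : V -> A, forall v, tau v = svar v * Wroot tau v.
Proof.
pose T := fix T j : V -> A := if j is j'.+1 then fun v => svar v * Wroot (T j') v else fun=> 0.
have ag j : forall v, agree j (T j v) (T j.+1 v).
  elim: j => [|j IH] v //; apply: agree_svar.
  have E1 : agree j (Eall (T j)) (Eall (T j.+1)).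
    by apply: agree_prod => i; apply: agreeD.
  have P1 : agree j (Egt (T j) v) (Egt (T j.+1) v).
    by apply: agree_prod => i; apply: agreeD.
  apply: agreeD; first exact: agreeX.
  apply: agree_sum => c; apply: agreeD; first exact: agreeX.
  by apply: agreeN; apply: agreeM => //; apply: agreeX.
exists (T n.+1) => v; apply/ffunP => X; apply: (ag n.+1 v).
by rewrite ltnS -[leqRHS](card_ord n) max_card.
Qed.

Variable tau : V -> A.
Hypothesis tauE : forall v, tau v = svar v * Wroot tau v.
Local Notation E := (Eall tau).

Lemma svar_tau v : svar v * tau v = 0.
Proof. by rewrite tauE mulrA svar2 mul0r. Qed.

Lemma tau2 v : tau v * tau v = 0.
Proof. by rewrite {1}tauE mulrAC svar_tau mul0r. Qed.

Lemma expr_1D_nilp (R : comNzRingType) (t : R) j : t * t = 0 -> (1 + t) ^+ j = 1 + t *+ j.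
Proof.
move=> t2; elim: j => [|j IH]; first by rewrite mulr0n addr0.
by rewrite exprS IH mulrDl mul1r mulrDr mulr1 mulrnAr t2 mul0rn addr0 -addrA -mulrSr.
Qed.

Lemma Eall_unit : exists E', E * E' = 1.
Proof.
exists (\prod_i (1 - tau i)); rewrite -big_split big1 //= => i _.
by rewrite mulrDl mul1r mulrBr mulr1 tau2 subr0 subrK.
Qed.

Definition Gs : A := \sum_(c < k1) E ^+ (k1 + k2 - c.+1).
Definition Hs : A := \sum_(i < q) E ^+ (k2 + i).

Lemma HsE : Hs = E ^+ k2 + E * Gs.
Proof.
rewrite /Hs big_ord_recl addn0 mulr_sumr; congr (_ + _).
rewrite (reindex_inj rev_ord_inj) /=; apply: eq_bigr => c _.
by rewrite -exprS; congr (_ ^+ _); have := ltn_ord c; rewrite /bump /=; lia.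
Qed.

Lemma Wroot_eq v : Wroot tau v = Hs - Gs * Egt tau v.
Proof.
rewrite /Wroot HsE sumrB -mulr_suml -/Gs addrA; congr (_ + _ - _).
rewrite /Gs mulr_sumr; apply: eq_bigr => c _; rewrite -exprS; congr (_ ^+ _).
by have := ltn_ord c; lia.
Qed.

Lemma Hs_sub_Gs : Hs - Gs = E ^+ (k1 + k2).
Proof.
rewrite /Hs big_ord_recr /= addrAC [X in X - _](_ : _ = Gs) ?subrr ?add0r 1?addnC //.
rewrite /Gs (reindex_inj rev_ord_inj) /=; apply: eq_bigr => c _.
by congr (_ ^+ _); have := ltn_ord c; lia.
Qed.

Definition Pge k : A := \prod_(i : V | (k <= i)%N) (1 + tau i).

Lemma Pge_ind k (F : V -> A) (kn : (k < n)%N) :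
  \prod_(i : V | (k <= i)%N) F i = F (Ordinal kn) * \prod_(i : V | (k < i)%N) F i.
Proof.
rewrite (bigD1 (Ordinal kn)) //=; congr (_ * _); apply: eq_bigl => i.
by rewrite -val_eqE /=; lia.
Qed.

(* The quantity P / (H - G P) is multiplied by 1 + x_v H when the vertex v is added. *)
Lemma Pge_logistic k : (k <= n)%N ->
  Pge k * (Hs - Gs) = (Hs - Gs * Pge k) * \prod_(i : V | (k <= i)%N) (1 + svar i * Hs).
Proof.
move=> kn; rewrite -(subKn kn); move: (n - k)%N (leq_subr k n) => j.
elim: j => [|j IH] jn.
  have no (F : V -> A) : \prod_(i : V | (n - 0 <= i)%N) F i = 1.
    by rewrite big1 // => i; rewrite subn0 leqNgt ltn_ord.
  by rewrite /Pge !no mulr1 mul1r mulr1.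
have jn' := ltnW jn; have {IH} := IH jn'.
have lt : (n - j.+1 < n)%N by lia.
have nE : (n - j)%N = (n - j.+1).+1 by lia.
rewrite /Pge !(Pge_ind _ lt) nE.
set P := \prod_(i < n | (n - j.+1 < i)%N) (1 + tau i); set Pi := \prod_(i < n | (n - j.+1 < i)%N) (1 + svar i * Hs).
have := tauE (Ordinal lt); rewrite Wroot_eq -[Egt _ _]/P; set x := svar _; set t := tau _.
have x2 : x * x = 0 by apply: svar2.
move=> -> IH.
transitivity ((1 + x * (Hs - Gs * P)) * (P * (Hs - Gs))); first by ring.
rewrite IH.
have e1 : (1 + x * (Hs - Gs * P)) * (Hs - Gs * P) =
   (Hs - Gs * ((1 + x * (Hs - Gs * P)) * P)) * (1 + x * Hs)
   + x * x * (Hs * Gs * P * (Hs - Gs * P)) by ring.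
by rewrite mulrA [RHS]mulrA e1 x2 mul0r addr0.
Qed.

(** [Pge_logistic] at 0. There [Hs - Gs] is [E ^+ (k1 + k2)] and [Hs - Gs * E] is [E ^+ k2], which
    is cancelled since [E] is a unit. *)
Lemma Eall_pow : E ^+ q = \prod_i (1 + svar i * Hs).
Proof.
have := Pge_logistic (leq0n n).
have all (F : V -> A) : \prod_(i : V | (0 <= i)%N) F i = \prod_i F i by apply: eq_bigl.
rewrite /Pge !all -/E Hs_sub_Gs -exprS.
have -> : Hs - Gs * E = E ^+ k2 by rewrite HsE mulrC addrK.
have [E' EE'] := Eall_unit => eq1.
have : E' ^+ k2 * (E ^+ (k1 + k2).+1) = E' ^+ k2 * (E ^+ k2 * \prod_i (1 + svar i * Hs)).
  by rewrite eq1.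
by rewrite mulrA -exprMn [E' * E]mulrC EE' expr1n mul1r -addSn exprD mulrCA -exprMn [E' * E]mulrC EE' expr1n mulr1.
Qed.

Definition wset (B : {set V}) (d : {ffun V -> 'I_q}) : nat := (\sum_(v in B) (k2 + d v))%N.

(** The power of [Hs] expands over functions on [B] with [q] values; letting them run over all of
    [V] counts each one [q ^ (n - #|B|)] times. *)
Lemma Hs_pow (B : {set V}) :
  Hs ^+ #|B| *+ q ^ (n - #|B|) = \sum_(d : {ffun V -> 'I_q}) E ^+ wset B d.
Proof.
transitivity (\prod_(v : V) \sum_(i < q) (if v \in B then E ^+ (k2 + i) else 1)); last first.
  rewrite bigA_distr_bigA; apply: eq_bigr => d _.
  by rewrite -big_mkcond /wset /= prodrXr.
rewrite (bigID (mem B)) /=.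
rewrite (eq_bigr (fun=> Hs)) => [|v vB]; last by apply: eq_bigr => i _; rewrite vB.
rewrite [X in _ * X](eq_bigr (fun=> q%:R)) => [|v /negPf vB]; last first.
  by under eq_bigr => i _ do rewrite vB; rewrite sumr_const card_ord.
rewrite !prodr_const -natrX mulr_natr; congr (_ *+ _ ^ _).
rewrite -[RHS]/(#|[pred i | i \notin B]|) (_ : #|[pred i | i \notin B]| = #|~: B|).
  have := cardsC B; rewrite card_ord.
  by move: #|B| #|~: B| => s s' e; rewrite -[in LHS]e addKn.
by apply: eq_card => v; rewrite !inE.
Qed.

Lemma Eall_powM (N : nat) (X : {set V}) :
  (E ^+ (q * N)) X = \sum_(B : {set V} | B \subset X) (Hs ^+ #|B|) (X :\: B) *+ N ^ #|B|.
Proof.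
rewrite exprM Eall_pow -prodrXl.
rewrite (eq_bigr (fun i => svar i * Hs *+ N + 1)) => [|i _]; last first.
  by rewrite expr_1D_nilp 1?addrC // mulrACA svar2 mul0r.
rewrite bigA_distr sfun_sum [RHS]big_mkcond /=; apply: eq_bigr => B _.
have -> : \prod_i (if i \in B then svar i * Hs *+ N else 1) =
    ((\prod_(i in B) svar i) * Hs ^+ #|B|) *+ N ^ #|B|.
  rewrite -big_mkcond /= -prodr_const -big_split /= -mulr_natr natrX -prodr_const -big_split /=.
  by apply: eq_bigr => i _; rewrite mulr_natr.
by rewrite sfunMn svar_prod; case: ifP => // _; rewrite mul0rn.
Qed.
End TreeSeries.

(** Swapping the values of [d] and [d'] outside [B] moves everything that [F] sees into [d] and
    leaves [d'] free. *)
Lemma sum_ffun_indep (T I : finType) (B : {set T}) (F : {ffun T -> I} -> {ffun T -> I} -> rat) :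
  (forall d1 d2 d' : {ffun T -> I}, {in B, d1 =1 d2} -> F d1 d' = F d2 d') ->
  (forall d d1 d2 : {ffun T -> I}, {in ~: B, d1 =1 d2} -> F d d1 = F d d2) ->
  \sum_d \sum_d' F d d' = (#|I| ^ #|T|)%N%:R * \sum_d F d d.
Proof.
move=> h1 h2; pose mix (d d' : {ffun T -> I}) : {ffun T -> I} :=
  [ffun v => if v \in B then d v else d' v].
pose sw (p : {ffun T -> I} * {ffun T -> I}) := (mix p.1 p.2, mix p.2 p.1).
have swK : involutive sw.
  move=> [d d']; rewrite /sw /=; congr (_, _); apply/ffunP => v; rewrite !ffunE;
  by case: (v \in B).
rewrite pair_bigA /= (reindex_inj (inv_inj swK)) /=.
rewrite -(pair_bigA _ (fun d d' => F (mix d d') (mix d' d))) /= mulr_sumr.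
apply: eq_bigr => d _; rewrite (eq_bigr (fun=> F d d)) => [|d' _].
  by rewrite sumr_const card_ffun mulr_natl.
rewrite (h1 _ d) => [|v vB]; last by rewrite ffunE vB.
by apply: h2 => v; rewrite inE => /negPf vB; rewrite ffunE vB.
Qed.

Lemma sum_subset_expr2 (T : finType) (D : {set T}) (y z : rat) :
  \sum_(A : {set T} | A \subset D) y ^+ #|A| * z ^+ #|D :\: A| = (y + z) ^+ #|D|.
Proof.
transitivity (\prod_i (if i \in D then y + z else 1 : rat)); last first.
  by rewrite -big_mkcond prodr_const.
transitivity (\prod_i ((if i \in D then y else 0) + (if i \in D then z else 1) : rat)); last first.
  by apply: eq_bigr => i _; case: ifP => _ //; rewrite add0r.
rewrite bigA_distr big_mkcond /=; apply: eq_bigr => A _.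
case: ifP => [sA|/negbT].
  rewrite (bigID (mem A)) /=; congr (_ * _).
    rewrite -prodr_const; apply: eq_bigr => i iA.
    by rewrite iA (subsetP sA).
  rewrite (bigID (mem D)) /= [X in _ * X]big1 ?mulr1; last first.
    by move=> i /andP[/negPf-> /negPf->].
  rewrite -prodr_const; apply: eq_big => [i|i]; first by rewrite !inE.
  by rewrite inE => /andP[/negPf-> ->].
move/subsetPn => [i iA iD]; rewrite (bigD1 i) //= iA (negPf iD) mul0r //.
Qed.

(** Since w(B) + w(X minus B) is the constant [D], the factor w(B) can be split over [v] in [B]. For
    fixed [v] a binomial sum over subsets of [X] without [v] remains, divided by [D]; summing the
    weights of [v] restores this [D]. *)
Lemma abel_sum (T : finType) (w : T -> nat) (X : {set T}) (y : rat) : X != set0 ->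
  \sum_(B : {set T} | B \subset X) y ^+ #|B| *
    (if X :\: B == set0 then 1
     else (\sum_(v in B) w v)%N%:R * ((\sum_(v in B) w v)%N%:R + (\sum_(v in X :\: B) w v)%N%:R)
        ^+ #|X :\: B|.-1)
  = y * (y + (\sum_(v in X) w v)%N%:R) ^+ #|X|.-1.
Proof.
move=> X0; set D : rat := (\sum_(v in X) w v)%N%:R.
have Xc : #|X| = #|X|.-1.+1 by rewrite prednK // card_gt0.
pose ter (A B : {set T}) : rat := y ^+ #|B| * D ^+ #|A :\: B|.-1.
have prE (B : {set T}) : B \subset X -> (X :\: B == set0) = (B == X).
  by move=> BX; rewrite setD_eq0 eqEsubset BX.
transitivity (y ^+ #|X| + \sum_(B : {set T} | B \proper X) \sum_(v in B) (w v)%:R * ter X B).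
  rewrite (bigD1 X) //= setDv eqxx mulr1; congr (_ + _).
  apply: eq_big => [B|B /andP[BX BnX]]; first by rewrite properEneq andbC.
  rewrite prE // (negPf BnX) -mulr_suml natr_sum /ter mulrCA; congr (_ * (_ * _ ^+ _)).
  rewrite -natr_sum -natrD /D; congr (_%:R).
  by rewrite [in RHS](big_setID B) /= (setIidPr BX).
rewrite (exchange_big_dep (fun v => v \in X)) /=; last first.
  by move=> B v /proper_sub/subsetP BX /BX.
(* The binomial sum will be divided by [D]; when [D] is 0 all weights on [X] vanish. *)
have [D0|D0] := eqVneq D 0.
  rewrite big1 ?addr0; first by rewrite D0 addr0 -exprS -Xc.
  move=> v vX; have : (\sum_(v in X) w v)%N == 0%N by rewrite -(eqr_nat rat) -/D D0.
  rewrite sum_nat_eq0 => /forall_inP/(_ v vX)/eqP ->.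
  by rewrite big1 // => B _; rewrite mul0r.
have U (A : {set T}) :
    (\sum_(B : {set T} | B \proper A) ter A B) * D = (y + D) ^+ #|A| - y ^+ #|A|.
  rewrite -sum_subset_expr2 [in RHS](bigD1 A) //= setDv cards0 expr0 mulr1 addrAC subrr add0r.
  rewrite mulr_suml; apply: eq_big => [B|B BA]; first by rewrite properEneq andbC.
  rewrite /ter -mulrA -exprSr prednK // card_gt0 setD_eq0.
  by case/properP: BA => _ [v vA vB]; apply/subsetPn; exists v.
have inner v : v \in X ->
    \sum_(B : {set T} | (B \proper X) && (v \in B)) (w v)%:R * ter X B
    = (w v)%:R * (y * (((y + D) ^+ #|X|.-1 - y ^+ #|X|.-1) / D)).
  move=> vX; rewrite -mulr_sumr; congr (_ * _).
  have -> : #|X|.-1 = #|X :\ v| by rewrite (cardsD1 v X) vX.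
  rewrite -U mulfK // mulr_sumr.
  rewrite (reindex_onto (fun B => v |: B) (fun B => B :\ v)) /=; last first.
    by move=> B /andP[_ vB]; rewrite setD1K.
  apply: eq_big => [B|B].
    rewrite setU11 andbT; apply/andP/idP => [[/properP[sB [u uX]]]|/properP[sB [u]]].
      rewrite !inE negb_or => /andP[uv uB] /eqP BE.
      apply/properP; split; first by rewrite -BE setSD.
      by exists u; rewrite // !inE uv.
    rewrite !inE => /andP[uv uX] uB; have vB : v \notin B.
      by apply/negP => /(subsetP sB); rewrite !inE eqxx.
    split; last by rewrite setU1K.
    apply/properP; split; last by exists u; rewrite // !inE negb_or uv.
    rewrite subUset sub1set vX; apply: subset_trans sB _; exact: subsetDl.
  move=> /andP[_ /eqP BE].
  have vB : v \notin B by rewrite -BE setD11.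
  rewrite /ter cardsU1 vB exprS -mulrA; congr (_ * (_ * _ ^+ _)).
  by rewrite setDDl.
rewrite (eq_bigr _ inner) -mulr_suml -natr_sum -/D.
rewrite {1}Xc exprS; move: (_ ^+ _) (_ ^+ _) => s s'.
by field.
Qed.

(** * Coefficients of the powers of [E] *)

Section Lagrange.
Variables (n k1 k2 : nat).
Local Notation V := 'I_n.
Local Notation A := (sfun V).
Local Notation q := k1.+1.
Variable tau : V -> A.
Hypothesis tauE : forall v, tau v = svar v * Wroot k1 k2 tau v.
Local Notation E := (Eall tau).

(** As each [tau r] squares to zero, [E ^+ y] expands over sets [R] with weight [y ^ #|R|]; this is
    its value at [X] as a polynomial in [y]. *)
Definition epoly (X : {set V}) : {poly rat} :=
  \sum_(R : {set V}) (\prod_(r in R) tau r) X *: 'X^#|R|.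

Lemma EallX y X : (E ^+ y) X = (epoly X).[y%:R].
Proof.
rewrite /epoly horner_sum -prodrXl.
rewrite (eq_bigr (fun i => tau i *+ y + 1)) => [|i _]; last first.
  by rewrite (expr_1D_nilp _ (tau2 tauE i)) addrC.
rewrite bigA_distr sfun_sum; apply: eq_bigr => R _.
rewrite -big_mkcond /= hornerZ hornerXn -natrX mulr_natr -sfunMn; apply: (congr1 (fun F : A => F X)).
rewrite -mulr_natr natrX -prodr_const -big_split /=.
by apply: eq_bigr => i _; rewrite mulr_natr.
Qed.

Lemma tau_support v (X : {set V}) : v \notin X -> tau v X = 0.
Proof. by rewrite tauE svarM => /negPf ->. Qed.

Lemma EallX0 y : (E ^+ y) set0 = 1.
Proof.
rewrite EallX /epoly (bigD1 set0) //= big_set0 cards0 sfun1 eqxx scale1r hornerD hornerXn expr0.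
rewrite horner_sum big1 ?addr0 // => R /set0Pn[r rR].
rewrite hornerZ (bigD1 r) //= sfunM big1 ?mul0r // => Y.
by rewrite subset0 => /eqP ->; rewrite tau_support ?mul0r // inE.
Qed.

Definition hval (y : nat) (d : {ffun V -> 'I_q}) (X : {set V}) : rat :=
  if X == set0 then 1 else y%:R * (y%:R + (wset k2 X d)%:R) ^+ #|X|.-1.

(** Induction on [#|X|]: the term [B] of [Eall_powM] involves the smaller set [X :\: B], the empty
    [B] contributing 0. The induction hypothesis is used at the exponent [wset k2 B d], so each
    stage must pass from multiples of [q] to all [y]. *)
Lemma Eall_formula (X : {set V}) y :
  (q ^ n)%N%:R * (E ^+ y) X = \sum_(d : {ffun V -> 'I_q}) hval y d X.
Proof.
have [k] := ubnP #|X|; elim: k X y => // k IH X y; rewrite ltnS => Xk.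
have [->|X0] := eqVneq X set0.
  rewrite EallX0 mulr1 (eq_bigr (fun=> 1)) => [|d _]; last by rewrite /hval eqxx.
  by rewrite sumr_const card_ffun !card_ord.
have qn0 : (q ^ n)%N%:R != 0 :> rat by rewrite pnatr_eq0 expn_eq0.
have mult N : (q ^ n)%N%:R * (E ^+ (q * N)) X = \sum_(d : {ffun V -> 'I_q}) hval (q * N) d X.
  transitivity (\sum_(d : {ffun V -> 'I_q}) \sum_(B : {set V} | B \subset X)
      (q * N)%N%:R ^+ #|B| * hval (wset k2 B d) d (X :\: B)); last first.
    apply: eq_bigr => d _; rewrite /hval (negPf X0).
    rewrite -(abel_sum (fun v => k2 + d v)%N (q * N)%N%:R X0); apply: eq_bigr => B BX.
    by case: eqP.
  rewrite exchange_big /= (Eall_powM tauE) mulr_sumr; apply: eq_bigr => B BX.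
  rewrite -mulr_sumr.
  have [->|B0] := eqVneq B set0.
    rewrite cards0 expr0 expn0 mulr1n mul1r setD0 sfun1 (negPf X0) mulr0 big1 // => d _.
    by rewrite /hval (negPf X0) /wset big_set0 mul0r.
  have Bn : (#|B| <= n)%N by rewrite -[leqRHS](card_ord n) max_card.
  have -> : (q ^ n)%N%:R * ((Hs k1 k2 tau ^+ #|B|) (X :\: B) *+ N ^ #|B|)
    = (q * N)%N%:R ^+ #|B| * \sum_(d : {ffun V -> 'I_q}) (E ^+ wset k2 B d) (X :\: B).
    have qE : (q ^ n = q ^ (n - #|B|) * q ^ #|B|)%N by rewrite -expnD subnK.
    rewrite -sfun_sum -Hs_pow sfunMn qE -natrX expnMn.
    move: (q ^ (n - #|B|))%N (q ^ #|B|)%N (N ^ #|B|)%N ((Hs k1 k2 tau ^+ #|B|) (X :\: B)).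
    move=> c1 c2 c3 F; rewrite -[F *+ c3]mulr_natr -[F *+ c1]mulr_natr !natrM.
    by move: c1%:R c2%:R c3%:R => x1 x2 x3; ring.
  congr (_ * _); apply: (mulfI qn0); rewrite mulr_sumr.
  have lt : (#|X :\: B| < k)%N.
    apply: leq_trans Xk; apply: proper_card; apply/properP; split; first exact: subsetDl.
    by have /set0Pn[v vB] := B0; exists v; rewrite ?(subsetP BX) // inE vB.
  under eq_bigr => d _ do rewrite IH //.
  (* The function expanding [Hs] matters only on [B], the one from the induction only outside [B]:
     they merge into one. *)
  rewrite (sum_ffun_indep (B := B) (F := fun d d' => hval (wset k2 B d) d' (X :\: B))).
  - by rewrite !card_ord.
  - move=> d1 d2 d' e; congr hval; apply: eq_bigr => v vB; by rewrite e.
  - move=> d d1 d2 e; rewrite /hval; case: eqP => // _; congr (_ * (_ + _%:R) ^+ _).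
    by apply: eq_bigr => v; rewrite inE => /andP[vB _]; rewrite e // inE.
suff : (q ^ n)%N%:R *: epoly X =
   \sum_(d : {ffun V -> 'I_q}) 'X * ('X + (wset k2 X d)%:R%:P) ^+ #|X|.-1.
  move=> /(congr1 (fun p => p.[y%:R])); rewrite hornerZ -EallX => ->.
  rewrite horner_sum; apply: eq_bigr => d _.
  by rewrite !hornerE /hval (negPf X0).
apply: (@poly_eq_infinite _ _ 0 q 0) => // t _.
rewrite addn0 hornerZ -EallX mulnC mult horner_sum; apply: eq_bigr => d _.
by rewrite !hornerE /hval (negPf X0).
Qed.
End Lagrange.

(** * Forests as parent functions *)

Lemma big_option (R : Type) (idx : R) (op : Monoid.com_law idx) (T : finType)
    (F : option T -> R) :
  \big[op/idx]_(p : option T) F p = op (F None) (\big[op/idx]_x F (Some x)).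
Proof.
rewrite (bigD1 None) //=; congr (op _ _).
rewrite (reindex_omap (Some : T -> option T) id) /=; last by case.
by apply: eq_bigl => x; rewrite eqxx.
Qed.

Section ParentFunctions.
Variables (n k1 k2 : nat).
Local Notation V := 'I_n.
Local Notation C := 'I_(k1 + k2).
Local Notation pf := {ffun V -> option (V * C)}.
Implicit Types (f g : pf) (v w u r : V) (X R D : {set V}).

(** The condition of [non_increasing] at the single vertex [v]. Forests are parent functions, [None]
    at the roots, so that each vertex is a child at most once by construction. *)
Definition okat f v : bool :=
  [forall c : C, [&& (c < k1)%N, [exists w, f w == Some (v, c)]
      & [forall w, forall c' : C, (f w == Some (v, c')) ==> (c <= c')%N]]
    ==> [exists w, (f w == Some (v, c)) && (w < v)%N]].

Lemma okat_ext f g v :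
  (forall w c, (f w == Some (v, c)) = (g w == Some (v, c))) -> okat f v = okat g v.
Proof.
move=> e; apply: eq_forallb => c; congr (_ ==> _).
  congr [&& _, _ & _]; first by apply: eq_existsb => w; rewrite e.
  by apply: eq_forallb => w; apply: eq_forallb => c'; rewrite e.
by apply: eq_existsb => w; rewrite e.
Qed.

(* okat is an alternating sum, over these options, of conditions that are
   products over the children: inl: no colour below k1; inr (inl c): all colours
   are at least c; inr (inr c): moreover the children of colour c exceed v. *)
Definition opt : finType := (unit + ('I_k1 + 'I_k1))%type.
Definition sgn (o : opt) : int := if o is inr (inr _) then -1 else 1.
Definition allow (o : opt) v w (c' : C) : bool :=
  match o with
  | inl _ => (k1 <= c')%N
  | inr (inl c) => (c <= c')%N
  | inr (inr c) => (c < c')%N || ((c' == c :> nat) && (v < w)%N)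
  end.
Definition allowp o v w (p : option (V * C)) : bool :=
  if p is Some (u, c') then (u == v) ==> allow o v w c' else true.

Lemma big_opt (R : Type) (idx : R) (op : Monoid.com_law idx) (F : opt -> R) :
  \big[op/idx]_o F o = op (F (inl tt)) (op (\big[op/idx]_c F (inr (inl c)))
     (\big[op/idx]_c F (inr (inr c)))).
Proof.
rewrite big_sumType big_sumType /=; congr (op _ _).
by rewrite (big_pred1 tt) //; case.
Qed.

(** Let [c0] be the least colour used, if below [k1]. For [c < c0] both conditions of [c] hold and
    cancel, for [c > c0] both fail, and [c0] leaves 1 minus the indicator that its children all
    exceed [v]. Since [v] is not its own child, not exceeding [v] means being smaller. *)
Lemma okat_expand f v : (forall c, f v != Some (v, c)) ->
  (okat f v : nat)%:Z = \sum_o sgn o * ([forall w, allowp o v w (f w)] : nat)%:Z.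
Proof.
move=> nl; rewrite big_opt /= mul1r.
under eq_bigr => c _ do rewrite mul1r.
under [X in _ + (_ + X)]eq_bigr => c _ do rewrite mulN1r.
rewrite -big_split /=.
have alP o : reflect (forall w c, f w = Some (v, c) -> allow o v w c)
    [forall w, allowp o v w (f w)].
  apply: (iffP forallP) => h w.
    by move=> c fw; have := h w; rewrite fw /= eqxx.
  rewrite /allowp; case fw: (f w) => [[u c]|] //; apply/implyP => /eqP uv.
  by apply: h; rewrite fw uv.
have [/existsP[w0 /existsP[c1 /andP[fw0 c1k]]]|no] :=
    boolP [exists w, exists c : C, (f w == Some (v, c)) && (c < k1)%N]; last first.
  have hi w c : f w = Some (v, c) -> (k1 <= c)%N.
    move=> fw; rewrite leqNgt; apply: contra no => ck.
    by apply/existsP; exists w; apply/existsP; exists c; rewrite fw eqxx.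
  have -> : [forall w, allowp (inl tt) v w (f w)] by apply/alP => w c /hi.
  rewrite big1 ?addr0 => [|c _].
    have -> // : okat f v.
    apply/forallP => c; apply/implyP => /and3P[ck /existsP[w /eqP/hi]].
    by rewrite leqNgt ck.
  have -> : [forall w, allowp (inr (inl c)) v w (f w)].
    by apply/alP => w c' /hi /=; apply: leq_trans; apply: ltnW.
  have -> : [forall w, allowp (inr (inr c)) v w (f w)].
    by apply/alP => w c' /hi /= h; rewrite (leq_trans (ltn_ord c) h).
  by rewrite subrr.
pose used (c : C) := [exists w, f w == Some (v, c)].
have uc1 : used c1 by apply/existsP; exists w0.
case: (arg_minnP (P := used) (fun c : C => c : nat) uc1) => c0 /existsP[w1 /eqP fw1] c0min.
have c0k : (c0 < k1)%N by apply: leq_ltn_trans c1k; apply: c0min.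
have mn w c : f w = Some (v, c) -> (c0 <= c)%N.
  by move=> fw; apply: c0min; apply/existsP; exists w; rewrite fw.
have -> : [forall w, allowp (inl tt) v w (f w)] = false.
  by apply/negbTE/negP => /alP/(_ w1 c0 fw1) /=; rewrite leqNgt c0k.
rewrite add0r (bigD1 (Ordinal c0k)) //= big1 ?addr0 => [|c cne].
  have -> : [forall w, allowp (inr (inl (Ordinal c0k))) v w (f w)].
    by apply/alP => w c /mn.
  case: (boolP (okat f v)) => ok.
    have -> // : [forall w, allowp (inr (inr (Ordinal c0k))) v w (f w)] = false.
    apply/negbTE/negP => /alP al.
    move/forallP/(_ c0)/implyP: ok => h.
    have : [exists w, (f w == Some (v, c0)) && (w < v)%N].
      apply: h; rewrite c0k /=; apply/andP; split; first by apply/existsP; exists w1; rewrite fw1.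
      by apply/forallP => w; apply/forallP => c; apply/implyP => /eqP/mn.
    case/existsP => w /andP[/eqP /al /=]; rewrite ltnn eqxx /=; lia.
  have -> // : [forall w, allowp (inr (inr (Ordinal c0k))) v w (f w)].
  apply/alP => w c fw /=; have := mn _ _ fw; rewrite leq_eqVlt => /orP[/eqP ce|->//].
  rewrite ce eqxx ltnn /= ltnNge leq_eqVlt; apply/negP => /orP[/eqP wv|wv].
    by have := nl c; rewrite -{1}(val_inj wv) fw eqxx.
  case/negP: ok; apply/forallP => c2; apply/implyP => /and3P[_ /existsP[w2 /eqP fw2] /forallP m2].
  have c2E : c2 = c0.
    apply: val_inj; apply/eqP; rewrite eqn_leq (mn _ _ fw2) andbT.
    by have /forallP/(_ c0) := m2 w1; rewrite fw1 eqxx.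
  apply/existsP; exists w; rewrite wv andbT fw c2E.
  by rewrite (val_inj ce : c0 = c).
have [lt|ge] := ltnP c c0.
  have -> : [forall w, allowp (inr (inl c)) v w (f w)].
    by apply/alP => w c' /mn /= h; apply: ltnW; apply: leq_trans h.
  have -> : [forall w, allowp (inr (inr c)) v w (f w)].
    by apply/alP => w c' /mn /= h; rewrite (leq_trans lt h).
  by rewrite subrr.
have gt : (c0 < c)%N by rewrite ltn_neqAle ge andbT eq_sym.
have -> : [forall w, allowp (inr (inl c)) v w (f w)] = false.
  by apply/negbTE/negP => /alP/(_ w1 c0 fw1) /=; rewrite leqNgt gt.
have -> // : [forall w, allowp (inr (inr c)) v w (f w)] = false.
apply/negbTE/negP => /alP/(_ w1 c0 fw1) /=; lia.
Qed.

Definition exits f D v : bool := if f v is Some (u, _) then u \notin D else true.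

(** Absence of cycles without paths: no non-empty set consists of non-roots whose parents lie in it.
    This form passes easily to a forest stripped of its roots. *)
Definition acyc f : bool :=
  [forall D : {set V}, (D != set0) ==> [exists v in D, exits f D v]].

Lemma acycP f : reflect (forall D, D != set0 -> exists2 v, v \in D & exits f D v)
  (acyc f).
Proof.
apply: (iffP forallP) => h D.
  move=> D0; move/implyP: (h D) => /(_ D0)/exists_inP[v vD hv].
  by exists v.
by apply/implyP => D0; apply/exists_inP; have [v vD hv] := h D D0; exists v.
Qed.

Definition FS X R : {set pf} := [set f : pf |
  [&& [forall v, (f v != None) == (v \in X) && (v \notin R)],
      [forall v, if f v is Some (u, _) then u \in X else true],
      [forall v, okat f v] & acyc f]].

Definition GS X R : {set pf} := [set g : pf |
  [&& [forall v, (g v != None) ==> (v \in X) && (v \notin R)],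
      [forall v, if g v is Some (u, _) then u \in R else true]
    & [forall r in R, okat g r]]].

Definition dom g : {set V} := [set v | g v != None].

Definition upper R f : pf :=
  [ffun v => if f v is Some (u, c) then if u \in R then Some (u, c) else None else None].
Definition lower R f : pf :=
  [ffun v => if f v is Some (u, c) then if u \in R then None else Some (u, c) else None].
Definition join g f : pf := [ffun v => if g v is Some p then Some p else f v].

Lemma joinK R f : join (upper R f) (lower R f) = f.
Proof.
apply/ffunP => v; rewrite !ffunE; case: (f v) => [[u c]|] //.
by case: ifP => // _.
Qed.

(** [g] records the edges into the roots; what remains is a forest on [X :\: R] whose roots are the
    children chosen by [g]. The local condition at a root depends on [g] alone, elsewhere on the
    rest alone. *)
Lemma FS_peel X R : R \subset X ->
  #|FS X R| = (\sum_(g in GS X R) #|FS (X :\: R) (dom g)|)%N.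
Proof.
move=> RX; rewrite -sum1_card (partition_big (upper R) (mem (GS X R))) /=; last first.
  move=> f; rewrite !inE => /and4P[/forallP h1 /forallP h2 /forallP h3 _].
  apply/and3P; split.
  - apply/forallP => v; apply/implyP; rewrite ffunE -(eqP (h1 v)).
    by case: (f v).
  - by apply/forallP => v; rewrite ffunE; case: (f v) => [[u c]|] //; case: ifP.
  - apply/forall_inP => r rR; rewrite (okat_ext (g := f)) // => w c.
    rewrite ffunE; case: (f w) => [[u c']|] //; case: ifP => // uR.
    by apply/esym/negbTE; apply: contraFneq uR => -[-> _].
apply: eq_bigr => g; rewrite inE => /and3P[/forallP g1 /forallP g2 /forall_inP g3].
rewrite -sum1_card (reindex_onto (join g) (lower R)) /=; last first.
  by move=> f /andP[_ /eqP <-]; rewrite joinK.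
apply: eq_bigl => f.
have gR v u c : g v = Some (u, c) -> [/\ u \in R, v \in X & v \notin R].
  by move=> e; have := g2 v; have := g1 v; rewrite e /= => /andP[].
apply/andP/idP => [[/andP[]]|].
  rewrite !inE => /and4P[/forallP h1 /forallP h2 /forallP h3 /acycP h4] /eqP ue /eqP le.
  have fE v : f v = if join g f v is Some (u, c) then if u \in R then None else Some (u, c) else None.
    by rewrite -{1}le ffunE.
  apply/and4P; split.
  - apply/forallP => v; rewrite inE; have := h1 v; have := fE v; rewrite !inE ffunE.
    case gv: (g v) => [[u c]|].
      by have [-> -> /negPf ->] := gR _ _ _ gv => ->; rewrite eqxx.
    case: (f v) => [[u c]|]; last by rewrite eqxx /= andbT andbC.
    by rewrite eqxx /= andbT andbC.
  - apply/forallP => v; have := h2 v; have := fE v; rewrite ffunE.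
    case gv: (g v) => [[u c]|]; first by have [-> _ _] := gR _ _ _ gv => ->.
    by case: (f v) => [[u c]|] //; rewrite !inE; case: ifP.
  - apply/forallP => v; have [vR|vR] := boolP (v \in R).
      apply/forallP => c; apply/implyP => /and3P[_ /existsP[w /eqP fw] _].
      have := fE w; rewrite fw ffunE; case gw: (g w) => [[u c']|]; last by rewrite fw vR.
      by have [-> _ _] := gR _ _ _ gw.
    rewrite -(okat_ext (f := join g f)) // => w c; rewrite ffunE.
    case gw: (g w) => [[u c']|] //.
    have [uR _ _] := gR _ _ _ gw; have := fE w; rewrite ffunE gw uR => ->.
    by apply/negbTE; apply: contraNneq vR => -[<- _].
  - apply/acycP => D D0; have [v vD hv] := h4 _ D0; exists v => //.
    by rewrite /exits fE; move: hv; rewrite /exits; case: (join g f v) => [[u c]|] //; case: ifP.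
rewrite !inE => /and4P[/forallP h1 /forallP h2 /forallP h3 /acycP h4].
have gf v p : g v = Some p -> f v = None.
  move=> gv; have := h1 v; rewrite !inE gv /= andbF => /eqP/negbT.
  by rewrite negbK => /eqP.
have fu v u c : f v = Some (u, c) -> [/\ u \in X, u \notin R, v \in X & v \notin R].
  move=> e; have := h2 v; rewrite e inE => /andP[-> ->].
  by have := h1 v; rewrite e !inE /= eq_sym => /eqP/andP[/andP[-> ->]].
have le : lower R (join g f) = f.
  apply/ffunP => v; rewrite !ffunE; case gv: (g v) => [[u c]|].
    by have [-> _ _] := gR _ _ _ gv; rewrite (gf _ _ gv).
  case fv: (f v) => [[u c]|] //; by have [_ /negPf -> _ _] := fu _ _ _ fv.
have ue : upper R (join g f) = g.
  apply/ffunP => v; rewrite !ffunE; case gv: (g v) => [[u c]|].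
    by have [-> _ _] := gR _ _ _ gv.
  case fv: (f v) => [[u c]|] //; by have [_ /negPf -> _ _] := fu _ _ _ fv.
split; last by rewrite le.
rewrite ue eqxx andbT; apply/and4P; split.
- apply/forallP => v; rewrite ffunE; case gv: (g v) => [[u c]|].
    by have [_ -> ->] := gR _ _ _ gv.
  by have := h1 v; rewrite !inE gv /= andbT andbC.
- apply/forallP => v; rewrite ffunE; case gv: (g v) => [[u c]|].
    by have [uR _ _] := gR _ _ _ gv; apply: (subsetP RX).
  by case fv: (f v) => [[u c]|] //; have [-> _ _ _] := fu _ _ _ fv.
- apply/forallP => v; have [vR|vR] := boolP (v \in R).
    rewrite (okat_ext (g := g)) ?g3 // => w c; rewrite ffunE.
    case gw: (g w) => [[u c']|] //; apply/negbTE/eqP => /fu[_]; rewrite vR //.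
  rewrite (okat_ext (g := f)) // => w c; rewrite ffunE.
  case gw: (g w) => [[u c']|] //; rewrite (gf _ _ gw).
  apply/negbTE/eqP => -[uv _]; have [] := gR _ _ _ gw.
  by rewrite uv (negPf vR).
- apply/acycP => D D0; have [/set0Pn[v]|] := boolP (D :&: R != set0).
    rewrite inE => /andP[vD vR]; exists v => //; rewrite /exits ffunE.
    case gv: (g v) => [[u c]|]; first by have [_ _] := gR _ _ _ gv; rewrite vR.
    by case fv: (f v) => [[u c]|] //; have [_ _ _] := fu _ _ _ fv; rewrite vR.
  rewrite negbK => /eqP DR; have [v vD hv] := h4 _ D0; exists v => //; rewrite /exits ffunE.
  case gv: (g v) => [[u c]|] //; have [uR _ _] := gR _ _ _ gv.
  by apply/negP => uD; have := in_set0 u; rewrite -DR inE uD uR.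
Qed.
End ParentFunctions.

Lemma prod_natr_forall (R : comNzRingType) (T : finType) (P b : pred T) :
  \prod_(s | P s) ((b s : nat)%:R : R) = ([forall (s | P s), b s] : nat)%:R.
Proof.
have [/forall_inP h|] := boolP [forall (s | P s), b s].
  by rewrite big1 // => s /h ->.
rewrite negb_forall_in => /exists_inP[s Ps /negPf bs].
by rewrite (bigD1 s) //= bs mul0r.
Qed.

Lemma sum_ord_geq m c0 : (c0 <= m)%N -> (\sum_(c < m) (c0 <= c) = m - c0)%N.
Proof.
move=> cm; have : (\sum_(c < m) (c0 <= c) + \sum_(c < m) (c < c0) = m)%N.
  rewrite -big_split /= (eq_bigr (fun=> 1%N)) => [|c _]; last by case: leqP.
  by rewrite sum_nat_const card_ord muln1.
by rewrite sum_ord_ltn // => e; apply/eqP; rewrite -(eqn_add2r c0) e subnK.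
Qed.

(** * The tree series counts forests *)

Section Expansion.
Variables (n k1 k2 : nat).
Local Notation V := 'I_n.
Local Notation C := 'I_(k1 + k2).
Local Notation pf := {ffun V -> option (V * C)}.
Local Notation A := (sfun V).
Variable tau : V -> A.
Hypothesis tauE : forall v, tau v = svar v * Wroot k1 k2 tau v.
Local Notation opt := (opt k1).

Definition nallow (o : opt) (r s : V) : nat := (\sum_(c : C) allow o r s c)%N.

(** Regroups powers of [E] by child: the exponent of [1 + tau s] is the number of colours open to
    [s] below [r]. *)
Lemma Wroot_opt r : Wroot k1 k2 tau r =
  \sum_(o : opt) (sgn o)%:~R * \prod_s (1 + tau s) ^+ nallow o r s.
Proof.
rewrite big_opt /= mul1r /Wroot; congr (_ + _).
  rewrite /Eall -prodrXl; apply: eq_bigr => s _; congr (_ ^+ _).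
  by rewrite /nallow /= sum_ord_geq ?leq_addr // addKn.
rewrite -big_split /=; apply: eq_bigr => c _; rewrite mul1r mulN1r; congr (_ - _).
  rewrite /Eall -prodrXl; apply: eq_bigr => s _; congr (_ ^+ _).
  by rewrite /nallow /= sum_ord_geq //; have := ltn_ord c; lia.
rewrite /Eall /Egt -prodrXl [X in _ * X]big_mkcond -big_split /=; apply: eq_bigr => s _.
have -> : nallow (inr (inr c)) r s = (k1 + k2 - c.+1 + (r < s))%N.
  rewrite /nallow /=.
  have cK : (c < k1 + k2)%N by have := ltn_ord c; lia.
  transitivity (\sum_(c' < k1 + k2) (c < c') + \sum_(c' < k1 + k2) (c' == Ordinal cK) * (r < s))%N.
    rewrite -big_split /=; apply: eq_bigr => c' _; rewrite -val_eqE /=; lia.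
  rewrite sum_ord_geq //; congr (_ + _)%N; rewrite (bigD1 (Ordinal cK)) //= eqxx mul1n.
  by rewrite big1 ?addn0 // => c' /negPf ->.
by rewrite exprD; case: (r < s)%N.
Qed.

Definition tterm (R : {set V}) (s : V) (p : option (V * C)) : A :=
  if p is Some (u, _) then if u \in R then tau s else 0 else 1.

(** As [tau s] squares to zero, [s] is picked at most once in the whole product over [R], so it gets
    at most one parent: the product expands over parent functions. *)
Lemma prod_Wroot (R : {set V}) : \prod_(r in R) Wroot k1 k2 tau r =
  \sum_(g : pf) (\prod_s tterm R s (g s)) * \prod_(r in R)
     \sum_(o : opt) (sgn o)%:~R * ([forall s, allowp o r s (g s)] : nat)%:R.
Proof.
under eq_bigr => r _ do rewrite Wroot_opt.
rewrite (big_distr_big (inl tt)) /=.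
under [RHS]eq_bigr => g _ do rewrite (big_distr_big (inl tt)) /= mulr_sumr.
rewrite exchange_big /=; apply: eq_bigr => oo _.
rewrite big_split /=.
under [RHS]eq_bigr => g _ do rewrite big_split /= mulrCA.
rewrite -mulr_sumr; congr (_ * _).
under [RHS]eq_bigr => g _.
  under [X in _ * X]eq_bigr => r _.
    rewrite (_ : [forall s, _] = [forall (s | predT s), allowp (oo r) r s (g s)]) //.
    rewrite -prod_natr_forall; over.
  rewrite exchange_big /= -big_split /=; over.
rewrite -(bigA_distr_bigA (fun s p => tterm R s p * \prod_(r in R) ((allowp (oo r) r s p : nat)%:R : A))).
rewrite exchange_big /=; apply: eq_bigr => s _.
rewrite prodrXr expr_1D_nilp; last exact: (tau2 tauE).
rewrite big_option; congr (_ + _); first by rewrite /= [X in _ * X]big1 ?mulr1.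
pose F u c : A := tterm R s (Some (u, c)) *
   \prod_(r in R) ((allowp (oo r) r s (Some (u, c)) : nat)%:R : A).
transitivity (\sum_u \sum_c F u c); last by rewrite pair_bigA; apply: eq_bigr => -[u c] _.
rewrite big_mkcond /= -sumrMnr /=; apply: eq_bigr => u _.
rewrite /F /=; case: ifP => uR; last by rewrite big1 // => c _; rewrite mul0r.
rewrite /nallow -sumrMnr; apply: eq_bigr => c _.
rewrite (bigD1 u) //= eqxx /= big1 ?mulr1 ?mulr_natr //.
by move=> r /andP[_ /negPf ru]; rewrite eq_sym ru.
Qed.

(** The variables of the roots kill every [g] that gives a root a parent, [tterm] kills parents
    outside [R], and the sum over options is [okat] by [okat_expand]. *)
Lemma svar_prod_Wroot (R : {set V}) :
  \prod_(r in R) tau r = (\prod_(r in R) svar r) *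
    \sum_(g in GS k1 k2 setT R) \prod_(s in dom g) tau s.
Proof.
under eq_bigr => r _ do rewrite tauE.
rewrite big_split /= prod_Wroot !mulr_sumr [RHS]big_mkcond /=; apply: eq_bigr => g _.
have kill s0 F : s0 \in R -> (\prod_(r in R) svar r) * (tau s0 * F) = 0.
  move=> sR; rewrite (bigD1 s0) //= mulrACA (svar_tau tauE) mul0r //.
have [|bad] := boolP [forall v, if g v is Some (u, _) then u \in R else true]; last first.
  rewrite ifF; last by rewrite inE (negPf bad) /= andbF.
  move: bad; rewrite negb_forall => /existsP[v]; case gv: (g v) => [[u c]|] // /negPf uR.
  by rewrite [X in _ * (X * _)](bigD1 v) //= gv /= uR mul0r mul0r mulr0.
move=> /forallP rg.
have [|bad] := boolP [forall v, (g v != None) ==> (v \notin R)]; last first.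
  rewrite ifF; last first.
    rewrite inE; apply/negbTE; rewrite negb_and; apply/orP; left.
    apply: contra bad => /forallP h; apply/forallP => v; apply/implyP => gv.
    by have := h v; rewrite gv inE.
  move: bad; rewrite negb_forall => /existsP[v]; rewrite negb_imply negbK => /andP[gv vR].
  rewrite [X in _ * (X * _)](bigD1 v) //=; case gvE: (g v) gv => [[u c]|] // _.
  have := rg v; rewrite gvE /= => ->.
  by rewrite -[tau v * _ * _]mulrA kill.
move=> /forallP dm.
have tE : \prod_s tterm R s (g s) = \prod_(s in dom g) tau s.
  rewrite [RHS]big_mkcond /=; apply: eq_bigr => s _; rewrite inE.
  by have := rg s; case: (g s) => [[u c]|] //= ->.
have oE : \prod_(r in R) \sum_(o : opt) (sgn o)%:~R * (([forall s, allowp o r s (g s)] : nat)%:R : A)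
    = ([forall r in R, okat g r] : nat)%:R.
  rewrite -prod_natr_forall; apply: eq_bigr => r rR.
  have gr : g r = None by apply/eqP; have := dm r; rewrite rR implybF negbK.
  have := okat_expand (f := g) (v := r).
  rewrite gr => /(_ (fun=> isT)) /(congr1 (fun z : int => z%:~R : A)) /=.
  rewrite -pmulrn => ->; rewrite rmorph_sum /=; apply: eq_bigr => o _.
  by rewrite rmorphM /= -pmulrn.
rewrite tE oE inE.
have -> : [forall v, (g v != None) ==> (v \in [set: V]) && (v \notin R)].
  by apply/forallP => v; rewrite inE; apply: dm.
have -> /= : [forall v, if g v is Some (u, _) then u \in R else true] by apply/forallP.
by case: [forall r in R, okat g r]; rewrite ?mulr1 ?mulr0.
Qed.

Lemma prod_tau_support (S Y : {set V}) : ~~ (S \subset Y) -> (\prod_(s in S) tau s) Y = 0.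
Proof.
case/subsetPn => s sS sY; rewrite (bigD1 s) //= tauE -mulrA svarM (negPf sY) //.
Qed.

(** [svar_prod_Wroot] for series and [FS_peel] for forests are the same recursion, and [X] shrinks
    when [R] is non-empty; without roots only the empty forest is acyclic. *)
Lemma prod_tau_card (X R : {set V}) : R \subset X ->
  (\prod_(r in R) tau r) X = #|FS k1 k2 X R|%:R.
Proof.
have [k] := ubnP #|X|; elim: k X R => // k IH X R; rewrite ltnS => Xk RX.
have [->|R0] := eqVneq R set0.
  rewrite big_set0 sfun1; have [->|X0] := eqVneq X set0.
    suff -> : FS k1 k2 (set0 : {set V}) set0 = [set [ffun=> None]] by rewrite cards1.
    apply/setP => f; rewrite !inE; apply/and4P/eqP => [[/forallP h _ _ _]|->].
      apply/ffunP => v; rewrite ffunE; have := h v; rewrite !inE /= => /eqP/negbT.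
      by rewrite negbK => /eqP.
    split.
    - by apply/forallP => v; rewrite ffunE !inE.
    - by apply/forallP => v; rewrite ffunE.
    - apply/forallP => v; apply/forallP => c; apply/implyP => /and3P[_ /existsP[w]].
      by rewrite ffunE.
    - apply/acycP => D /set0Pn[v vD]; exists v => //; by rewrite /exits ffunE.
  suff -> : FS k1 k2 X set0 = set0 by rewrite cards0.
  apply/setP => f; rewrite !inE; apply/negbTE/negP => /and4P[/forallP h1 /forallP h2 _ /acycP/(_ _ X0)[v vX]].
  have := h1 v; have := h2 v; rewrite /exits vX !inE /=.
  by case: (f v) => [[u c]|] // ->.
rewrite svar_prod_Wroot svar_prod RX sfun_sum FS_peel // natr_sum.
rewrite big_mkcond [RHS]big_mkcond /=; apply: eq_bigr => g _.
have lt : (#|X :\: R| < k)%N.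
  apply: leq_trans Xk; apply: proper_card; apply/properP; split; first exact: subsetDl.
  by have /set0Pn[v vR] := R0; exists v; rewrite ?(subsetP RX) // inE vR.
have [gX|gX] := boolP (g \in GS k1 k2 X R).
  have := gX; rewrite !inE => /and3P[/forallP g1 g2 g3].
  rewrite g2 g3 andbT /=.
  have -> : [forall v, (g v != None) ==> (v \in [set: V]) && (v \notin R)].
    by apply/forallP => v; apply/implyP => gv; have := g1 v; rewrite gv inE => /andP[].
  apply: IH => //; apply/subsetP => v; rewrite !inE => gv.
  by have := g1 v; rewrite gv => /andP[-> ->].
case: ifP => // gT; apply: prod_tau_support; apply: contra gX => /subsetP sub.
move: gT; rewrite !inE => /and3P[/forallP g1 -> ->]; rewrite !andbT.
by apply/forallP => v; apply/implyP => gv; have := sub v; rewrite !inE gv => /(_ isT); rewrite andbC.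
Qed.

Lemma forest_poly (y : rat) : (0 < n)%N ->
  \sum_(R : {set V}) #|FS k1 k2 setT R|%:R * y ^+ #|R| =
  (k1.+1 ^ n)%N%:R^-1 * \sum_(d : {ffun V -> 'I_k1.+1}) y * (y + (\sum_v (k2 + d v))%N%:R) ^+ n.-1.
Proof.
move=> n0.
have T0 : [set: V] != set0 by apply/set0Pn; exists (Ordinal n0); rewrite inE.
have E : (k1.+1 ^ n)%N%:R *: epoly tau setT =
   \sum_(d : {ffun V -> 'I_k1.+1}) 'X * ('X + (\sum_v (k2 + d v))%N%:R%:P) ^+ n.-1.
  apply: (@poly_eq_infinite _ _ 0 1 0) => // t _.
  rewrite muln1 addn0 hornerZ -(EallX tauE) (Eall_formula tauE) horner_sum.
  apply: eq_bigr => d _; rewrite !hornerE /hval (negPf T0) cardsT card_ord.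
  by congr (_ * (_ + _%:R) ^+ _); apply: eq_bigl => v; rewrite inE.
have q0 : (k1.+1 ^ n)%N%:R != 0 :> rat by rewrite pnatr_eq0 expn_eq0.
transitivity (epoly tau setT).[y].
  rewrite /epoly horner_sum; apply: eq_bigr => R _.
  by rewrite hornerZ hornerXn prod_tau_card ?subsetT.
apply: (mulfI q0); rewrite mulrA mulfV // mul1r -hornerZ E horner_sum.
by apply: eq_bigr => d _; rewrite !hornerE.
Qed.
End Expansion.

(** * Coloured rooted trees *)

Section RootedTrees.
Variables (n k1 k2 : nat).
Local Notation V := 'I_n.+1.
Local Notation C := 'I_(k1 + k2).
Local Notation pf := {ffun V -> option (V * C)}.
Local Notation vmax := (ord_max : V).
Hypothesis k1_gt0 : (0 < k1)%N.
Implicit Types (f : pf) (v w u : V) (D S : {set V}).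

Lemma K_gt0 : (0 < k1 + k2)%N.
Proof. by rewrite addn_gt0 k1_gt0. Qed.
Definition col0 : C := Ordinal K_gt0.

Definition up f : rel V := fun v u => if f v is Some (u', _) then u' == u else false.

Definition roots f : {set V} := [set v | f v == None].

Lemma connect_up_step f v w : connect (up f) v w -> v != w ->
  exists u c, f v = Some (u, c) /\ connect (up f) u w.
Proof.
move=> /connectP[[|u p] /=]; first by move=> _ ->; rewrite eqxx.
rewrite {1}/up => /andP[+ pp] lw _; case fv: (f v) => [[u' c]|] // /eqP uu.
by exists u, c; rewrite uu; split => //; apply/connectP; exists p.
Qed.

Lemma acyc_no_cycle f w u c : acyc f -> f w = Some (u, c) -> ~~ connect (up f) u w.
Proof.
move=> /acycP ac fw; apply/negP => uw.
pose D := [set v | connect (up f) u v && connect (up f) v w].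
have D0 : D != set0 by apply/set0Pn; exists u; rewrite inE connect0.
have [v] := ac _ D0; rewrite inE => /andP[uv vw]; rewrite /exits.
have [vE|/(connect_up_step vw)[u' [c' [fv u'w]]]] := eqVneq v w.
  by rewrite vE fw inE connect0 uw.
rewrite fv inE u'w andbT; case/negP; apply: connect_trans uv _.
by apply: connect1; rewrite /up fv.
Qed.

Lemma no_cycle_acyc f : (forall w u c, f w = Some (u, c) -> ~~ connect (up f) u w) -> acyc f.
Proof.
move=> nc; apply/acycP => D /set0Pn[v0 v0D].
pose anc v := [set u | connect (up f) v u].
case: (arg_minnP (P := fun v => v \in D) (fun v => #|anc v|) v0D) => v vD mv.
exists v => //; rewrite /exits; case fv: (f v) => [[u c]|] //; apply/negP => uD.
have := mv _ uD; rewrite leqNgt => /negP; apply; apply: proper_card.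
apply/properP; split; last first.
  by exists v; rewrite inE ?connect0 //; apply: nc fv.
apply/subsetP => x; rewrite !inE; apply: connect_trans; apply: connect1.
by rewrite /up fv.
Qed.

Lemma acyc_neq f w u c : acyc f -> f w = Some (u, c) -> w != u.
Proof.
by move=> ac fw; have := acyc_no_cycle ac fw; apply: contraNneq => ->.
Qed.

(** Root of the tree containing the last vertex, the one tree that [glue] leaves in place. *)
Definition rootmax f : V := odflt vmax [pick v | (f v == None) && connect (up f) vmax v].

Lemma rootmaxP f : acyc f -> f (rootmax f) = None /\ connect (up f) vmax (rootmax f).
Proof.
move=> /acycP ac; rewrite /rootmax; case: pickP => [v /andP[/eqP]//|no].
pose D := [set v | connect (up f) vmax v].
have D0 : D != set0 by apply/set0Pn; exists vmax; rewrite inE connect0.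
have [v] := ac _ D0; rewrite inE => mv; rewrite /exits.
case fv: (f v) => [[u c]|]; last by have := no v; rewrite fv mv.
rewrite inE; case/negP; apply: connect_trans mv _.
by apply: connect1; rewrite /up fv.
Qed.

Definition cut f S : pf := [ffun w => if w \in S then None else f w].
Definition glue f : pf :=
  [ffun w => if (f w == None) && (w != rootmax f) then Some (vmax, col0) else f w].
Definition chmax f : {set V} := [set w | f w == Some (vmax, col0)].
Definition detached f : {set V} := roots f :\ rootmax f.

Definition forests : {set pf} := [set f : pf | [forall v, okat f v] && acyc f].
Definition trees : {set pf} := [set f in forests | #|roots f| == 1%N].

(** All children of the largest label are smaller, so edges at it may be added or cut freely; this
    singles out the vertex [n] of the theorem. *)
Lemma okat_max f : acyc f -> okat f vmax.
Proof.
move=> ac; apply/forallP => c; apply/implyP => /and3P[_ /existsP[w /eqP fw] _].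
apply/existsP; exists w; rewrite fw eqxx /=.
have := acyc_neq ac fw; rewrite -val_eqE /=; have := ltn_ord w; lia.
Qed.

Lemma leave_set f x y D : connect (up f) x y -> x \in D -> y \notin D ->
  exists u u' c, [/\ u \in D, f u = Some (u', c) & u' \notin D].
Proof.
move=> /connectP[p + ->]; elim: p x => [|z p IH] x /=; first by move=> _ ->.
rewrite {1}/up => /andP[]; case fx: (f x) => [[z' c]|] // /eqP <- pp xD yD.
have [zD|zD] := boolP (z' \in D); first exact: (IH z').
by exists x, z', c.
Qed.

Lemma okat_other f f' v : (forall w, f w = f' w \/
    ((f w = None \/ f w = Some (vmax, col0)) /\ (f' w = None \/ f' w = Some (vmax, col0)))) ->
  v != vmax -> okat f v = okat f' v.
Proof.
move=> h vm; apply: okat_ext => w c.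
have nm : (Some (vmax, col0) == Some (v, c)) = false.
  by apply/negbTE; apply: contraNneq vm => -[-> _].
by case: (h w) => [->//|[[]-> []->]]; rewrite ?nm.
Qed.

Lemma glue_tree f : f \in forests -> glue f \in trees.
Proof.
rewrite !inE => /andP[/forallP ok ac].
have [r1 r2] := rootmaxP ac.
have acg : acyc (glue f).
  apply/acycP => D D0; have /acycP/(_ _ D0)[v vD ev] := ac.
  have rg : glue f (rootmax f) = None by rewrite ffunE eqxx andbF r1.
  (* If [D] contains [vmax], the exit found for [f] may be a root now hung below [vmax]; another is
     found at [rootmax f] or on the path leading to it. *)
  have [mD|mD] := boolP (vmax \in D); last first.
    exists v => //; move: ev; rewrite /exits ffunE; case: ifP => // _ _; exact: mD.
  have [rD|rD] := boolP (rootmax f \in D).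
    by exists (rootmax f) => //; rewrite /exits rg.
  have [u [u' [c [uD fu u'D]]]] := leave_set r2 mD rD.
  by exists u => //; rewrite /exits ffunE fu.
apply/andP; split; first (apply/andP; split => //).
  apply/forallP => v; have [->|vm] := eqVneq v vmax; first exact: okat_max.
  rewrite (okat_other (f' := f)) // => w; rewrite ffunE.
  case: ifP => [/andP[/eqP -> _]|_]; last by left.
  by right; split; [right|left].
rewrite (_ : roots (glue f) = [set rootmax f]) ?cards1 //.
apply/setP => w; rewrite !inE ffunE; have [->|wr] /= := eqVneq w (rootmax f).
  by rewrite andbF r1.
by rewrite andbT; case: ifP => // ->.
Qed.

Lemma cut_glue f : acyc f -> cut (glue f) (detached f) = f.
Proof.
move=> /rootmaxP[r1 _]; apply/ffunP => w; rewrite !ffunE !inE.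
by case: (eqVneq w (rootmax f)) => [->|wr] /=; case: eqP => //=; rewrite ?r1.
Qed.

Lemma cut_forest f S : f \in trees -> S \subset chmax f -> cut f S \in forests.
Proof.
rewrite !inE => /andP[/andP[/forallP ok ac] _] /subsetP SC.
have acc : acyc (cut f S).
  apply/acycP => D D0; have /acycP/(_ _ D0)[v vD ev] := ac; exists v => //.
  by move: ev; rewrite /exits ffunE; case: ifP.
rewrite acc andbT; apply/forallP => v.
have [->|vm] := eqVneq v vmax; first exact: okat_max.
rewrite (okat_other (f' := f)) // => w; rewrite ffunE; case: ifP => [wS|_]; last by left.
by right; split; [left|right; have := SC _ wS; rewrite inE => /eqP].
Qed.

Lemma tree_root f : f \in trees -> roots f = [set rootmax f].
Proof.
rewrite !inE => /andP[/andP[_ /rootmaxP[r1 _]] /cards1P[r e]].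
have : rootmax f \in roots f by rewrite inE r1.
by rewrite e => /set1P ->.
Qed.

Lemma rootmax_cut f S : f \in trees -> S \subset chmax f -> rootmax (cut f S) = rootmax f.
Proof.
move=> tf SC; have := cut_forest tf SC; rewrite inE => /andP[_ acc].
have rE := tree_root tf.
have ac : acyc f by move: tf; rewrite !inE => /andP[/andP[]].
have [c1 c2] := rootmaxP acc.
have sub : connect (up f) vmax (rootmax (cut f S)).
  apply: connect_sub c2 => x y; rewrite /up ffunE; case: ifP => // _ h; exact: connect1.
have [rS|rS] := boolP (rootmax (cut f S) \in S).
  have := subsetP SC _ rS; rewrite inE => /eqP fr.
  by have := acyc_no_cycle ac fr; rewrite sub.
move: c1; rewrite ffunE (negPf rS) => c1.
by apply/set1P; rewrite -rE inE c1.
Qed.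

Lemma roots_cut f S : f \in trees -> S \subset chmax f -> roots (cut f S) = rootmax f |: S.
Proof.
move=> tf SC; apply/setP => w; rewrite !inE ffunE; case: ifP => [_|_]; first by rewrite orbT.
by rewrite orbF; have /setP/(_ w) := tree_root tf; rewrite !inE.
Qed.

Lemma root_notin_chmax f : f \in trees -> rootmax f \notin chmax f.
Proof.
move=> tf; rewrite inE; have := set11 (rootmax f).
by rewrite -(tree_root tf) inE => /eqP ->.
Qed.

(** Forests are trees with a set [S] of colour-1 edges at the last vertex cut, which makes
    [#|S| + 1] roots; the sum over [S] is binomial. *)
Lemma sum_forests_trees (y : rat) :
  \sum_(f in forests) y ^+ #|roots f| = y * \sum_(f in trees) (1 + y) ^+ #|chmax f|.
Proof.
rewrite (partition_big glue (mem trees)) /=; last by move=> f; apply: glue_tree.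
rewrite mulr_sumr; apply: eq_bigr => f tf.
rewrite -sum_subset_expr mulr_sumr (reindex_onto (cut f) detached) /=; last first.
  by move=> f' /andP[+ /eqP <-]; rewrite inE => /andP[_ ac]; rewrite cut_glue.
have rn := root_notin_chmax tf.
have tr : f (rootmax f) = None.
  by have := set11 (rootmax f); rewrite -(tree_root tf) inE => /eqP.
apply: eq_big => S.
  apply/andP/idP => [[/andP[fS /eqP gf] /eqP dS]|SC].
    apply/subsetP => w; rewrite -dS !inE => /andP[wr wN].
    by rewrite -gf ffunE wr wN.
  have fS := cut_forest tf SC; rewrite fS /=.
  have rC := rootmax_cut tf SC.
  have rS : rootmax f \notin S by apply: contra rn => /(subsetP SC).
  split; last by rewrite /detached rC roots_cut // setU1K.
  apply/eqP/ffunP => w; rewrite ffunE rC ffunE; case: ifP => [/andP[]|].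
    case: ifP => [wS _ _|_ /eqP fw wr].
      by have := subsetP SC _ wS; rewrite inE => /eqP ->.
    have : w \in roots f by rewrite inE fw.
    by rewrite (tree_root tf) inE (negPf wr).
  case: ifP => // wS /=.
  by move/negbT; rewrite negbK => /eqP wr; rewrite -wr wS in rS.
move=> /andP[/andP[fS /eqP gf] /eqP dS].
have SC : S \subset chmax f.
  apply/subsetP => w; rewrite -dS !inE => /andP[wr wN].
  by rewrite -gf ffunE wr wN.
have rS : rootmax f \notin S by apply: contra rn => /(subsetP SC).
by rewrite roots_cut // cardsU1 rS exprS.
Qed.

Lemma sum_FS_forests (y : rat) :
  \sum_(R : {set V}) #|FS k1 k2 setT R|%:R * y ^+ #|R| = \sum_(f in forests) y ^+ #|roots f|.
Proof.
rewrite [RHS](partition_big roots predT) //=; apply: eq_bigr => R _.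
rewrite (eq_bigr (fun=> y ^+ #|R|)); last by move=> f /andP[_ /eqP ->].
rewrite sumr_const mulr_natl; congr (_ *+ _); apply: eq_card => f.
rewrite inE; apply/and4P/andP => [[/forallP h1 _ h3 h4]|[]].
  split; first by rewrite inE h3 h4.
  apply/eqP/setP => v; rewrite inE; have := h1 v; rewrite inE /= => /eqP h.
  by rewrite -[in RHS](negbK (v \in R)) -h negbK.
rewrite inE => /andP[h3 h4] /eqP rR.
split => //; last by apply/forallP => v; case: (f v) => [[u c]|]; rewrite ?inE.
by apply/forallP => v; rewrite -rR !inE.
Qed.

Definition edges_of f : {set ctedge n.+1 (k1 + k2)} :=
  [set t | f t.1.2 == Some (t.1.1, t.2)].

Lemma edges_of_inj : injective edges_of.
Proof.
move=> f f' /setP e; apply/ffunP => w.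
case fw: (f w) => [[u c]|].
  by have := e (u, w, c); rewrite !inE /= fw eqxx => /esym/eqP.
case fw': (f' w) => [[u c]|] //.
by have := e (u, w, c); rewrite !inE /= fw fw' eqxx.
Qed.

Lemma parent_edges_of f u w : parent (edges_of f) u w = up f w u.
Proof.
apply/existsP/idP => [[c]|]; first by rewrite inE /= /up => /eqP ->.
by rewrite /up; case fw: (f w) => [[u' c]|] // /eqP <-; exists c; rewrite inE /= fw.
Qed.

Lemma connect_edges_of f u w : connect (parent (edges_of f)) u w = connect (up f) w u.
Proof.
transitivity (connect [rel x y | up f y x] u w); last exact: (connect_rev (up f) u w).
by apply: eq_connect => x y; apply: parent_edges_of.
Qed.

Lemma card_edges_of f : (#|edges_of f| + #|roots f| = n.+1)%N.
Proof.
rewrite -[RHS](card_ord n.+1) -[RHS](cardsC (roots f)) addnC; congr (_ + _)%N.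
rewrite -(@card_in_imset _ _ (fun t : ctedge n.+1 (k1 + k2) => t.1.2)).
  apply: eq_card => w; apply/imsetP/idP => [[[[u w'] c]]|].
    by rewrite !inE /= => /eqP fw ->; rewrite fw.
  rewrite !inE; case fw: (f w) => [[u c]|] // _.
  by exists (u, w, c); rewrite // inE /= fw.
move=> [[u w] c] [[u' w'] c']; rewrite !inE /= => /eqP fw /eqP fw' ww.
by move: fw; rewrite ww fw' => -[-> ->].
Qed.

Lemma edges_of_tree f :
  (colored_rooted_tree (edges_of f) /\ non_increasing k1 (edges_of f)) <-> f \in trees.
Proof.
split.
  move=> [[c1 c2 c3 c4] ni]; rewrite !inE.
  have r1 : #|roots f| = 1%N by have := card_edges_of f; rewrite c1 /=; lia.
  rewrite r1 eqxx andbT; apply/andP; split; last first.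
    apply: no_cycle_acyc => w u c fw; rewrite -connect_edges_of; apply: c4.
    by rewrite parent_edges_of /up fw.
  apply/forallP => v; apply/forallP => c; apply/implyP => /and3P[ck /existsP[w /eqP fw] /forallP m].
  have [|w' [w'e w'v]] := ni v c _ ck.
    split; first by exists w; rewrite inE /= fw.
    move=> w2 c2'; rewrite inE /= => h.
    by have /forallP/(_ c2')/implyP := m w2; apply.
  by apply/existsP; exists w'; rewrite w'v andbT; move: w'e; rewrite inE.
rewrite !inE => /andP[/andP[/forallP ok ac] /eqP r1]; split.
  split.
  - by have := card_edges_of f; rewrite r1 /=; lia.
  - move=> [[u w] c]; rewrite inE /= => /eqP fw.
    by rewrite eq_sym; apply: acyc_neq ac fw.
  - move=> w; case fw: (f w) => [[u c]|].
      rewrite (_ : [set t in edges_of f | t.1.2 == w] = [set (u, w, c)]) ?cards1 //.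
      apply/setP => -[[u' w'] c']; rewrite !inE /=.
      apply/andP/eqP => [[/eqP h /eqP ww]|[-> -> ->]]; last by rewrite fw !eqxx.
      by move: h; rewrite ww fw => -[-> ->].
    rewrite (_ : [set t in edges_of f | t.1.2 == w] = set0) ?cards0 //.
    apply/setP => -[[u' w'] c']; rewrite !inE /=.
    by apply/negbTE/negP => /andP[/eqP h /eqP ww]; move: h; rewrite ww fw.
  - move=> u w; rewrite parent_edges_of connect_edges_of /up.
    by case fw: (f w) => [[u' c]|] // /eqP <-; apply: acyc_no_cycle ac fw.
move=> v c [[w]]; rewrite inE /= => fw m ck.
have /existsP[w' /andP[h1 h2]] : [exists w, (f w == Some (v, c)) && (w < v)%N].
  move/forallP/(_ c)/implyP: (ok v); apply.
  rewrite ck /=; apply/andP; split; first by apply/existsP; exists w.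
  apply/forallP => w'; apply/forallP => c'; apply/implyP => h.
  by apply: (m w'); rewrite inE.
by exists w'; rewrite inE.
Qed.

Lemma tree_edges_of T : colored_rooted_tree T -> exists f, T = edges_of f.
Proof.
move=> [_ _ c3 _].
pose f : pf := [ffun w => if [pick t in T | t.1.2 == w] is Some t then Some (t.1.1, t.2) else None].
exists f; apply/setP => -[[u w] c]; rewrite inE ffunE /=.
case: pickP => [[[u' w'] c'] /= /andP[tT /eqP ww]|no].
  apply/idP/eqP => [uT|[<- <-]]; last by rewrite -ww.
  have := c3 w; rewrite leqNgt => le.
  case: (eqVneq (u, w, c) (u', w', c')) => [[-> _ ->]//|ne].
  case/negP: le; rewrite (cardsD1 (u, w, c)) inE uT eqxx /= add1n ltnS card_gt0.
  by apply/set0Pn; exists (u', w', c'); rewrite !inE eq_sym ne tT ww /=.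
by have := no (u, w, c); rewrite /= eqxx andbT => ->.
Qed.

Lemma n_edges_edges_of f : n_edges_color1 (edges_of f) = #|chmax f|.
Proof.
rewrite /n_edges_color1 -(@card_in_imset _ _ (fun t : ctedge n.+1 (k1 + k2) => t.1.2)).
  apply: eq_card => w; apply/imsetP/idP => [[[[u w'] c]]|].
    rewrite !inE /= => /andP[/eqP fw /andP[/eqP um /eqP c0]] ->; rewrite fw.
    by apply/eqP; congr (Some (_, _)); apply: val_inj.
  rewrite !inE => /eqP fw; exists (vmax, w, col0) => //.
  by rewrite !inE /= fw !eqxx.
move=> [[u w] c] [[u' w'] c']; rewrite !inE /= => /andP[/eqP fw _] /andP[/eqP fw' _] ww.
by move: fw; rewrite ww fw' => -[-> ->].
Qed.

Definition tree_poly : {poly rat} := \sum_(f in trees) 'X^#|chmax f|.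

Lemma coef_tree_poly alpha : tree_poly`_alpha = (tree_count n.+1 k1 k2 alpha)%:R.
Proof.
rewrite /tree_poly coef_sum /tree_count.
under eq_bigr => f _ do rewrite coefXn.
rewrite -natr_sum; congr (_%:R).
transitivity #|[set f in trees | #|chmax f| == alpha]|.
  rewrite -sum1_card big_mkcond [RHS]big_mkcond /=; apply: eq_bigr => f _.
  by rewrite [in RHS]inE; case: (f \in trees) => //=; rewrite eq_sym; case: eqP.
rewrite -(@card_in_imset _ _ edges_of); last by move=> f f' _ _; apply: edges_of_inj.
apply: eq_card => T; rewrite [in RHS]inE; apply/imsetP/asboolP => [[f]|[cT nT eT]].
  rewrite inE => /andP[/edges_of_tree[h1 h2] /eqP h3] ->.
  by split => //; rewrite n_edges_edges_of.
have [f TE] := tree_edges_of cT; exists f => //.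
rewrite inE -n_edges_edges_of -TE eT eqxx andbT.
by apply/edges_of_tree; rewrite -TE.
Qed.

Lemma tree_polyE : tree_poly =
  k1.+1%:R ^- n.+1 *: \sum_(d : {ffun V -> 'I_k1.+1}) ('X + ((\sum_v (k2 + d v))%N%:R - 1)%:P) ^+ n.
Proof.
have [tau tauE] := tau_exists n.+1 k1 k2.
(* For [t] at least 2 the value [y = t - 1] is nonzero, so the factor [y] common to both sides can
   be cancelled. *)
apply: (@poly_eq_infinite _ _ 2 1 0) => // t t2; rewrite muln1 addn0.
pose y : rat := t%:R - 1.
have y0 : y != 0 by rewrite /y subr_eq0 (eqr_nat rat t 1); lia.
have := forest_poly tauE y (ltn0Sn n).
rewrite sum_FS_forests sum_forests_trees -mulr_sumr mulrCA => /(mulfI y0).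
have -> : 1 + y = t%:R by rewrite addrC subrK.
rewrite /tree_poly horner_sum.
under [X in X = _ -> _]eq_bigr => f _ do rewrite -hornerXn.
move=> ->; rewrite hornerZ natrX horner_sum; congr (_ * _); apply: eq_bigr => d _.
by rewrite !hornerE /=; congr (_ ^+ _); rewrite /y; ring.
Qed.
End RootedTrees.

(** * Cells of the real arrangement *)

Section StrongConnectivity.
Variable T : finType.
Implicit Types (D : rel T) (u v x y : T).

Definition addarc D u v : rel T := fun x y => D x y || ((x == u) && (y == v)).
Definition strong D := [forall x, forall y, connect D x y].

Lemma strongP D : reflect (forall x y, connect D x y) (strong D).
Proof.
apply: (iffP forallP) => h x; first by move=> y; have /forallP := h x.
by apply/forallP.
Qed.

Lemma strong_sub D D' : (forall x y, D x y -> connect D' x y) -> strong D -> strong D'.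
Proof.
by move=> h /strongP s; apply/strongP => x y; apply: connect_sub (s x y).
Qed.

Lemma connect_addarcl D u v x y : connect D x y -> connect (addarc D u v) x y.
Proof. by apply: connect_sub => {}x {}y h; apply: connect1; rewrite /addarc h. Qed.

Lemma connect_addarc D u v x y : connect (addarc D u v) x y ->
  connect D x y || (connect D x u && connect D v y).
Proof.
move=> /connectP[p + ->]; elim/last_ind: p => [|p z IH]; first by rewrite connect0.
rewrite rcons_path last_rcons => /andP[/IH h]; rewrite /addarc.
move: (last x p) h => w h /orP[wz|/andP[/eqP wu /eqP zv]].
  case/orP: h => [h|/andP[-> h]]; apply/orP; [left|right]; apply: connect_trans h _;
  exact: connect1.
rewrite zv connect0 andbT; apply/orP; right.
by move: h; rewrite wu => /orP[|/andP[]].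
Qed.

Lemma strong_addarc_connect D u v : connect D u v -> strong (addarc D u v) = strong D.
Proof.
move=> uv; apply/idP/idP; apply: strong_sub => x y; last first.
  by move=> xy; apply: connect1; rewrite /addarc xy.
by case/orP => [/connect1//|/andP[/eqP-> /eqP->]].
Qed.

Lemma strong_addarc_rev D u v : strong (addarc D u v) -> connect D v u.
Proof.
by move=> /strongP/(_ v u)/connect_addarc/orP[//|/andP[]].
Qed.

Lemma strong_count D u v :
  (forall Y : {set T}, (forall x y, D x y -> (x \in Y) = (y \in Y)) -> u \in Y -> v \in Y) ->
  (strong (addarc D u v) + strong (addarc D v u) =
   strong D + strong (addarc (addarc D u v) v u))%N.
Proof.
move=> weak; set D2 := addarc (addarc D u v) v u.
have sub1 : strong (addarc D u v) -> strong D2.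
  by apply: strong_sub => x y xy; apply: connect1; rewrite /D2 /addarc in xy *; rewrite xy.
have sub2 : strong (addarc D v u) -> strong D2.
  apply: strong_sub => x y xy; apply: connect1; move: xy; rewrite /D2 /addarc.
  by case/orP => ->; rewrite ?orbT.
have sub0 u' v' : strong D -> strong (addarc D u' v').
  by apply: strong_sub => x y xy; apply: connect1; rewrite /addarc xy.
have [sD|nD] := boolP (strong D).
  by rewrite !sub0 // sub1 ?sub0.
have [s2|n2] := boolP (strong D2); last first.
  by rewrite (negPf (contra sub1 n2)) (negPf (contra sub2 n2)).
have nboth : ~~ (strong (addarc D u v) && strong (addarc D v u)).
  apply: contra nD => /andP[s1 s1']; have uv := strong_addarc_rev s1'.
  by rewrite -(strong_addarc_connect uv).
suff : strong (addarc D u v) || strong (addarc D v u).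
  by move: nboth; case: strong; case: strong.
have [uv|nuv] := boolP (connect D u v).
  apply/orP; right; apply: strong_sub s2 => x y; rewrite /D2 /addarc.
  case/orP => [/orP[xy|/andP[/eqP-> /eqP->]]|vu]; last by apply: connect1; rewrite vu orbT.
    by apply: connect1; rewrite xy.
  exact: connect_addarcl.
have [vu|nvu] := boolP (connect D v u).
  apply/orP; left; apply: strong_sub s2 => x y; rewrite /D2 {1}/addarc.
  case/orP => [/connect1//|/andP[/eqP-> /eqP->]].
  exact: connect_addarcl.
exfalso; move/negP: (nuv); apply.
suff : v \in [set w | connect D u w] by rewrite inE.
apply: weak; last by rewrite inE connect0.
move=> x y xy; rewrite !inE; apply/idP/idP => h; first exact: connect_trans h (connect1 xy).
move/strongP: s2 => s2.
have : connect (addarc D u v) u x by case/orP: (connect_addarc (s2 u x)) => [//|/andP[]].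
case/connect_addarc/orP => [//|/andP[_ vx]].
have : connect D y u || connect D y v.
  case/orP: (connect_addarc (s2 y u)) => [/connect_addarc|/andP[/connect_addarc + _]].
    by case/orP => [->//|/andP[->]].
  by case/orP => [->|/andP[->]]; rewrite ?orbT.
case/orP => h'.
  by case/negP: nvu; apply: connect_trans vx _; apply: connect_trans (connect1 xy) h'.
by case/negP: nuv; apply: connect_trans h h'.
Qed.
End StrongConnectivity.

Section Cells.
Variables (n : nat) (a b : int).
Local Notation G := (gedge n a b).
Local Notation K := (Kedges n a b).
Local Notation R := Rdefinitions.R.
Implicit Types (Z E P S : {set G}) (x : 'I_n -> R) (e h : G).

Definition hv x e : R := x (ghead e) - x (gtail e) - igain R e.

Definition cell Z E P x : bool := sat (@igain n a b R) Z x &&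
  [forall e in E, if e \in P then 0 < hv x e else hv x e < 0].

Lemma cellP Z E P x : reflect ((forall e, e \in Z -> hv x e = 0) /\
   (forall e, e \in E -> if e \in P then 0 < hv x e else hv x e < 0)) (cell Z E P x).
Proof.
apply: (iffP andP) => -[h1 h2]; split.
- by move=> e eZ; move/satP: h1 => /(_ e eZ) h; rewrite /hv h subrr.
- by move=> e eE; move/forall_inP: h2 => /(_ e eE).
- by apply/satP => e /h1/eqP; rewrite subr_eq0 => /eqP.
- by apply/forall_inP.
Qed.

Definition feas Z E P : bool := `[< exists x, cell Z E P x >].
Definition feas0 S : bool := `[< exists x : 'I_n -> R, sat (@igain n a b R) S x >].

(** An arc from [u] to [v] means that raising [x u] may force raising [x v]. A vertex set closed
    under arcs can be raised by any amount within the cell ([cell_bump]), which is why strong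
    connectivity encodes boundedness up to translation. *)
Definition dig Z E P : rel 'I_n := fun u v => adj Z u v || [exists e in E,
  if e \in P then (gtail e == u) && (ghead e == v) else (gtail e == v) && (ghead e == u)].

Definition bcell Z E P : bool := feas Z E P && strong (dig Z E P).
Definition bcount Z E : nat := #|[set P : {set G} | (P \subset E) && bcell Z E P]|.
Definition fsum Z E : int := \sum_(S : {set G} | S \subset E) (-1) ^+ #|S| * (feas0 (Z :|: S) : nat)%:Z.

Lemma sum_subset_setU1 (V : zmodType) (F : {set G} -> V) E h : h \notin E ->
  \sum_(S : {set G} | S \subset h |: E) F S =
  \sum_(S : {set G} | S \subset E) (F S + F (h |: S)).
Proof.
move=> hE; rewrite big_split /= (bigID (fun S : {set G} => h \notin S)) /=; congr (_ + _).
  apply: eq_bigl => S; apply/andP/idP => [[sS hS]|sS].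
    apply/subsetP => e eS; have := subsetP sS _ eS; rewrite !inE => /orP[/eqP eh|//].
    by rewrite -eh eS in hS.
  by split; [apply: subset_trans (subsetUr _ _)|apply: contra hE => /(subsetP sS)].
rewrite (reindex_onto (fun S => h |: S) (fun S => S :\ h)) /=; last first.
  by move=> S /andP[_]; rewrite negbK => /setD1K.
apply: eq_bigl => S; rewrite setU11 /= andbT.
apply/andP/idP => [[sS /eqP SE]|sS].
  have hS : h \notin S by rewrite -SE setD11.
  apply/subsetP => e eS; have : e \in h |: E by apply: (subsetP sS); rewrite inE eS orbT.
  by rewrite !inE => /orP[/eqP eh|//]; rewrite -eh eS in hS.
have hS : h \notin S by apply: contra hE => /(subsetP sS).
by rewrite setU1K // eqxx; split => //; apply: setUS.
Qed.

Lemma fsum_setU1 Z E h : h \notin E -> fsum Z (h |: E) = fsum Z E - fsum (h |: Z) E.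
Proof.
move=> hE; rewrite /fsum sum_subset_setU1 // big_split /=; congr (_ + _).
rewrite -sumrN; apply: eq_bigr => S sS.
have hS : h \notin S by apply: contra hE => /(subsetP sS).
by rewrite cardsU1 hS exprS mulN1r mulNr setUCA setUA.
Qed.

Lemma bcount_setU1 Z E h : h \notin E ->
  (bcount Z (h |: E))%:Z = \sum_(P : {set G} | P \subset E)
    ((bcell Z (h |: E) P : nat)%:Z + (bcell Z (h |: E) (h |: P) : nat)%:Z).
Proof.
move=> hE; rewrite /bcount card_sumz.
rewrite -(sum_subset_setU1 (fun P => (bcell Z (h |: E) P : nat)%:Z)) //.
by rewrite [RHS]big_mkcond /=; apply: eq_bigr => P _; rewrite inE; case: (_ \subset _).
Qed.

Lemma bcountE Z E : (bcount Z E)%:Z = \sum_(P : {set G} | P \subset E) (bcell Z E P : nat)%:Z.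
Proof.
rewrite /bcount card_sumz [RHS]big_mkcond /=; apply: eq_bigr => P _.
by rewrite inE; case: (_ \subset _).
Qed.

Section AddHyperplane.
Variables (Z E P : {set G}) (h : G).
Hypothesis hE : h \notin E.
Hypothesis PE : P \subset E.
Local Notation u := (gtail h).
Local Notation v := (ghead h).
Let hP : h \notin P. Proof. by apply: contra hE => /(subsetP PE). Qed.

Lemma dig_add : dig Z (h |: E) (h |: P) =2 addarc (dig Z E P) u v.
Proof.
move=> x y; rewrite /dig /addarc -orbA; congr (_ || _); apply/existsP/orP.
  case=> e; rewrite !inE => /andP[/orP[/eqP->|eE]].
    by rewrite eqxx /= => /andP[/eqP-> /eqP->]; right; rewrite !eqxx.
  have -> : (e == h) = false by apply/negbTE; apply: contraNneq hE => <-.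
  by move=> he; left; apply/existsP; exists e; rewrite eE.
case=> [/existsP[e /andP[eE he]]|/andP[/eqP-> /eqP->]]; last first.
  by exists h; rewrite !inE eqxx /= !eqxx.
exists e; rewrite !inE eE orbT /=.
by have -> : (e == h) = false by apply/negbTE; apply: contraNneq hE => <-.
Qed.

Lemma dig_sub : dig Z (h |: E) P =2 addarc (dig Z E P) v u.
Proof.
move=> x y; rewrite /dig /addarc -orbA; congr (_ || _); apply/existsP/orP.
  case=> e; rewrite !inE => /andP[/orP[/eqP->|eE]].
    by rewrite (negPf hP) => /andP[/eqP-> /eqP->]; right; rewrite !eqxx.
  by move=> he; left; apply/existsP; exists e; rewrite eE.
case=> [/existsP[e /andP[eE he]]|/andP[/eqP-> /eqP->]]; last first.
  by exists h; rewrite !inE eqxx /= (negPf hP) !eqxx.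
by exists e; rewrite !inE eE orbT /=.
Qed.

Lemma dig_eq : dig (h |: Z) E P =2 addarc (addarc (dig Z E P) u v) v u.
Proof.
move=> x y; rewrite /dig /addarc; set ex := [exists e in E, _].
have -> : adj (h |: Z) x y = adj Z x y || joins h x y.
  apply/existsP/orP => [[e /andP[]]|].
    rewrite !inE => /orP[/eqP->|eZ] je; [by right|left].
    by apply/existsP; exists e; rewrite eZ.
  case=> [/existsP[e /andP[eZ je]]|jh].
    by exists e; rewrite !inE eZ orbT.
  by exists h; rewrite !inE eqxx.
rewrite /joins ![x == _]eq_sym ![y == _]eq_sym [(v == x) && _]andbC.
by case: (adj Z x y) ex => [] []; rewrite //= ?orbT ?orbF.
Qed.

Lemma strong_eq (D D' : rel 'I_n) : D =2 D' -> strong D = strong D'.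
Proof.
move=> e; apply: eq_forallb => x; apply: eq_forallb => y; exact: eq_connect.
Qed.

Lemma cell_plus x : cell Z (h |: E) (h |: P) x = (0 < hv x h) && cell Z E P x.
Proof.
apply/cellP/andP => [[c1 c2]|[hh /cellP[c1 c2]]]; split => //.
- by have := c2 h; rewrite !inE eqxx; apply.
- apply/cellP; split => // e eE; have := c2 e; rewrite !inE eE orbT.
  have -> : (e == h) = false by apply/negbTE; apply: contraNneq hE => <-.
  by apply.
- move=> e; rewrite !inE => /orP[/eqP->|eE]; first by rewrite eqxx.
  have -> /= : (e == h) = false by apply/negbTE; apply: contraNneq hE => <-.
  exact: c2.
Qed.

Lemma cell_minus x : cell Z (h |: E) P x = (hv x h < 0) && cell Z E P x.
Proof.
apply/cellP/andP => [[c1 c2]|[hh /cellP[c1 c2]]]; split => //.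
- by have := c2 h; rewrite !inE eqxx (negPf hP); apply.
- by apply/cellP; split => // e eE; apply: c2; rewrite !inE eE orbT.
- move=> e; rewrite !inE => /orP[/eqP->|eE]; first by rewrite (negPf hP).
  exact: c2.
Qed.

Lemma cell_zero x : cell (h |: Z) E P x = (hv x h == 0) && cell Z E P x.
Proof.
by rewrite /cell sat_setU1 -andbA /hv subr_eq0.
Qed.

Lemma hv_convex x y (s t : R) e : s + t = 1 ->
  hv (fun w => s * x w + t * y w) e = s * hv x e + t * hv y e.
Proof.
move=> st; rewrite /hv -[X in _ - X = _]mul1r -st; ring.
Qed.

Lemma feas_between : feas Z (h |: E) (h |: P) -> feas Z (h |: E) P -> feas (h |: Z) E P.
Proof.
move=> /asboolP[x] + /asboolP[y]; rewrite cell_plus cell_minus => /andP[xp /cellP[x1 x2]].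
move=> /andP[ym /cellP[y1 y2]].
pose d := hv x h - hv y h; have d0 : 0 < d by rewrite /d; lra.
(* Weights of the point where the segment from [x] to [y] meets the hyperplane of [h]. *)
pose s := - hv y h / d; pose t := hv x h / d.
have st : s + t = 1 by rewrite /s /t -mulrDl addrC divff // gt_eqF.
have s0 : 0 < s by rewrite divr_gt0 // oppr_gt0.
have t0 : 0 < t by rewrite divr_gt0.
apply/asboolP; exists (fun w => s * x w + t * y w); rewrite cell_zero; apply/andP; split.
  by rewrite hv_convex // /s /t; apply/eqP; field; rewrite gt_eqF.
apply/cellP; split => e he; rewrite hv_convex //.
  by rewrite x1 // y1 // !mulr0 addr0.
have := x2 _ he; have := y2 _ he; case: ifP => _ hx hy.
  by rewrite addr_gt0 // mulr_gt0.
by rewrite -oppr_gt0 opprD -!mulrN addr_gt0 // mulr_gt0 // oppr_gt0.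
Qed.

Definition bump (Y : pred 'I_n) (t : R) x w : R := x w + (if Y w then t else 0).

Lemma cell_bump x (Y : pred 'I_n) (t : R) : 0 <= t ->
  (forall w w', dig Z E P w w' -> Y w -> Y w') ->
  cell Z E P x -> cell Z E P (bump Y t x).
Proof.
move=> t0 cl /cellP[c1 c2].
have bE e : hv (bump Y t x) e = hv x e + (if Y (ghead e) then t else 0) - (if Y (gtail e) then t else 0).
  by rewrite /hv /bump; ring.
apply/cellP; split => e he; rewrite bE.
  have d1 : dig Z E P (gtail e) (ghead e) by rewrite /dig adj_edge.
  have d2 : dig Z E P (ghead e) (gtail e) by rewrite /dig adj_sym adj_edge.
  have -> : Y (gtail e) = Y (ghead e) by apply/idP/idP; [apply: cl d1|apply: cl d2].
  by rewrite c1 // add0r subrr.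
have := c2 _ he; case: ifP => eP hx.
  have d1 : dig Z E P (gtail e) (ghead e).
    by apply/orP; right; apply/existsP; exists e; rewrite he eP !eqxx.
  have := cl _ _ d1; case: (Y (gtail e)); case: (Y (ghead e)) => i; try (by have := i isT); lra.
have d1 : dig Z E P (ghead e) (gtail e).
  by apply/orP; right; apply/existsP; exists e; rewrite he eP !eqxx.
have := cl _ _ d1; case: (Y (ghead e)); case: (Y (gtail e)) => i; try (by have := i isT); lra.
Qed.

Lemma hv_bump x (Y : pred 'I_n) (t : R) : hv (bump Y t x) h =
  hv x h + (if Y v then t else 0) - (if Y u then t else 0).
Proof. by rewrite /hv /bump; ring. Qed.

(** Otherwise everything reached from [u] could be raised by [hv x h], which brings the point onto
    the hyperplane. So the arc of [h] is redundant for an uncut cell. *)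
Lemma feas_plus_connect : feas Z (h |: E) (h |: P) -> ~~ feas (h |: Z) E P ->
  connect (dig Z E P) u v.
Proof.
move=> /asboolP[x]; rewrite cell_plus => /andP[xp cx] nf; apply/negPn/negP => nc.
case/negP: nf; apply/asboolP.
exists (bump (fun w => connect (dig Z E P) u w) (hv x h) x); rewrite cell_zero; apply/andP; split.
  by rewrite hv_bump connect0 (negPf nc) addr0 subrr.
apply: cell_bump => //; first exact: ltW.
by move=> y z yz /connect_trans; apply; apply: connect1.
Qed.

Lemma feas_minus_connect : feas Z (h |: E) P -> ~~ feas (h |: Z) E P ->
  connect (dig Z E P) v u.
Proof.
move=> /asboolP[x]; rewrite cell_minus => /andP[xp cx] nf; apply/negPn/negP => nc.
case/negP: nf; apply/asboolP.
exists (bump (fun w => connect (dig Z E P) v w) (- hv x h) x); rewrite cell_zero; apply/andP; split.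
  by rewrite hv_bump connect0 (negPf nc) subr0 subrr.
apply: cell_bump => //; first by rewrite oppr_ge0 ltW.
by move=> y z yz /connect_trans; apply; apply: connect1.
Qed.

(** If the hyperplane of [h] cuts the cell, this is [strong_count]; if not, one side at most is
    inhabited and the arc of [h] on that side is already implied. *)
Lemma bcell_add :
  (forall w w', connect (adj (Z :|: E)) w w') ->
  (feas (h |: Z) E P -> feas Z (h |: E) P && feas Z (h |: E) (h |: P)) ->
  (bcell Z (h |: E) P + bcell Z (h |: E) (h |: P) = bcell Z E P + bcell (h |: Z) E P)%N.
Proof.
move=> con both; rewrite /bcell (strong_eq dig_add) (strong_eq dig_sub) (strong_eq dig_eq).
have [f1|nf1] := boolP (feas (h |: Z) E P).
  have /andP[-> ->] := both f1.
  have -> /= : feas Z E P.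
    by move: f1 => /asboolP[x]; rewrite cell_zero => /andP[_ cx]; apply/asboolP; exists x.
  rewrite addnC; apply: strong_count => Y cl uY.
  have /connectP[p + ->] := con u v; elim: p (u) uY => //= z p IH w wY /andP[wz].
  apply: IH; move: wz => /existsP[e /andP[]]; rewrite inE => /orP[eZ|eE] je.
    have ad : dig Z E P w z by apply/orP; left; apply/existsP; exists e; rewrite eZ.
    by rewrite -(cl _ _ ad).
  have [eP|eP] := boolP (e \in P).
    have d1 : dig Z E P (gtail e) (ghead e).
      by apply/orP; right; apply/existsP; exists e; rewrite eE eP !eqxx.
    by move: wY; have := cl _ _ d1; move: je => /orP[]/andP[/eqP-> /eqP->] ->.
  have d1 : dig Z E P (ghead e) (gtail e).
    by apply/orP; right; apply/existsP; exists e; rewrite eE (negPf eP) !eqxx.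
  by move: wY; have := cl _ _ d1; move: je => /orP[]/andP[/eqP-> /eqP->] ->.
rewrite /= addn0.
have [fp|nfp] := boolP (feas Z (h |: E) (h |: P)).
  have -> : feas Z (h |: E) P = false.
    by apply/negbTE; apply: contra nf1; apply: feas_between.
  have -> : feas Z E P.
    by move: fp => /asboolP[x]; rewrite cell_plus => /andP[_ cx]; apply/asboolP; exists x.
  by rewrite (strong_addarc_connect (feas_plus_connect fp nf1)).
have [fm|nfm] := boolP (feas Z (h |: E) P).
  have -> : feas Z E P.
    by move: fm => /asboolP[x]; rewrite cell_minus => /andP[_ cx]; apply/asboolP; exists x.
  by rewrite (strong_addarc_connect (feas_minus_connect fm nf1)) addn0.
suff -> : feas Z E P = false by [].
apply/negbTE/negP => /asboolP[x cx].
have [lt|gt|eq] := ltgtP (hv x h) 0.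
- by case/negP: nfm; apply/asboolP; exists x; rewrite cell_minus lt.
- by case/negP: nfp; apply/asboolP; exists x; rewrite cell_plus gt.
- by case/negP: nf1; apply/asboolP; exists x; rewrite cell_zero eq eqxx.
Qed.

Lemma pos_lower_bound (s : seq G) (F : G -> R) :
  (forall e, e \in s -> 0 < F e) -> exists2 t, 0 < t & forall e, e \in s -> t < F e.
Proof.
elim: s => [|e s IH] hs; first by exists 1.
have [|t t0 ht] := IH; first by move=> f fs; apply: hs; rewrite inE fs orbT.
have Fe : 0 < F e by apply: hs; rewrite mem_head.
exists (Num.min t (F e / 2)); first by rewrite lt_min t0 divr_gt0.
move=> f; rewrite inE gt_min => /orP[/eqP->|/ht ->//]; apply/orP; right; lra.
Qed.

(** The component of the head in [Z] can move alone, so [h] takes both signs while finitely many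
    strict inequalities survive a small move. *)
Lemma feas_perturb : ~~ connect (adj Z) u v -> feas (h |: Z) E P ->
  feas Z (h |: E) P && feas Z (h |: E) (h |: P).
Proof.
move=> nc /asboolP[x]; rewrite cell_zero => /andP[/eqP x0 /cellP[c1 c2]].
have [|t t0 ht] := @pos_lower_bound (enum E) (fun e => `|hv x e|).
  by move=> e; rewrite mem_enum normr_gt0 => /c2; case: ifP => _ hx; [rewrite gt_eqF|rewrite lt_eqF].
have hh s : hv (shift Z v s x) h = s.
  by rewrite /hv shift_nedge // addrAC -/(hv x h) x0 add0r.
have cc s : `|s| <= t -> cell Z E P (shift Z v s x).
  move=> st; apply/cellP; split => e he; first by rewrite /hv shift_edge // -/(hv x e) c1.
  have {}ht := ht e; rewrite mem_enum in ht; have {}ht := ht he.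
  have : exists s', `|s'| <= `|s| /\ hv (shift Z v s x) e = hv x e + s'.
    rewrite /hv /shift; case: ifP => _; case: ifP => _.
    - by exists 0; split; [rewrite normr0|ring].
    - by exists s; split => //; ring.
    - by exists (- s); split; [rewrite normrN|ring].
    - by exists 0; split; [rewrite normr0|ring].
  case=> s' [s's ->]; have := c2 _ he; case: ifP => _ hx.
    rewrite gtr0_norm // in ht.
    have := ler_norm (- s'); rewrite normrN; lra.
  rewrite ltr0_norm // in ht; have := ler_norm s'; lra.
have ct : `|t| <= t by rewrite gtr0_norm.
apply/andP; split; apply/asboolP.
  exists (shift Z v (- t) x); rewrite cell_minus hh oppr_lt0 t0 /=.
  by apply: cc; rewrite normrN.
by exists (shift Z v t x); rewrite cell_plus hh t0 cc.
Qed.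
End AddHyperplane.
End Cells.

(** * Deletion-restriction for bounded cells *)

Section CountBounded.
Variables (n : nat) (a b : int).
Local Notation G := (gedge n a b).
Local Notation K := (Kedges n a b).
Local Notation R := Rdefinitions.R.
Implicit Types (Z E P S : {set G}) (x : 'I_n -> R) (e h : G).
Hypothesis n_gt0 : (0 < n)%N.

Lemma sat_connect_const (S : {set G}) (x y : 'I_n -> R) u v : connect (adj S) u v ->
  sat (@igain n a b R) S x -> sat (@igain n a b R) S y -> x v - x u = y v - y u.
Proof.
move=> /connectP[p + ->] /satP sx /satP sy; elim: p u => [|w p IH] u /=; first by rewrite !subrr.
move=> /andP[/existsP[e /andP[eS je]] pp]; have := IH _ pp.
have e1 := sx _ eS; have e2 := sy _ eS.
by move: je => /orP[]/andP[/eqP tE /eqP hE]; rewrite tE hE in e1 e2; lra.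
Qed.

Lemma feas0_setU1_nconnect S h : ~~ connect (adj S) (gtail h) (ghead h) ->
  feas0 (h |: S) = feas0 S.
Proof.
move=> nc; apply/asboolP/asboolP => -[x]; last by move=> sx; apply: sat_add sx nc.
by rewrite sat_setU1 => /andP[_ sx]; exists x.
Qed.

Lemma connect_setU1_same S h u v : connect (adj S) (gtail h) (ghead h) ->
  connect (adj (h |: S)) u v -> connect (adj S) u v.
Proof.
move=> ch; apply: connect_sub => w w' /existsP[e /andP[]]; rewrite !inE => /orP[/eqP->|eS] je.
  by move: je => /orP[]/andP[/eqP<- /eqP<-] //; rewrite connect_adj_sym.
by apply: connect1; apply/existsP; exists e; rewrite eS.
Qed.

(** Only [h] crosses the cut around the component of its tail, and in one direction. *)
Lemma bridge_not_strong Z E P h : h \notin E ->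
  ~~ connect (adj (Z :|: E)) (gtail h) (ghead h) -> ~~ strong (dig Z (h |: E) P).
Proof.
move=> hE nc; apply/negP => /strongP st.
pose Y := [set w | connect (adj (Z :|: E)) (gtail h) w].
have uY : gtail h \in Y by rewrite inE connect0.
have vY : ghead h \notin Y by rewrite inE.
have adE e w w' : e \in Z :|: E -> joins e w w' -> (w \in Y) = (w' \in Y).
  move=> eS je; rewrite !inE; apply: same_connect_r; first exact: connect_adj_sym.
  by apply: connect1; apply/existsP; exists e; rewrite eS.
have closed (Q : pred 'I_n) w w' : (forall z z', dig Z (h |: E) P z z' -> Q z -> Q z') ->
    connect (dig Z (h |: E) P) w w' -> Q w -> Q w'.
  by move=> cl /connectP[p + ->]; elim: p w => //= z p IH w /andP[/cl wz pp] /wz; apply: IH.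
have arc w w' : dig Z (h |: E) P w w' -> (w \in Y) = (w' \in Y) \/
    (if h \in P then w = gtail h else w' = gtail h).
  case/orP => [/existsP[e /andP[eZ je]]|/existsP[e /andP[]]].
    by left; apply: (adE e) => //; rewrite inE eZ.
  rewrite in_setU1 => /orP[/eqP->|eE].
    by case: ifP => hP /andP[/eqP<- /eqP<-]; right.
  move=> he; left; apply: (adE e); first by rewrite inE eE orbT.
  by move: he; rewrite /joins; case: ifP => _ ->; rewrite ?orbT.
have [hP|hP] := boolP (h \in P).
  have : gtail h \notin Y.
    apply: (closed (fun w => w \notin Y) (ghead h)) => // w w' /arc; rewrite hP.
    by case=> [->//|->]; rewrite uY.
  by rewrite uY.
case/negP: vY; apply: (closed (fun w => w \in Y) (gtail h)) => // w w' /arc.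
by rewrite (negPf hP) => -[<-//|->].
Qed.

(* Deletion-restriction: adding h to E either cuts cells, or is a bridge, or is
   constant on the flat of Z. *)
Lemma bcount_fsum E Z : forest Z -> E \subset K -> (forall e, e \in E -> e \notin Z) ->
  (forall u v, connect (adj (Z :|: E)) u v) ->
  (bcount Z E)%:Z = (-1) ^+ (n.-1 - #|Z|) * fsum Z E.
Proof.
have [k] := ubnP #|E|; elim: k E Z => // k IH E Z; rewrite ltnS => Ek fZ EK dj con.
have [E0|[h hE0]] := set_0Vmem E.
  rewrite E0 setU0 in con *.
  have tZ : spanning_tree Z by [].
  rewrite (spanning_sol_card n_gt0 tZ) subnn expr0 mul1r /fsum bcountE.
  have sub0 (S : {set G}) : (S \subset set0) = (S == set0) by rewrite subset0.
  rewrite !(big_pred1 set0) //= cards0 expr0 mul1r setU0.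
  have [x sx] := forest_sat (@igain n a b R) fZ.
  have -> : feas0 Z by apply/asboolP; exists x.
  have -> // : bcell Z set0 set0.
  apply/andP; split.
    by apply/asboolP; exists x; apply/andP; split => //; apply/forall_inP => e; rewrite inE.
  apply/strongP => u v; apply: connect_sub (con u v) => w w' ad; apply: connect1.
  by rewrite /dig ad.
pose E' := E :\ h; have EE : E = h |: E' by rewrite setD1K.
have hE : h \notin E' by rewrite setD11.
have hK : h \in K by apply: (subsetP EK).
have hZ : h \notin Z by apply: dj.
have E'K : E' \subset K by apply: subset_trans EK; apply: subsetDl.
have E'k : (#|E'| < k)%N by move: Ek; rewrite (cardsD1 h) hE0.
have dj' e : e \in E' -> e \notin Z by rewrite !inE => /andP[_ /dj].
have djh e : e \in E' -> e \notin h |: Z.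
  by move=> eE'; rewrite !inE negb_or dj' // andbT; apply: contraNneq hE => <-.
rewrite EE fsum_setU1 //.
have conU : h |: (Z :|: E') = Z :|: E by rewrite EE setUCA.
(* For a bridge both sides are 0: no cell is strong, and adding [h] does not change feasibility. *)
have [con'|ncon] := pselect (forall u v, connect (adj (Z :|: E')) u v); last first.
  have nc : ~~ connect (adj (Z :|: E')) (gtail h) (ghead h).
    apply/negP => ch; apply: ncon => u v; apply: connect_setU1_same ch _.
    by rewrite conU.
  rewrite bcountE big1 => [|P _]; last first.
    by rewrite /bcell (negPf (bridge_not_strong P hE nc)) andbF.
  suff -> : fsum (h |: Z) E' = fsum Z E' by rewrite subrr mulr0.
  apply: eq_bigr => S sS; rewrite -setUA feas0_setU1_nconnect //.
  by apply: contra nc; apply: connect_adj_sub; apply: setUS.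
have conh u v : connect (adj (h |: Z :|: E')) u v.
  by apply: connect_adj_sub (con' u v); rewrite -setUA; apply: subsetUr.
have split_count :
    (forall P, P \subset E' -> feas (h |: Z) E' P -> feas Z (h |: E') P && feas Z (h |: E') (h |: P)) ->
    (bcount Z (h |: E'))%:Z = (bcount Z E')%:Z + (bcount (h |: Z) E')%:Z.
  move=> both; rewrite bcount_setU1 // !bcountE -big_split /=; apply: eq_bigr => P PE.
  by rewrite -!PoszD (bcell_add hE PE con' (both P PE)).
have [ch|nc] := boolP (connect (adj Z) (gtail h) (ghead h)); last first.
  have fhZ : forest (h |: Z) by apply/forest_setU1.
  rewrite split_count => [|P PE]; last exact: feas_perturb.
  rewrite (IH E' Z) // (IH E' (h |: Z)) //.
  have := forest_card n_gt0 fhZ; rewrite cardsU1 hZ add1n => lt.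
  have -> : (n.-1 - #|Z|)%N = (n.-1 - #|Z|.+1).+1 by rewrite -subSn // subSS.
  by rewrite exprS mulN1r mulrBr !mulNr opprK.
have hvc x y : sat (@igain n a b R) Z x -> sat (@igain n a b R) Z y -> hv x h = hv y h.
  by move=> sx sy; rewrite /hv (sat_connect_const ch sx sy).
(* Here [h] is constant on the flat of [Z]. If the flat lies in the hyperplane, no point is strictly
   off it, and [h] can join any set containing [Z] without changing feasibility: both sides are
   0. *)
have [/asboolP[x0]|nf] := boolP (feas0 (h |: Z)).
  rewrite sat_setU1 => /andP[/eqP x0h sx0].
  have hv0 x : sat (@igain n a b R) Z x -> hv x h = 0.
    by move=> sx; rewrite (hvc _ _ sx sx0) /hv x0h subrr.
  rewrite bcountE big1 => [|P _]; last first.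
    rewrite /bcell (_ : feas _ _ _ = false) //; apply/negbTE/negP => /asboolP[x /andP[sx /forall_inP/(_ h)]].
    by rewrite setU11 (hv0 _ sx) ltxx; case: ifP => _ /(_ isT).
  suff -> : fsum (h |: Z) E' = fsum Z E' by rewrite subrr mulr0.
  apply: eq_bigr => S _; congr (_ * (nat_of_bool _)%:Z).
  apply/asboolP/asboolP => -[x sx]; exists x; apply/satP => e eS; move/satP: sx => sx.
    by apply: sx; rewrite -setUA setU1r.
  move: eS; rewrite -setUA !in_setU1 => /orP[/eqP->|eS]; last exact: sx.
  apply/eqP; rewrite -subr_eq0; apply/eqP/hv0/satP => f fZ'.
  by apply: sx; rewrite inE fZ'.
(* Otherwise the flat misses the hyperplane: the restricted terms vanish and the count is that
   without [h]. *)
have nfS S : h \in S -> Z \subset S -> feas0 S = false.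
  move=> hS ZS; apply/negbTE; apply: contra nf => /asboolP[x /satP sx]; apply/asboolP.
  by exists x; apply/satP => e; rewrite !inE => /orP[/eqP->|/(subsetP ZS)]; apply: sx.
have nfc P : feas (h |: Z) E' P = false.
  apply/negbTE; apply: contra nf => /asboolP[x /andP[sx _]].
  by apply/asboolP; exists x.
rewrite split_count => [|P _]; last by rewrite nfc.
rewrite [bcount (h |: Z) E'](_ : _ = 0%N) ?addr0; last first.
  by apply/eqP; rewrite cards_eq0; apply/eqP/setP => P; rewrite !inE /bcell nfc /= andbF.
rewrite (IH E' Z) //; congr (_ * _).
suff -> : fsum (h |: Z) E' = 0 by rewrite subr0.
apply: big1 => S _; rewrite nfS ?mulr0 //; last by apply: subset_trans (subsetUl _ _); apply: subsetUr.
by rewrite !inE eqxx.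
Qed.

Variable r : G -> nat.
Hypothesis r_inj : {in K &, injective r}.

(** Whitney's cancellation again, with feasibility in place of the number of solutions: NBC sets are
    all feasible, and [nbc_sum_sign] at 1 keeps the bases of activity 0. *)
Lemma bcount_nbc : bcount set0 K = nbc_count r 0.
Proof.
have f0 : forest (set0 : {set G}).
  split; first exact: sub0set.
  move=> C; rewrite subset0 => /eqP -> [vs [es [[sv se _ _] [_ _ CE]]]].
  case: es se sv CE => [<-//|e es _ _] /setP/(_ e).
  by rewrite !inE eqxx.
have conK u v : connect (adj (set0 :|: K)) u v.
  rewrite set0U; have [->//|uv] := eqVneq u v; have [e eK je] := exists_joins a b uv.
  by apply: connect1; apply/existsP; exists e; rewrite eK.
have dj (e : G) : e \in K -> e \notin (set0 : {set G}) by move=> _; rewrite inE.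
have := bcount_fsum f0 (subxx K) dj conK.
rewrite cards0 subn0.
have -> : fsum set0 K = (-1) ^+ n.-1 * (nbc_count r 0)%:Z.
  rewrite /fsum; under eq_bigr => S _ do rewrite set0U.
  rewrite (whitney_nbc n_gt0 r_inj (phi := fun S => (feas0 S : nat)%:Z)); first last.
  - move=> S C CS [vs [es hC]] nb; rewrite (_ : feas0 S = false) //.
    apply/negbTE/negP => /asboolP[x sx]; apply: nb; exists vs, es; split => //.
    by have /eqP := sat_circle hC CS sx; rewrite intr_eq0 => /eqP.
  - move=> S C e _ bC eC sC; congr ((nat_of_bool _)%:Z).
    by apply/asboolP/asboolP => -[x sx]; exists x; move: sx; rewrite (sat_balanced x bC eC sC).
  transitivity (\sum_(S : {set G} | `[< nbc_set r S >]) (-1) ^+ #|S| * 1 ^+ (n.-1 - #|S|) : int).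
    apply: eq_bigr => S /asboolP[fS _]; rewrite expr1n; congr (_ * _).
    have [x sx] := forest_sat (@igain n a b R) fS.
    by have -> : feas0 S by apply/asboolP; exists x.
  rewrite (nbc_sum_sign n_gt0 r_inj) subrr; congr (_ * _).
  rewrite /nbc_count card_sumz big_mkcond /=; apply: eq_bigr => B _; rewrite inE.
  case: asboolP => [nB|nB].
    rewrite expr0n natz; congr (Posz (nat_of_bool _)); apply/eqP/asboolP => [->|[]//].
    by [].
  by case: asboolP => // -[].
by rewrite mulrA -exprMn mulrNN mulr1 expr1n mul1r => -[].
Qed.
End CountBounded.

(** * Regions of the real arrangement as cells *)

Section Regions.
Import numFieldNormedType.Exports.
Local Open Scope classical_set_scope.
Local Open Scope ring_scope.
Variables (n : nat) (a b : int).
Local Notation G := (gedge n a b).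
Local Notation K := (Kedges n a b).
Local Notation R := Rdefinitions.R.
Local Notation W := 'rV[R]_n.
Hypothesis n_gt0 : (0 < n)%N.
Implicit Types (P : {set G}) (e : G).

Definition fn (x : W) : 'I_n -> R := fun v => x ord0 v.

Definition Cell P : set W := fun x => sum0_space x /\ cell finset.set0 K P (fn x).

Definition signs (x : W) : {set G} := finset (fun e : G => (e \in K) && (0 < hv (fn x) e)).

Lemma cell0P P (x : 'I_n -> R) : reflect
  (forall e : G, e \in K -> if e \in P then 0 < hv x e else hv x e < 0) (cell finset.set0 K P x).
Proof.
apply: (iffP (cellP _ _ _ _)) => [[_ h]//|h]; split => // e.
by rewrite finset.inE.
Qed.

Lemma Cell_signs (x : W) : arr_complement a b x -> Cell (signs x) x.
Proof.
move=> [s0 nh]; split => //; apply/cell0P => e eK; rewrite finset.inE eK /=.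
case: ifP => // /negbT; rewrite -leNgt le_eqVlt => /orP[/eqP h|//].
by case: (nh e eK); rewrite /hyperplane /=; move/eqP: h; rewrite subr_eq0 => /eqP.
Qed.

Lemma Cell_sub P : Cell P `<=` @arr_complement n a b.
Proof.
move=> x [s0 /cell0P c]; split => // e eK hx.
have h0 : hv (fn x) e = 0 by rewrite /hv /fn hx subrr.
by have := c e eK; rewrite h0 ltxx; case: ifP.
Qed.

Lemma Cell_unique P P' (x : W) : P \subset K -> P' \subset K -> Cell P x -> Cell P' x -> P = P'.
Proof.
move=> PK P'K [_ /cell0P c] [_ /cell0P c']; apply/setP => e.
have [eK|eK] := boolP (e \in K).
  have := c e eK; have := c' e eK; case: ifP; case: ifP => // _ _ h1 h2.
    by have := lt_trans h1 h2; rewrite ltxx.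
  by have := lt_trans h1 h2; rewrite ltxx.
have out (Q : {set G}) : Q \subset K -> (e \in Q) = false.
  by move=> /fintype.subsetP QK; apply/negbTE; apply: contra eK; apply: QK.
by rewrite !out.
Qed.

Lemma fn_convex (x y : W) (s t : R) : fn (s *: x + t *: y) = (fun w => s * fn x w + t * fn y w).
Proof. by apply/funext => w; rewrite /fn !mxE. Qed.

Lemma Cell_convex P (x y : W) (t : R) : Cell P x -> Cell P y -> 0 <= t <= 1 ->
  Cell P ((1 - t) *: x + t *: y).
Proof.
move=> [sx /cell0P cx] [sy /cell0P cy] /andP[t0 t1]; split.
  rewrite /sum0_space /=; under eq_bigr => i _ do rewrite !mxE.
  by rewrite big_split /= -!mulr_sumr sx sy !mulr0 addr0.
apply/cell0P => e eK; rewrite fn_convex hv_convex; last by rewrite subrK.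
have := cx e eK; have := cy e eK; case: ifP => _ h1 h2; nra.
Qed.

Lemma hv_continuous e : continuous (fun x : W => hv (fn x) e).
Proof.
have h (v : 'I_n) : continuous (fun x : W => fn x v) by apply: coord_continuous.
move=> x; apply: (@continuousB _ R^o _ (fun x : W => fn x (ghead e) - fn x (gtail e) : R^o)
  (fun=> igain R e : R^o)); last exact: cst_continuous.
by apply: (@continuousB _ R^o _ (fun x : W => fn x (ghead e) : R^o) (fun x : W => fn x (gtail e) : R^o)); apply: h.
Qed.

(** On a connected set that avoids the hyperplanes each [hv] keeps its sign by the intermediate
    value property; conversely cells are convex. *)
Lemma component_Cell (x : W) : arr_complement a b x ->
  connected_component (@arr_complement n a b) x = Cell (signs x).
Proof.
move=> cx; have Cx := Cell_signs cx; apply/seteqP; split => y.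
  move=> [B [Bx BC cB] By]; have [s0 _] := BC _ By; split => //; apply/cell0P => e eK.
  have : connected ((fun x : W => hv (fn x) e) @` B).
    apply: connected_continuous_connected => //; apply: continuous_subspaceT.
    exact: hv_continuous.
  move=> /connected_intervalP itv.
  have n0 z : B z -> hv (fn z) e != 0.
    move=> /BC[_ /(_ e eK) nh]; apply/eqP => h; apply: nh.
    by rewrite /hyperplane /=; move/eqP: h; rewrite subr_eq0 => /eqP.
  have Ix : ((fun x : W => hv (fn x) e) @` B) (hv (fn x) e) by exists x.
  have Iy : ((fun x : W => hv (fn x) e) @` B) (hv (fn y) e) by exists y.
  rewrite finset.inE eK /=; case: ifP => hx; rewrite lt_neqAle ?n0 //= leNgt.
    rewrite eq_sym n0 //=; apply/negP => hy.
    have [|z Bz z0] := itv _ _ Iy Ix 0; first by rewrite !ltW.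
    by have := n0 z Bz; rewrite z0 eqxx.
  apply/negP => hy; have [|z Bz z0] := itv _ _ Ix Iy 0.
    by rewrite (ltW hy) andbT leNgt hx.
  by have := n0 z Bz; rewrite z0 eqxx.
move=> Cy.
pose seg (t : R) : W := (1 - t) *: x + t *: y.
exists (seg @` `[0, 1]); last first.
  by exists 1; [rewrite /= in_itv /= ler01 lexx|rewrite /seg subrr scale0r add0r scale1r].
split.
- by exists 0; [rewrite /= in_itv /= ler01 lexx|rewrite /seg subr0 scale0r addr0 scale1r].
- move=> _ [t + <-]; rewrite /= in_itv /= => t01.
  exact: (@Cell_sub (signs x)) (Cell_convex Cx Cy t01).
- apply: connected_continuous_connected; first exact: segment_connected.
  apply: continuous_subspaceT => t.
  apply: cvgD.
    apply: cvgZr_tmp; apply: cvgB; [exact: cvg_cst|exact: cvg_id].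
  by apply: cvgZr_tmp; exact: cvg_id.
Qed.

Lemma norm_rV_le (x : W) (M : R) : 0 <= M -> (`|x| <= M) <-> (forall v, `|x ord0 v| <= M).
Proof.
move=> M0; rewrite /Num.norm /= mx_normrE; split.
  by move=> /bigmax_leP[_ h] v; apply: (h (ord0, v)).
by move=> h; apply/bigmax_leP; split => // -[i v] _ /=; rewrite (ord1 i).
Qed.

Lemma recenter (f : 'I_n -> R) : exists x : W, sum0_space x /\
  exists c, fn x = (fun v => f v - c).
Proof.
pose c := (\sum_i f i) / n%:R.
exists (\row_v (f v - c)); split; last by exists c; apply/funext => v; rewrite /fn mxE.
rewrite /sum0_space /=; under eq_bigr => i _ do rewrite mxE.
rewrite sumrB sumr_const card_ord -mulr_natr /c divfK ?subrr //.
by rewrite pnatr_eq0 -lt0n.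
Qed.

Lemma hv_translate (f : 'I_n -> R) c e : hv (fun v => f v - c) e = hv f e.
Proof. by rewrite /hv; ring. Qed.

Lemma cell_translate Z E P (f : 'I_n -> R) c :
  cell Z E P (fun v => f v - c) = cell Z E P f.
Proof.
by apply/cellP/cellP => -[h1 h2]; split => e he;
  [have := h1 e he|have := h2 e he|have := h1 e he|have := h2 e he]; rewrite hv_translate.
Qed.

Lemma Cell_nonempty P : feas finset.set0 K P -> exists x, Cell P x.
Proof.
move=> /asboolP[f cf]; have [x [sx [c xE]]] := recenter f; exists x; split => //.
by rewrite xE cell_translate.
Qed.

(** Each arc bounds a difference of coordinates by the largest gain, and simple paths are short; the
    zero sum turns bounded differences into bounded coordinates. *)
Lemma strong_bounded P : feas finset.set0 K P -> strong (dig finset.set0 K P) ->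
  bounded_set (Cell P).
Proof.
move=> fP /strongP st.
have [M0 M00 gb] : exists2 M0 : R, 0 <= M0 & forall e, `|igain R e| <= M0.
  exists (absz a + absz (b - a))%N%:R; first exact: ler0n.
  move=> e; rewrite /igain -intr_norm -abszE -pmulrn ler_nat.
  by rewrite /gain; have := ltn_ord e.2; rewrite /ngains; lia.
have arc (x : W) u v : Cell P x -> dig finset.set0 K P u v -> fn x u - fn x v <= M0.
  move=> [_ /cell0P c] /orP[/existsP[e /andP[]]|/existsP[e /andP[eK]]]; first by rewrite finset.inE.
  have := c e eK; have := gb e; rewrite ler_norml => /andP[g1 g2].
  by rewrite /hv; case: ifP => _ h /andP[/eqP<- /eqP<-]; lra.
have pth (x : W) u v : Cell P x -> fn x u - fn x v <= n%:R * M0.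
  move=> Cx; have /connectP[p0 pp0] := st u v; case/shortenP: pp0 => p pp up _ ->.
  have sz : (size p <= n)%N.
    by apply: leq_trans (leqnSn _) _; rewrite -[X in (X <= _)%N]/(size (u :: p)) -(card_uniqP up) -[X in (_ <= X)%N](card_ord n) max_card.
  apply: le_trans (_ : (size p)%:R * M0 <= _); last by rewrite ler_wpM2r // ler_nat.
  elim: p u pp {up sz} => [|w p IH] u /=; first by rewrite subrr mul0r.
  move=> /andP[uw pp]; have := IH _ pp; have := arc _ _ _ Cx uw.
  by rewrite -[(size p).+1]addn1 natrD mulrDl mul1r; lra.
have [x0 Cx0] := Cell_nonempty fP.
have PF : ProperFilter (globally (Cell P)) by apply: globally_properfilter Cx0.
apply: (@ex_bound _ _ _ (fun x : W => x) _ PF).2; exists (n%:R * M0) => x Cx /=.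
apply/norm_rV_le; first by rewrite mulr_ge0.
move=> v; have [s0 _] := Cx.
have nn : 0 < n%:R :> R by rewrite ltr0n.
have low : \sum_(i < n) (fn x i - fn x v) <= n%:R * (n%:R * M0).
  rewrite mulr_natl -[X in _ *+ X](card_ord n) -sumr_const.
  by apply: ler_sum => i _; apply: pth.
have upp : \sum_(i < n) (fn x v - fn x i) <= n%:R * (n%:R * M0).
  rewrite mulr_natl -[X in _ *+ X](card_ord n) -sumr_const.
  by apply: ler_sum => i _; apply: pth.
have s1 : \sum_(i < n) fn x i = 0 by exact: s0.
move: low; rewrite sumrB s1 sub0r sumr_const card_ord -[fn x v *+ n]mulr_natl -mulrN.
move: upp; rewrite sumrB s1 subr0 sumr_const card_ord -[fn x v *+ n]mulr_natl.
by rewrite !ler_pM2l // => upp low; rewrite ler_norml lerNl low upp.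
Qed.

Lemma bounded_strong P : feas finset.set0 K P -> bounded_set (Cell P) -> strong (dig finset.set0 K P).
Proof.
move=> fP bP; apply/strongP => u v; apply/negPn/negP => nc.
have [x0 Cx0] := Cell_nonempty fP.
have PF : ProperFilter (globally (Cell P)) by apply: globally_properfilter Cx0.
have [M hM] := (@ex_bound _ _ _ (fun x : W => x) _ PF).1 bP.
have M0 : 0 <= M by apply: le_trans (normr_ge0 x0) (hM _ Cx0).
(* Chosen so that the difference of the coordinates [u] and [v] becomes [2 * M + 1], too large when
   both are bounded by [M]. *)
pose t := 2 * M + 1 - (fn x0 u - fn x0 v).
have ub (x : W) w : Cell P x -> `|fn x w| <= M by move=> Cx; apply: (norm_rV_le x M0).1; apply: hM.
have t0 : 0 <= t.
  have := ub _ u Cx0; have := ub _ v Cx0; rewrite !ler_norml /t; lra.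
pose f := bump (fun w => connect (dig finset.set0 K P) u w) t (fn x0).
have cf : cell finset.set0 K P f.
  apply: cell_bump => //; last by case: Cx0.
  by move=> w w' ww' /connect_trans; apply; apply: connect1.
have [x [sx [c xE]]] := recenter f.
have Cx : Cell P x by split => //; rewrite xE cell_translate.
have := ub _ u Cx; have := ub _ v Cx; rewrite xE /f /bump connect0 (negPf nc) !ler_norml /t; lra.
Qed.

Lemma num_bounded_regions_bcount : num_bounded_regions n a b (bcount finset.set0 K).
Proof.
pose BP := finset (fun P : {set G} => (P \subset K) && bcell finset.set0 K P).
exists (fun i : 'I_(bcount finset.set0 K) => Cell (enum_val (A := BP) i)); split.
  move=> i j ij.
  have := enum_valP i; have := enum_valP j; rewrite !finset.inE => /andP[jK _] /andP[iK /andP[fi _]].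
  have [x Cx] := Cell_nonempty fi.
  apply: enum_val_inj; apply: (Cell_unique iK jK Cx).
  by move: Cx; rewrite ij.
move=> A; split.
  move=> [[x cx AE] bA]; have Cx := Cell_signs cx.
  have sK : signs x \subset K by apply/fintype.subsetP => e; rewrite finset.inE => /andP[].
  rewrite component_Cell // in AE.
  have fs : feas finset.set0 K (signs x) by apply/asboolP; exists (fn x); case: Cx.
  have sB : signs x \in BP.
    by rewrite finset.inE sK /bcell fs /=; apply: bounded_strong => //; rewrite -AE.
  by exists (enum_rank_in sB (signs x)); rewrite enum_rankK_in.
move=> [i ->]; have := enum_valP i; rewrite finset.inE => /andP[iK /andP[fi si]].
split; last exact: strong_bounded.
have [x Cx] := Cell_nonempty fi; exists x; first exact: Cell_sub Cx.
have cx := Cell_sub Cx; rewrite component_Cell //; congr Cell.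
apply: (Cell_unique iK _ Cx (Cell_signs cx)).
by apply/fintype.subsetP => e; rewrite finset.inE => /andP[].
Qed.
End Regions.

Lemma coef_nbc_poly (n k1 k2 alpha : nat) (r : gedge n.+1 (1 - k2%:Z) (k1 + k2)%N%:Z -> nat) :
  (nbc_poly r)`_alpha = (nbc_count r alpha)%:R.
Proof.
rewrite /nbc_poly coef_sum /nbc_count card_sum_nat natr_sum big_mkcond /=.
apply: eq_bigr => B _; rewrite coefXn.
case: asboolP => [nB|nB]; last by case: asboolP => // -[].
by rewrite eq_sym; congr ((nat_of_bool _)%:R); apply/eqP/asboolP => [|[]].
Qed.

Lemma nbc_count_tree_count (n k1 k2 alpha : nat)
    (r : gedge n.+1 (1 - k2%:Z) (k1 + k2)%N%:Z -> nat) : (0 < k1)%N ->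
  {in Kedges n.+1 (1 - k2%:Z) (k1 + k2)%N%:Z &, injective r} ->
  nbc_count r alpha = tree_count n.+1 k1 k2 alpha.
Proof.
move=> k1_gt0 r_inj; apply/eqP; rewrite -(eqr_nat rat).
by rewrite -coef_nbc_poly -(coef_tree_poly n k2 k1_gt0) (nbc_polyE k1_gt0 r_inj) tree_polyE.
Qed.

Local Close Scope ring_scope.

Theorem theorem4p3 (n k1 k2 alpha : nat)
    (r : gedge n (1 - k2%:Z) (k1 + k2)%:Z -> nat) :
  (2 <= n)%N -> (1 <= k1)%N -> (alpha <= n - 1)%N ->
  {in Kedges n (1 - k2%:Z) (k1 + k2)%:Z &, injective r} ->
  nbc_count r alpha = tree_count n k1 k2 alpha /\
  num_bounded_regions n (1 - k2%:Z) (k1 + k2)%:Z (tree_count n k1 k2 0).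
Proof.
case: n r => // n r _ k1_gt0 _ r_inj; split; first exact: nbc_count_tree_count.
rewrite -(nbc_count_tree_count 0 k1_gt0 r_inj) -(bcount_nbc (ltn0Sn n) r_inj).
exact: num_bounded_regions_bcount.
Qed.
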